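(* Let $\alpha>1$, $\beta\in\mathbb{C}$, and let $F_{\alpha,\beta}$ be the entire function defined in the context. Then for $-\pi-\pi/\alpha<\theta<0$, as $R\to\infty$, $$ \begin{aligned} F_{\alpha,\beta}(R\mathrm{e}^{\mathrm{i}\theta})&+\sum_{\beta+n\alpha+m+1=0}\frac{\mathrm{i}^n\mathrm{e}^{\mathrm{i}(\theta-\pi/2)m}R^m}{n!\,m!}\bigl(\log R+(\theta+\pi/2)\mathrm{i}\bigr)\\ &\sim\sum_{n=0}^\infty\frac{\exp\bigl(\mathrm{i}(n\pi/2-(\theta+\pi/2)(\beta+n\alpha+1))\bigr)\,\Gamma^{*}(\beta+n\alpha+1)}{n!\,R^{\beta+n\alpha+1}}, \end{aligned} $$ and this asymptotic expansion holds uniformly on closed subsectors, i.e. uniformly for $-\pi-\pi/\alpha+\varepsilon\le\theta\le-\varepsilon$ for each fixed (small) $\varepsilon>0$.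
   Context: For $\operatorname{Im}z<0$, $$ \begin{aligned} F_{\alpha,\beta}(z)=\mathrm{F.p.}\int_0^\infty t^\beta \mathrm{e}^{\mathrm{i}t^\alpha-\mathrm{i}zt}\,\mathrm{d}t:={}&\int_1^\infty t^\beta \mathrm{e}^{\mathrm{i}t^\alpha-\mathrm{i}zt}\,\mathrm{d}t+\int_0^1t^\beta\Bigl(\mathrm{e}^{\mathrm{i}t^\alpha-\mathrm{i}zt}-\sum_{m+n\alpha+\operatorname{Re}\beta\le-1}\frac{\mathrm{i}^n(-\mathrm{i}z)^m}{n!\,m!}t^{n\alpha+m}\Bigr)\mathrm{d}t\\ &+\sum'_{m+n\alpha+\operatorname{Re}\beta\le-1}\frac{\mathrm{i}^n(-\mathrm{i}z)^m}{n!\,m!}\,\frac{1}{\beta+n\alpha+m+1}, \end{aligned} $$ where $\sum'$ omits terms with $\beta+n\alpha+m+1=0$ (Hadamard finite part; the ordinary integral if $\operatorname{Re}\beta>-1$). This function extends to an entire function, also denoted $F_{\alpha,\beta}$. Sums with a condition involving $m,n$ run over pairs of integers $m,n\ge0$ satisfying it (finite, possibly empty). $\Gamma^{*}(z)=\Gamma(z)$ (Euler gamma function) if $z\notin\{0,-1,-2,\dots\}$, and for integers $k\ge0$, $\Gamma^{*}(-k)=\mathrm{F.p.}\int_0^\infty\mathrm{e}^{-t}t^{-k-1}\,\mathrm{d}t=\frac{(-1)^k}{k!}\bigl(-\gamma+\sum_{j=1}^k\frac1j\bigr)$, with $\gamma$ the Euler–Mascheroni constant. The relation $\sim$ is that of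 an asymptotic series: for each $N\ge0$, the left-hand side minus the sum of the terms $n<N$ on the right is $O(R^{-\operatorname{Re}\beta-N\alpha-1})$ as $R\to\infty$. *)

(* Defs.v *)
From Stdlib Require Import Reals Lra Lia ZArith.
From Coquelicot Require Import Coquelicot.
Open Scope R_scope.

(** ** Complex exponential, powers of positive reals, finite sums and products *)

Definition Cexp (z : C) : C := (exp (Re z) * cos (Im z), exp (Re z) * sin (Im z)).

(** [t ^ w] with the real logarithm; only meaningful for [0 < t]. *)
Definition Rcpow (t : R) (w : C) : C := Cexp (w * RtoC (ln t)).

(** [Csum a N] is the sum, and [Cprod a N] the product, of the [a k] with [k < N]. *)
Fixpoint Csum (a : nat -> C) (N : nat) : C :=
  match N with
  | O => RtoC 0
  | S k => (Csum a k + a k)%C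
  end.

Fixpoint Cprod (a : nat -> C) (N : nat) : C :=
  match N with
  | O => RtoC 1
  | S k => (Cprod a k * a k)%C
  end.

(** ** The Euler gamma function and its finite-part version *)

(** The Euler integral, convergent for [0 < Re z]. *)
Definition Gamma_integral (z : C) : C :=
  RInt_gen (V := C_R_CompleteNormedModule)
    (fun t : R => (RtoC (exp (- t)) * Rcpow t (z - 1))%C)
    (at_right 0) (Rbar_locally p_infty).

Definition Gamma_shift (z : C) : nat := Z.to_nat (up (- Re z)).

Lemma Gamma_shift_pos (z : C) : 0 < Re (z + INR (Gamma_shift z))%C.
Proof.
rewrite re_plus, re_RtoC; unfold Gamma_shift.
destruct (archimed (- Re z)) as [Hu _].
assert (H : IZR (up (- Re z)) <= INR (Z.to_nat (up (- Re z)))).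
{ rewrite INR_IZR_INZ; apply IZR_le; lia. }
lra.
Qed.

(** Meromorphic continuation by the functional equation
    [Gamma (z + N) = z (z + 1) ... (z + N - 1) Gamma z];
    the value at the poles is junk. *)
Definition Gamma (z : C) : C :=
  (Gamma_integral (z + INR (Gamma_shift z))
   / Cprod (fun j => z + INR j) (Gamma_shift z))%C.

Definition harmonic (k : nat) : R := sum_n_m (fun j => / INR j) 1 k.

Definition Euler_Mascheroni : R :=
  real (Lim_seq (fun n => harmonic n - ln (INR n))).

(** The finite part of the integral of [exp (- t) * t ^ (- k - 1)] over
    [(0, +oo)]. *)
Definition Gamma_fp (k : nat) : R :=
  (- 1) ^ k / INR (fact k) * (- Euler_Mascheroni + harmonic k).

(** If [z] is a nonpositive integer [- k], then [k] is [Int_part (- Re z)]. *)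
Definition Gamma_star (z : C) : C :=
  let k := Z.to_nat (Int_part (- Re z)) in
  if Ceq_dec z (RtoC (- INR k)) then RtoC (Gamma_fp k) else Gamma z.

Lemma Gamma_star_pole (k : nat) :
  Gamma_star (RtoC (- INR k)) = RtoC (Gamma_fp k).
Proof.
unfold Gamma_star; rewrite re_RtoC, Ropp_involutive, Int_part_INR, Nat2Z.id.
now destruct (Ceq_dec (RtoC (- INR k)) (RtoC (- INR k))).
Qed.

Lemma Gamma_star_regular (z : C) :
  (forall k : nat, z <> RtoC (- INR k)) -> Gamma_star z = Gamma z.
Proof.
intros H; unfold Gamma_star.
destruct (Ceq_dec _ _) as [e|]; [now destruct (H _ e)|reflexivity].
Qed.

(** ** Sums over the pairs [(m, n)] with [m + n alpha + Re beta <= -1] *)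

(** For [1 <= alpha], both [m] and [n] are below this bound for such a pair. *)
Definition index_bound (beta : C) : nat := Z.to_nat (up (- 1 - Re beta)).

Lemma index_bound_spec (alpha : R) (beta : C) (m n : nat) :
  1 <= alpha -> INR m + INR n * alpha + Re beta <= - 1 ->
  (m < index_bound beta)%nat /\ (n < index_bound beta)%nat.
Proof.
intros Ha H; unfold index_bound.
destruct (archimed (- 1 - Re beta)) as [Hu _].
pose proof (pos_INR m); pose proof (pos_INR n).
assert (Hn : INR n <= INR n * alpha) by nra.
assert (Hm' : INR m < IZR (up (- 1 - Re beta))) by lra.
assert (Hn' : INR n < IZR (up (- 1 - Re beta))) by lra.
rewrite INR_IZR_INZ in Hm', Hn'.
apply lt_IZR in Hm'; apply lt_IZR in Hn'; lia.
Qed.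

Definition low_sum (alpha : R) (beta : C) (c : nat -> nat -> C) : C :=
  Csum (fun m => Csum (fun n =>
    if Rle_dec (INR m + INR n * alpha + Re beta) (- 1) then c m n else RtoC 0)
    (index_bound beta)) (index_bound beta).

(** ** The function [F] *)

Definition F_coef (z : C) (m n : nat) : C :=
  (Ci ^ n * (- Ci * z) ^ m / (INR (fact n) * INR (fact m)))%C.

Definition F_exponent (alpha : R) (beta : C) (m n : nat) : C :=
  (beta + INR n * alpha + INR m + 1)%C.

Definition F_exp (alpha : R) (z : C) (t : R) : C :=
  Cexp (Ci * Rpower t alpha - Ci * z * t)%C.

(** The Hadamard finite part, for [Im z < 0]. *)
Definition F_finite_part (alpha : R) (beta z : C) : C :=
  (RInt_gen (V := C_R_CompleteNormedModule)
     (fun t : R => (Rcpow t beta * F_exp alpha z t)%C)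
     (at_point 1) (Rbar_locally p_infty)
   + RInt_gen (V := C_R_CompleteNormedModule)
     (fun t : R => (Rcpow t beta *
        (F_exp alpha z t
         - low_sum alpha beta (fun m n =>
             F_coef z m n * Rpower t (INR n * alpha + INR m))))%C)
     (at_right 0) (at_point 1)
   + low_sum alpha beta (fun m n =>
       if Ceq_dec (F_exponent alpha beta m n) (RtoC 0) then RtoC 0
       else F_coef z m n * (1 / F_exponent alpha beta m n)))%C.

Definition entire (F : C -> C) : Prop :=
  forall z : C, @ex_derive C_AbsRing C_NormedModule F z.

Definition is_F (alpha : R) (beta : C) (F : C -> C) : Prop :=
  entire F /\ forall z : C, Im z < 0 -> F z = F_finite_part alpha beta z.

(** ** The asymptotic expansion along [z = r exp (i theta)] *)

(** The sum over [beta + n alpha + m + 1 = 0]; this equation implies the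
    condition built into [low_sum]. *)
Definition log_sum (alpha : R) (beta : C) (theta r : R) : C :=
  low_sum alpha beta (fun m n =>
    if Ceq_dec (F_exponent alpha beta m n) (RtoC 0) then
      (Ci ^ n * Cexp (Ci * (theta - PI / 2) * INR m) * RtoC (r ^ m)
       / (INR (fact n) * INR (fact m))
       * (ln r + (theta + PI / 2) * Ci))%C
    else RtoC 0).

Definition expansion_term (alpha : R) (beta : C) (theta r : R) (n : nat) : C :=
  (Cexp (Ci * (INR n * PI / 2 - (theta + PI / 2) * (beta + INR n * alpha + 1)))
   * Gamma_star (beta + INR n * alpha + 1)
   / (INR (fact n) * Rcpow r (beta + INR n * alpha + 1)))%C.

(** The expansion holds as [r -> +oo], uniformly for [theta] in [T]. *)
Definition expansion_on (alpha : R) (beta : C) (F : C -> C) (T : R -> Prop) : Prop :=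
  forall N : nat, exists K r0 : R, 0 < r0 /\
    forall theta r : R, T theta -> r0 <= r ->
      Cmod (F (RtoC r * Cexp (Ci * theta)) + log_sum alpha beta theta r
            - Csum (expansion_term alpha beta theta r) N)%C
      <= K * Rpower r (- Re beta - INR N * alpha - 1).

(* Main.v *)
Require Import Defs.
From Stdlib Require Import Reals Lra Lia ZArith Classical IndefiniteDescription.
From Coquelicot Require Import Coquelicot.
Open Scope R_scope.

(** Substitute [t = exp x].  With [b = beta + 1], [a = - i] and [lam = i z] the
integrand becomes [exp (b x - a exp (alpha x) - lam exp x)], an entire function
of [x]; the powers of [t] in its expansion at [t = 0] become exponentials
[exp (w x)], and rotating the ray of integration in the [t]-plane becomes
translating the real line in the [x]-plane.  The Hadamard finite part is the
limit of [int_p^q f + S p] as [p -> - oo] and [q -> + oo], where [S] is a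
primitive of those exponentials, with [x] as the primitive of the constant 1
([is_fp]).  In this form finite parts are linear, and by Cauchy's theorem a
translation of the line by [Lam] replaces [f] and [S] by their translates and
keeps the value ([fp_shift]).  Since [exp_prim w (x + Lam)] is a multiple of
[exp_prim w x] except for [w = 0], where [Lam] is added, all logarithms of the
theorem come from the terms with [w = 0] ([integrand_fp_shift]).

Continuation.  For [Im z < 0], [F z] is such a finite part ([F_integrand_fp]).
If the line is translated by [i phi] with [0 < phi < pi / alpha], then [a] gets
a positive real part, the integral converges for every [z], and its value is an
entire function of [z] ([entire_finite_part]).  Both functions agree on a small
disc, where the translation is allowed, hence everywhere
([rotation_continues]).  As [F] is only known to be complex differentiable, the
identity theorem starts from Goursat's theorem: Goursat's theorem for the
function [Q (w + exp zeta)], which has period [2 pi i], gives the maximum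
principle [circle_bound], and applying it to [D z / z ^ n] for all [n] shows
that an entire [D] vanishing near 0 is zero ([entire_zero]).

Expansion.  On a fixed line, replace the factor [exp (- a exp (alpha x))] by
its Taylor polynomial; since [Re a >= 0], the error is bounded by a power of
[exp (alpha x)], which gives the remainder estimate ([watson_remainder]).  The
terms are finite parts of [exp (v x - lam exp x)].  For [lam = 1] they are the
values of [Gamma_star] ([gamma_star_fp]), by the functional equation and, at
[v = 0], a computation of Euler's constant; a translation of the line by a
logarithm of [lam] gives the general case ([laplace_fp]).

The lines [phi = 0] and [phi] slightly below [pi / alpha] each give the
expansion, uniformly, on a closed subsector of opening less than [pi]
([ray_expansion]), and two such subsectors cover the required one because
[alpha > 1] ([sector_expansion]). *)

(** The complex numbers as a real normed space. *)
Local Notation CV := C_R_CompleteNormedModule.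

(** * Complex derivatives, and complex integrals over real intervals *)

Lemma Rlt_div_mult (x e c : R) : 0 < c -> x < e / c -> x * c < e.
Proof.
intros Hc H; apply (Rmult_lt_compat_r c) in H; [|exact Hc].
now replace (e / c * c) with e in H by (field; lra).
Qed.

(** Differentiability for the multiplication of [C] as a normed ring, the
    structure for which the product and chain rules are available; [entire_holo]
    compares it with the structure used by [entire]. *)
Definition Cdiff (g : C -> C) (z l : C) : Prop :=
  @is_derive C_AbsRing (AbsRing_NormedModule C_AbsRing) g z l.

Definition CInt (f : R -> C) (a b : R) : C :=
  RInt (V := CV) f a b.

Definition Rcont (f : R -> C) (x : R) : Prop :=
  @continuous R_UniformSpace CV f x.

Lemma norm_C_R (x : C) : @norm R_AbsRing CV x = Cmod x.
Proof.
unfold norm; simpl; unfold prod_norm, Cmod; simpl.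
unfold norm; simpl; unfold abs; simpl.
f_equal; rewrite !Rmult_1_r, <- !Rabs_mult, !(Rabs_pos_eq (_ * _)); nra.
Qed.

Lemma Cdiff_eps (g : C -> C) (z l : C) :
  Cdiff g z l <->
  forall eps : R, 0 < eps -> exists d, 0 < d /\
    forall w, Cmod (w - z) < d ->
      Cmod (g w - g z - (w - z) * l)%C <= eps * Cmod (w - z)%C.
Proof.
split.
- intros [_ H] eps He.
  destruct (H z (fun P HP => HP) (mkposreal eps He)) as [d Hd].
  exists d; split; [apply d|]; intros w Hw.
  exact (Hd w Hw).
- intros H; split.
  + apply is_linear_scal_l.
  + intros x Hx.
    apply (is_filter_lim_locally_unique (K := C_AbsRing)
      (V := AbsRing_NormedModule C_AbsRing)) in Hx; rewrite <- Hx.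
    intros [eps He]; destruct (H eps He) as (d & Hd & H').
    exists (mkposreal d Hd); intros w Hw; apply H', Hw.
Qed.

Lemma Cdiff_const (c z : C) : Cdiff (fun _ => c) z (RtoC 0).
Proof. exact (is_derive_const (K := C_AbsRing) (V := AbsRing_NormedModule C_AbsRing) c z). Qed.

Lemma Cdiff_id (z : C) : Cdiff (fun x => x) z (RtoC 1).
Proof. exact (is_derive_id (K := C_AbsRing) z). Qed.

Lemma Cdiff_val (g : C -> C) (z l l' : C) : Cdiff g z l -> l = l' -> Cdiff g z l'.
Proof. now intros H <-. Qed.

Lemma Cdiff_plus (f g : C -> C) (z a b : C) :
  Cdiff f z a -> Cdiff g z b -> Cdiff (fun x => f x + g x)%C z (a + b)%C.
Proof.
exact (is_derive_plus (K := C_AbsRing) (V := AbsRing_NormedModule C_AbsRing) f g z a b).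
Qed.

Lemma Cdiff_mult (f g : C -> C) (z a b : C) :
  Cdiff f z a -> Cdiff g z b -> Cdiff (fun x => f x * g x)%C z (a * g z + f z * b)%C.
Proof.
intros Hf Hg.
exact (is_derive_mult (K := C_AbsRing) f g z a b Hf Hg Cmult_comm).
Qed.

Lemma Cdiff_comp (f g : C -> C) (z a b : C) :
  Cdiff f (g z) a -> Cdiff g z b -> Cdiff (fun x => f (g x)) z (b * a)%C.
Proof.
exact (is_derive_comp (K := C_AbsRing) (V := AbsRing_NormedModule C_AbsRing) f g z a b).
Qed.

Lemma Cdiff_ext (f g : C -> C) (z l : C) :
  (forall x, f x = g x) -> Cdiff f z l -> Cdiff g z l.
Proof.
exact (is_derive_ext (K := C_AbsRing) (V := AbsRing_NormedModule C_AbsRing) f g z l).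
Qed.

Lemma Cdiff_scal (c : C) (g : C -> C) (z l : C) :
  Cdiff g z l -> Cdiff (fun x => c * g x)%C z (c * l)%C.
Proof.
intros H; eapply Cdiff_val; [apply Cdiff_mult; [apply Cdiff_const|exact H]|].
cbv beta; ring.
Qed.

Lemma Cdiff_minus (f g : C -> C) (z a b : C) :
  Cdiff f z a -> Cdiff g z b -> Cdiff (fun x => f x - g x)%C z (a - b)%C.
Proof.
exact (is_derive_minus (K := C_AbsRing) (V := AbsRing_NormedModule C_AbsRing) f g z a b).
Qed.

Lemma Cdiff_Csum (g : nat -> C -> C) (l : nat -> C) (z : C) (N : nat) :
  (forall k, (k < N)%nat -> Cdiff (g k) z (l k)) ->
  Cdiff (fun x => Csum (fun k => g k x) N) z (Csum l N).
Proof.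
induction N as [|N IH]; intros H; simpl.
- apply Cdiff_const.
- apply Cdiff_plus; [apply IH; intros; apply H; lia|apply H; lia].
Qed.

Definition Ccont (g : C -> C) (z : C) : Prop :=
  forall eps, 0 < eps -> exists d, 0 < d /\
    forall w, Cmod (w - z) < d -> Cmod (g w - g z)%C < eps.

Lemma Cdiff_cont (g : C -> C) (z l : C) : Cdiff g z l -> Ccont g z.
Proof.
rewrite Cdiff_eps; intros H eps He.
destruct (H 1 Rlt_0_1) as (d & Hd & H1).
pose proof (Cmod_ge_0 l).
assert (Hp : 0 < eps / (2 + Cmod l)) by (apply Rdiv_lt_0_compat; lra).
exists (Rmin d (eps / (2 + Cmod l))); split; [now apply Rmin_pos|].
intros w Hw.
specialize (H1 w (Rlt_le_trans _ _ _ Hw (Rmin_l _ _))).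
assert (H2 := Rlt_le_trans _ _ _ Hw (Rmin_r _ _)).
replace (g w - g z)%C with ((g w - g z - (w - z) * l) + (w - z) * l)%C by ring.
eapply Rle_lt_trans; [apply Cmod_triangle|].
rewrite Cmod_mult.
pose proof (Cmod_ge_0 (w - z)%C).
assert (Cmod (w - z)%C * (2 + Cmod l) < eps).
{ apply Rlt_div_mult in H2; [|lra]; lra. }
nra.
Qed.

Lemma Rcont_eps (f : R -> C) (x : R) :
  Rcont f x <-> forall eps, 0 < eps -> exists d, 0 < d /\
    forall y, Rabs (y - x) < d -> Cmod (f y - f x)%C < eps.
Proof.
split.
- intros H eps He.
  assert (He2 : 0 < eps / 2) by lra.
  destruct (proj1 (filterlim_locally f (f x)) H (mkposreal _ He2)) as [d Hd].
  exists d; split; [apply d|]; intros y Hy.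
  specialize (Hd y Hy); destruct Hd as [H1 H2].
  unfold ball in H1, H2; simpl in H1, H2; unfold AbsRing_ball, minus, plus, opp, abs in H1, H2.
  simpl in H1, H2.
  eapply Rle_lt_trans; [apply Cmod_2Rmax|].
  assert (sqrt 2 < 2).
  { rewrite <- (sqrt_Rsqr 2) at 2 by lra. apply sqrt_lt_1; unfold Rsqr; lra. }
  pose proof (sqrt_pos 2).
  assert (Rmax (Rabs (fst (f y - f x)%C)) (Rabs (snd (f y - f x)%C)) < eps / 2)
    by now apply Rmax_lub_lt.
  assert (0 <= Rmax (Rabs (fst (f y - f x)%C)) (Rabs (snd (f y - f x)%C))).
  { eapply Rle_trans; [apply Rabs_pos|apply Rmax_l]. }
  nra.
- intros H; apply filterlim_locally; intros eps.
  destruct (H eps (cond_pos eps)) as (d & Hd & H').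
  exists (mkposreal d Hd); intros y Hy.
  specialize (H' y Hy).
  pose proof (Rmax_Cmod (f y - f x)%C) as Hm.
  split; unfold ball; simpl; unfold AbsRing_ball, minus, plus, opp, abs; simpl.
  + eapply Rle_lt_trans; [|exact H']; eapply Rle_trans; [apply Rmax_l|exact Hm].
  + eapply Rle_lt_trans; [|exact H']; eapply Rle_trans; [apply Rmax_r|exact Hm].
Qed.

Lemma Rcont_line (g : C -> C) (p u : C) (x : R) :
  Ccont g (p + x * u)%C -> Rcont (fun t : R => g (p + t * u)%C) x.
Proof.
intros H; apply Rcont_eps; intros eps He.
destruct (H eps He) as (d & Hd & H').
pose proof (Cmod_ge_0 u).
assert (Hp : 0 < d / (1 + Cmod u)) by (apply Rdiv_lt_0_compat; lra).
exists (d / (1 + Cmod u)); split; [exact Hp|].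
intros y Hy; apply H'.
replace (p + y * u - (p + x * u))%C with (RtoC (y - x) * u)%C
  by (rewrite RtoC_minus; ring).
rewrite Cmod_mult, Cmod_R.
apply Rlt_div_mult in Hy; [|lra].
pose proof (Rabs_pos (y - x)); nra.
Qed.

Lemma Rcont_ext (f g : R -> C) (x : R) :
  (forall y, f y = g y) -> Rcont f x -> Rcont g x.
Proof. intros H; apply continuous_ext; exact H. Qed.

Lemma Rcont_plus (f g : R -> C) (x : R) :
  Rcont f x -> Rcont g x -> Rcont (fun t => f t + g t)%C x.
Proof. exact (continuous_plus (V := CV) f g x). Qed.

Lemma Rcont_minus (f g : R -> C) (x : R) :
  Rcont f x -> Rcont g x -> Rcont (fun t => f t - g t)%C x.
Proof. exact (continuous_minus (V := CV) f g x). Qed.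

Lemma Rcont_const (c : C) (x : R) : Rcont (fun _ => c) x.
Proof. apply continuous_const. Qed.

Lemma Rcont_mult (f g : R -> C) (x : R) :
  Rcont f x -> Rcont g x -> Rcont (fun t => f t * g t)%C x.
Proof.
rewrite !Rcont_eps; intros Hf Hg eps He.
pose proof (Cmod_ge_0 (f x)); pose proof (Cmod_ge_0 (g x)).
set (M := 2 + Cmod (f x) + Cmod (g x)).
assert (HM : 0 < M) by (unfold M; lra).
assert (Hp : 0 < Rmin 1 (eps / (2 * M))).
{ apply Rmin_pos; [lra|apply Rdiv_lt_0_compat; lra]. }
destruct (Hf _ Hp) as (d1 & Hd1 & H1).
destruct (Hg _ Hp) as (d2 & Hd2 & H2).
exists (Rmin d1 d2); split; [now apply Rmin_pos|]; intros y Hy.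
specialize (H1 y (Rlt_le_trans _ _ _ Hy (Rmin_l _ _))).
specialize (H2 y (Rlt_le_trans _ _ _ Hy (Rmin_r _ _))).
replace (f y * g y - f x * g x)%C
  with ((f y - f x) * (g y - g x) + (f y - f x) * g x + f x * (g y - g x))%C by ring.
set (e := Rmin 1 (eps / (2 * M))) in *.
assert (He1 : e <= 1) by apply Rmin_l.
assert (He2 : e * (2 * M) <= eps).
{ replace eps with (eps / (2 * M) * (2 * M)) by (field; lra).
  apply Rmult_le_compat_r; [lra|apply Rmin_r]. }
eapply Rle_lt_trans; [apply Cmod_triangle|].
eapply Rle_lt_trans; [apply Rplus_le_compat_r, Cmod_triangle|].
rewrite !Cmod_mult.
pose proof (Cmod_ge_0 (f y - f x)%C); pose proof (Cmod_ge_0 (g y - g x)%C).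
unfold M in *; nra.
Qed.

Lemma Rcont_scal (c : C) (g : R -> C) (x : R) :
  Rcont g x -> Rcont (fun t => c * g t)%C x.
Proof. intros H; apply Rcont_mult; [apply Rcont_const|exact H]. Qed.

Lemma Rcont_Csum (g : nat -> R -> C) (x : R) (N : nat) :
  (forall k, (k < N)%nat -> Rcont (g k) x) ->
  Rcont (fun t => Csum (fun k => g k t) N) x.
Proof.
induction N as [|N IH]; intros H; simpl.
- apply Rcont_const.
- apply Rcont_plus; [apply IH; intros; apply H; lia|apply H; lia].
Qed.

Lemma ex_CI (f : R -> C) (a b : R) :
  (forall x, Rcont f x) -> ex_RInt (V := CV) f a b.
Proof. intros H; apply ex_RInt_continuous; intros; apply H. Qed.

Lemma CInt_plus (f g : R -> C) (a b : R) :
  (forall x, Rcont f x) -> (forall x, Rcont g x) ->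
  CInt (fun x => f x + g x)%C a b = (CInt f a b + CInt g a b)%C.
Proof.
intros Hf Hg.
exact (RInt_plus (V := CV) f g a b (ex_CI f a b Hf) (ex_CI g a b Hg)).
Qed.

Lemma CInt_minus (f g : R -> C) (a b : R) :
  (forall x, Rcont f x) -> (forall x, Rcont g x) ->
  CInt (fun x => f x - g x)%C a b = (CInt f a b - CInt g a b)%C.
Proof.
intros Hf Hg.
exact (RInt_minus (V := CV) f g a b (ex_CI f a b Hf) (ex_CI g a b Hg)).
Qed.

Lemma CInt_ext (f g : R -> C) (a b : R) :
  (forall x, f x = g x) -> CInt f a b = CInt g a b.
Proof.
intros H; exact (RInt_ext (V := CV) f g a b (fun x _ => H x)).
Qed.

Lemma CInt_Chasles (f : R -> C) (a b c : R) :
  (forall x, Rcont f x) -> (CInt f a b + CInt f b c = CInt f a c)%C.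
Proof.
intros H.
exact (RInt_Chasles (V := CV) f a b c (ex_CI f a b H) (ex_CI f b c H)).
Qed.

(** The integral in a real normed space is real linear; the complex
    linearity [CInt_scal] is checked on components. *)
Lemma CInt_pair (f : R -> C) (a b : R) :
  (forall x, Rcont f x) ->
  CInt f a b = (RInt (fun x => fst (f x)) a b, RInt (fun x => snd (f x)) a b).
Proof.
intros H; apply (is_RInt_unique (V := CV)).
apply (is_RInt_fct_extend_pair (U := R_NormedModule) (V := R_NormedModule));
apply (RInt_correct (V := R_CompleteNormedModule)), ex_RInt_continuous; intros x _.
- exact (continuous_comp f fst x (H x) (continuous_fst (fst (f x)) (snd (f x)))).
- exact (continuous_comp f snd x (H x) (continuous_snd (fst (f x)) (snd (f x)))).
Qed.

Lemma ex_RInt_fst (f : R -> C) (a b : R) :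
  (forall x, Rcont f x) -> ex_RInt (fun x => fst (f x)) a b.
Proof.
intros H; apply (ex_RInt_continuous (V := R_CompleteNormedModule)); intros x _.
exact (continuous_comp f fst x (H x) (continuous_fst (fst (f x)) (snd (f x)))).
Qed.

Lemma ex_RInt_snd (f : R -> C) (a b : R) :
  (forall x, Rcont f x) -> ex_RInt (fun x => snd (f x)) a b.
Proof.
intros H; apply (ex_RInt_continuous (V := R_CompleteNormedModule)); intros x _.
exact (continuous_comp f snd x (H x) (continuous_snd (fst (f x)) (snd (f x)))).
Qed.

Lemma CInt_scal (c : C) (f : R -> C) (a b : R) :
  (forall x, Rcont f x) -> CInt (fun x => c * f x)%C a b = (c * CInt f a b)%C.
Proof.
intros H.
rewrite (CInt_pair (fun x => c * f x)%C) by (intros; now apply Rcont_scal).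
rewrite (CInt_pair f) by exact H.
destruct c as [u v]; unfold Cmult; simpl.
pose proof (ex_RInt_fst f a b H) as E1; pose proof (ex_RInt_snd f a b H) as E2.
f_equal.
- rewrite (RInt_minus (V := R_CompleteNormedModule) (fun x => u * fst (f x)) (fun x => v * snd (f x)))
    by (now apply (ex_RInt_scal (V := R_CompleteNormedModule))).
  rewrite !(RInt_scal (V := R_CompleteNormedModule)) by assumption.
  reflexivity.
- rewrite (RInt_plus (V := R_CompleteNormedModule) (fun x => u * snd (f x)) (fun x => v * fst (f x)))
    by (now apply (ex_RInt_scal (V := R_CompleteNormedModule))).
  rewrite !(RInt_scal (V := R_CompleteNormedModule)) by assumption.
  reflexivity.
Qed.

Lemma CInt_const (c : C) (a b : R) : CInt (fun _ => c) a b = (RtoC (b - a) * c)%C.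
Proof.
unfold CInt; rewrite RInt_const. destruct c; unfold Cmult; simpl.
unfold scal; simpl; unfold prod_scal, scal; simpl; unfold mult; simpl.
f_equal; ring.
Qed.

Lemma CInt_bound (f : R -> C) (g : R -> R) (a b : R) :
  a <= b -> (forall x, Rcont f x) -> (forall x, continuous g x) ->
  (forall x, a <= x <= b -> Cmod (f x) <= g x) ->
  Cmod (CInt f a b) <= RInt g a b.
Proof.
intros Hab Hf Hg H.
rewrite <- norm_C_R.
apply (norm_RInt_le (V := CV) f g a b); [exact Hab| | |].
- intros x Hx; rewrite norm_C_R; now apply H.
- apply (RInt_correct (V := CV)), ex_CI, Hf.
- apply (RInt_correct (V := R_CompleteNormedModule)), ex_RInt_continuous; intros; apply Hg.
Qed.

Lemma CInt_bound_const (f : R -> C) (M : R) (a b : R) :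
  a <= b -> (forall x, Rcont f x) ->
  (forall x, a <= x <= b -> Cmod (f x) <= M) ->
  Cmod (CInt f a b) <= (b - a) * M.
Proof.
intros Hab Hf H.
eapply Rle_trans; [apply (CInt_bound f (fun _ => M)); auto; intros; apply continuous_const|].
rewrite RInt_const; unfold scal; simpl; unfold mult; simpl; lra.
Qed.

Lemma CInt_lin (f : R -> C) (u v a b : R) :
  (forall x, Rcont f x) ->
  CInt (fun y => RtoC u * f (u * y + v)%R)%C a b = CInt f (u * a + v) (u * b + v).
Proof.
intros H; unfold CInt.
rewrite <- (RInt_comp_lin (V := CV)) by (apply ex_CI, H).
apply (RInt_ext (V := CV)); intros x _. now rewrite <- scal_R_Cmult.
Qed.

Lemma Cdiff_is_derive_R (g : C -> C) (p u l : C) (x : R) :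
  Cdiff g (p + x * u)%C l ->
  @is_derive R_AbsRing CV (fun t : R => g (p + t * u)%C) x (u * l)%C.
Proof.
rewrite Cdiff_eps; intros H; split.
- apply is_linear_scal_l.
- intros y Hy.
  apply (is_filter_lim_locally_unique (K := R_AbsRing) (V := R_NormedModule)) in Hy.
  rewrite <- Hy; clear y Hy.
  intros eps; pose proof (Cmod_ge_0 u).
  assert (He : 0 < eps / (1 + Cmod u)).
  { apply Rdiv_lt_0_compat; [apply eps|lra]. }
  destruct (H _ He) as (d & Hd & H').
  assert (Hp : 0 < d / (1 + Cmod u)) by (apply Rdiv_lt_0_compat; lra).
  exists (mkposreal _ Hp); intros y Hy.
  rewrite norm_C_R.
  assert (E : (p + y * u - (p + x * u))%C = (RtoC (y - x) * u)%C)
    by (rewrite RtoC_minus; ring).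
  specialize (H' (p + y * u)%C); rewrite E in H'.
  rewrite Cmod_mult, Cmod_R in H'.
  assert (Hy' : Rabs (y - x) < d / (1 + Cmod u)) by exact Hy.
  assert (HR : Rabs (y - x) * Cmod u < d).
  { apply Rlt_div_mult in Hy'; [|lra].
    pose proof (Rabs_pos (y - x)); nra. }
  specialize (H' HR).
  match goal with |- Cmod ?X <= _ =>
    replace X with (g (p + y * u) - g (p + x * u) - RtoC (y - x) * u * l)%C end.
  2:{ apply injective_projections; simpl;
      unfold minus, plus, opp, scal; simpl; unfold mult; simpl; ring. }
  eapply Rle_trans; [exact H'|].
  change (norm (minus y x)) with (Rabs (y - x)).
  pose proof (Rabs_pos (y - x)).
  apply Rle_trans with (eps / (1 + Cmod u) * (Rabs (y - x) * (1 + Cmod u))).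
  + apply Rmult_le_compat_l; [lra|]. apply Rmult_le_compat_l; lra.
  + right; field; lra.
Qed.

Lemma CInt_FTC (g dg : C -> C) (p u : C) (a b : R) :
  (forall z, Cdiff g z (dg z)) -> (forall z, Ccont dg z) ->
  CInt (fun x => u * dg (p + x * u))%C a b = (g (p + b * u) - g (p + a * u))%C.
Proof.
intros Hg Hc; apply (is_RInt_unique (V := CV)).
apply (is_RInt_derive (V := CV) (fun t => g (p + RtoC t * u)%C)).
- intros x _; apply Cdiff_is_derive_R, Hg.
- intros x _; apply (Rcont_scal u), Rcont_line, Hc.
Qed.

Lemma Cdiff_mean_value (g dg : C -> C) (p q : C) (M : R) :
  (forall z, Cdiff g z (dg z)) -> (forall z, Ccont dg z) ->
  (forall s : R, 0 <= s <= 1 -> Cmod (dg (p + s * (q - p)))%C <= M) ->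
  Cmod (g q - g p)%C <= M * Cmod (q - p)%C.
Proof.
intros Hg Hc HM.
pose proof (CInt_FTC g dg p (q - p)%C 0 1 Hg Hc) as E.
replace (p + 1 * (q - p))%C with q in E by ring.
replace (p + 0 * (q - p))%C with p in E by ring.
rewrite <- E.
eapply Rle_trans; [apply (CInt_bound_const _ (M * Cmod (q - p)%C)); [lra| |]|lra].
- intros x; apply Rcont_scal, Rcont_line, Hc.
- intros x Hx; rewrite Cmod_mult, Rmult_comm.
  apply Rmult_le_compat_r; [apply Cmod_ge_0|now apply HM].
Qed.

Lemma Cexp_plus (z w : C) : Cexp (z + w) = (Cexp z * Cexp w)%C.
Proof.
destruct z as [a b], w as [c d]; unfold Cexp, Cmult, Re, Im; simpl.
rewrite exp_plus, cos_plus, sin_plus; f_equal; ring.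
Qed.

Lemma Cexp_0 : Cexp (RtoC 0) = RtoC 1.
Proof.
unfold Cexp, RtoC, Re, Im; simpl; rewrite exp_0, cos_0, sin_0; f_equal; ring.
Qed.

Lemma Cexp_R (x : R) : Cexp (RtoC x) = RtoC (exp x).
Proof.
unfold Cexp, RtoC, Re, Im; simpl; rewrite cos_0, sin_0; f_equal; ring.
Qed.

Lemma Cmod_Cexp (z : C) : Cmod (Cexp z) = exp (Re z).
Proof.
unfold Cmod, Cexp; simpl.
replace (_ + _) with (Rsqr (exp (Re z))).
- rewrite sqrt_Rsqr; [reflexivity|left; apply exp_pos].
- pose proof (sin2_cos2 (Im z)); unfold Rsqr in *; nra.
Qed.

Lemma Cexp_nz (z : C) : Cexp z <> RtoC 0.
Proof. apply Cmod_gt_0; rewrite Cmod_Cexp; apply exp_pos. Qed.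

Lemma Cexp_opp (z : C) : Cexp (- z) = (/ Cexp z)%C.
Proof.
pose proof (Cexp_nz z).
assert (E : (Cexp (- z) * Cexp z = 1)%C).
{ rewrite <- Cexp_plus; replace (- z + z)%C with (RtoC 0) by ring; apply Cexp_0. }
replace (Cexp (- z)) with (Cexp (- z) * Cexp z / Cexp z)%C by (field; auto).
rewrite E; unfold Cdiv; ring.
Qed.

Lemma Cexp_minus (z w : C) : Cexp (z - w) = (Cexp z / Cexp w)%C.
Proof. unfold Cminus, Cdiv; now rewrite Cexp_plus, Cexp_opp. Qed.

Lemma Cexp_pow (z : C) (n : nat) : (Cexp z ^ n)%C = Cexp (INR n * z).
Proof.
induction n as [|n IH].
- simpl; replace (0 * z)%C with (RtoC 0) by ring; now rewrite Cexp_0.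
- rewrite Cpow_S, IH, <- Cexp_plus, S_INR, RtoC_plus; f_equal; ring.
Qed.

Lemma derive_at_0 (f : R -> R) (l eps : R) :
  derivable_pt_lim f 0 l -> 0 < eps ->
  exists d, 0 < d /\ forall x, Rabs x < d -> Rabs (f x - f 0 - l * x) <= eps * Rabs x.
Proof.
intros H He; destruct (H eps He) as [[d Hd] H']; exists d; split; [exact Hd|].
intros x Hx; destruct (Req_dec x 0) as [->|Hne].
- replace (f 0 - f 0 - l * 0) with 0 by ring; rewrite !Rabs_R0; lra.
- specialize (H' x Hne Hx); rewrite Rplus_0_l in H'.
  replace (f x - f 0 - l * x) with (((f x - f 0) / x - l) * x) by (field; exact Hne).
  rewrite Rabs_mult; apply Rmult_le_compat_r; [apply Rabs_pos|lra].
Qed.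

(** With [h = a + i b], the two components of [exp h - 1 - h] are
    [exp a (cos b - 1) + (exp a - 1 - a)] and
    [exp a (sin b - b) + (exp a - 1) b]. *)
Lemma Cdiff_Cexp_0 (eps : R) : 0 < eps -> exists d, 0 < d /\
  forall h, Cmod h < d -> Cmod (Cexp h - 1 - h)%C <= eps * Cmod h.
Proof.
intros He; set (e := Rmin 1 (eps / 16)).
assert (He0 : 0 < e) by (apply Rmin_pos; lra).
assert (He1 : e <= 1) by apply Rmin_l.
assert (He2 : 16 * e <= eps) by (pose proof (Rmin_r 1 (eps / 16)); fold e in H; lra).
assert (D1 := derivable_pt_lim_exp 0); rewrite exp_0 in D1.
assert (D2 := derivable_pt_lim_cos 0); rewrite sin_0, Ropp_0 in D2.
assert (D3 := derivable_pt_lim_sin 0); rewrite cos_0 in D3.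
destruct (derive_at_0 exp 1 e D1 He0) as (d1 & Hd1 & H1).
destruct (derive_at_0 cos 0 e D2 He0) as (d2 & Hd2 & H2).
destruct (derive_at_0 sin 1 e D3 He0) as (d3 & Hd3 & H3).
rewrite exp_0 in H1; rewrite cos_0 in H2; rewrite sin_0 in H3.
exists (Rmin (Rmin d1 d2) (Rmin d3 (e / 2))); split.
{ repeat apply Rmin_pos; lra. }
intros [a b] Hh.
assert (Hm := Rmax_Cmod (a, b)); simpl fst in Hm; simpl snd in Hm.
assert (Ha : Rabs a <= Cmod (a, b)) by (eapply Rle_trans; [apply Rmax_l|exact Hm]).
assert (Hb : Rabs b <= Cmod (a, b)) by (eapply Rle_trans; [apply Rmax_r|exact Hm]).
set (m := Cmod (a, b)) in *.
assert (m < d1 /\ m < d2 /\ m < d3 /\ m < e / 2) as (L1 & L2 & L3 & L4).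
{ pose proof (Rmin_l (Rmin d1 d2) (Rmin d3 (e / 2))); pose proof (Rmin_r (Rmin d1 d2) (Rmin d3 (e / 2))).
  pose proof (Rmin_l d1 d2); pose proof (Rmin_r d1 d2); pose proof (Rmin_l d3 (e / 2)).
  pose proof (Rmin_r d3 (e / 2)); lra. }
specialize (H1 a ltac:(lra)); specialize (H2 b ltac:(lra)); specialize (H3 b ltac:(lra)).
eapply Rle_trans; [apply Cmod_2Rmax|].
assert (S2 : sqrt 2 < 2).
{ rewrite <- (sqrt_Rsqr 2) at 2 by lra; apply sqrt_lt_1; unfold Rsqr; lra. }
pose proof (sqrt_pos 2) as S0.
unfold Cexp, Re, Im; simpl.
set (E := exp a) in *; set (c := cos b) in *; set (s := sin b) in *.
pose proof (Rabs_pos a); pose proof (Rabs_pos b).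
assert (HE : Rabs (E - 1) <= e).
{ replace (E - 1) with ((E - 1 - 1 * a) + a) by ring.
  eapply Rle_trans; [apply Rabs_triang|].
  assert (e * Rabs a <= 1 * Rabs a) by (apply Rmult_le_compat_r; lra).
  lra. }
assert (HE2 : Rabs E <= 2).
{ replace E with (E - 1 + 1) by ring; eapply Rle_trans; [apply Rabs_triang|].
  rewrite Rabs_R1; lra. }
assert (B : Rmax (Rabs (E * c + - (1) + - a)) (Rabs (E * s + - 0 + - b)) <= 3 * e * m).
{ apply Rmax_lub.
  - replace (E * c + - (1) + - a) with (E * (c - 1 - 0 * b) + (E - 1 - 1 * a)) by ring.
    eapply Rle_trans; [apply Rabs_triang|]; rewrite Rabs_mult.
    assert (Rabs E * Rabs (c - 1 - 0 * b) <= 2 * (e * Rabs b)) by (apply Rmult_le_compat; auto using Rabs_pos).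
    nra.
  - replace (E * s + - 0 + - b) with (E * (s - 0 - 1 * b) + (E - 1) * b) by ring.
    eapply Rle_trans; [apply Rabs_triang|]; rewrite !Rabs_mult.
    assert (Rabs E * Rabs (s - 0 - 1 * b) <= 2 * (e * Rabs b)) by (apply Rmult_le_compat; auto using Rabs_pos).
    assert (Rabs (E - 1) * Rabs b <= e * Rabs b) by (apply Rmult_le_compat_r; auto).
    nra. }
assert (0 <= m) by lra.
match type of B with ?Y <= _ => set (X := Y) in * end.
assert (0 <= X) by (unfold X; eapply Rle_trans; [apply Rabs_pos|apply Rmax_l]).
assert (sqrt 2 * X <= 2 * (3 * e * m)) by (apply Rmult_le_compat; lra).
assert (6 * e * m <= eps * m) by (apply Rmult_le_compat_r; lra).
lra.
Qed.

Lemma Cdiff_Cexp (z : C) : Cdiff Cexp z (Cexp z).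
Proof.
rewrite Cdiff_eps; intros eps He.
pose proof (Cmod_gt_0 (Cexp z)) as [Hz _]; specialize (Hz (Cexp_nz z)).
destruct (Cdiff_Cexp_0 (eps / Cmod (Cexp z))) as (d & Hd & H).
{ apply Rdiv_lt_0_compat; lra. }
exists d; split; [exact Hd|]; intros w Hw; specialize (H _ Hw).
replace (Cexp w) with (Cexp z * Cexp (w - z))%C
  by (rewrite <- Cexp_plus; f_equal; ring).
replace (Cexp z * Cexp (w - z) - Cexp z - (w - z) * Cexp z)%C
  with (Cexp z * (Cexp (w - z) - 1 - (w - z)))%C by ring.
rewrite Cmod_mult.
apply Rle_trans with (Cmod (Cexp z) * (eps / Cmod (Cexp z) * Cmod (w - z)%C)).
- apply Rmult_le_compat_l; lra.
- right; field; lra.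
Qed.

Definition holo (f : C -> C) : Prop := forall z, exists l, Cdiff f z l.

Lemma holo_const (c : C) : holo (fun _ => c).
Proof. intros z; eexists; apply Cdiff_const. Qed.

Lemma holo_id : holo (fun z => z).
Proof. intros z; eexists; apply Cdiff_id. Qed.

Lemma holo_Cexp : holo Cexp.
Proof. intros z; eexists; apply Cdiff_Cexp. Qed.

Lemma holo_ext (f g : C -> C) : (forall z, f z = g z) -> holo f -> holo g.
Proof. intros E H z; destruct (H z) as [l Hl]; exists l; exact (Cdiff_ext f g z l E Hl). Qed.

Lemma holo_plus (f g : C -> C) : holo f -> holo g -> holo (fun z => f z + g z)%C.
Proof.
intros Hf Hg z; destruct (Hf z), (Hg z); eexists; apply (Cdiff_plus f g); eassumption.
Qed.

Lemma holo_minus (f g : C -> C) : holo f -> holo g -> holo (fun z => f z - g z)%C.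
Proof.
intros Hf Hg z; destruct (Hf z), (Hg z); eexists; apply (Cdiff_minus f g); eassumption.
Qed.

Lemma holo_mult (f g : C -> C) : holo f -> holo g -> holo (fun z => f z * g z)%C.
Proof.
intros Hf Hg z; destruct (Hf z), (Hg z); eexists; apply (Cdiff_mult f g); eassumption.
Qed.

Lemma holo_opp (f : C -> C) : holo f -> holo (fun z => - f z)%C.
Proof.
intros H; apply holo_ext with (fun z => 0 - f z)%C; [intros; ring|].
apply (holo_minus (fun _ => RtoC 0)); [apply holo_const|exact H].
Qed.

Lemma holo_comp (f g : C -> C) : holo f -> holo g -> holo (fun z => f (g z)).
Proof.
intros Hf Hg z; destruct (Hg z) as [b Hb]; destruct (Hf (g z)) as [a Ha].
eexists; apply (Cdiff_comp f g); eassumption.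
Qed.

Lemma holo_Csum (f : nat -> C -> C) (N : nat) :
  (forall k, holo (f k)) -> holo (fun z => Csum (fun k => f k z) N).
Proof.
intros H; induction N as [|N IH]; [exact (holo_const (RtoC 0))|].
exact (holo_plus (fun z => Csum (fun k => f k z) N) (f N) IH (H N)).
Qed.

Lemma holo_Ccont (f : C -> C) (z : C) : holo f -> Ccont f z.
Proof. intros H; destruct (H z) as [l Hl]; exact (Cdiff_cont f z l Hl). Qed.

Lemma Rcont_holo (f : C -> C) (x : R) : holo f -> Rcont (fun t : R => f (RtoC t)) x.
Proof.
intros H; apply Rcont_ext with (fun t : R => f (0 + t * 1)%C).
- intros y; f_equal; ring.
- now apply Rcont_line, holo_Ccont.
Qed.

Lemma entire_holo (F : C -> C) : entire F <-> holo F.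
Proof.
split; intros H z; destruct (H z) as [l [_ Hl]]; exists l.
- split; [apply is_linear_scal_l|exact Hl].
- split; [apply @is_linear_scal_l|exact Hl].
Qed.

Create HintDb holo.
#[global] Hint Resolve holo_id holo_const holo_Cexp : holo.

Global Opaque Cdiff Rcont CInt.

Ltac cdiff := cbv beta;
  lazymatch goal with
  | |- Cdiff (fun x => x) _ _ => apply Cdiff_id
  | |- Cdiff (fun _ => ?c) _ _ => apply Cdiff_const
  | |- Cdiff (fun x => (@?f x + @?g x)%C) _ _ => apply (Cdiff_plus f g); cdiff
  | |- Cdiff (fun x => (@?f x - @?g x)%C) _ _ => apply (Cdiff_minus f g); cdiff
  | |- Cdiff (fun x => (@?f x * @?g x)%C) _ _ => apply (Cdiff_mult f g); cdiff
  | |- Cdiff (fun x => Cexp (@?g x)) _ _ => apply (Cdiff_comp Cexp g); [apply Cdiff_Cexp|cdiff]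
  | |- Cdiff Cexp _ _ => apply Cdiff_Cexp
  end.

Ltac holo := cbv beta;
  lazymatch goal with
  | |- holo (fun x => x) => apply holo_id
  | |- holo (fun _ => ?c) => apply holo_const
  | |- holo (fun x => (@?f x + @?g x)%C) => apply (holo_plus f g); holo
  | |- holo (fun x => (@?f x - @?g x)%C) => apply (holo_minus f g); holo
  | |- holo (fun x => (@?f x * @?g x)%C) => apply (holo_mult f g); holo
  | |- holo (fun x => (- @?f x)%C) => apply (holo_opp f); holo
  | |- holo (fun x => Csum (fun k => @?f x k) ?N) =>
      apply (holo_Csum (fun k x => f x k)); intros ?; holo
  | |- holo (fun x => ?F (@?g x)) => apply (holo_comp F g); holo
  | |- _ => auto with holo
  end.

(** * Goursat's theorem *)

Definition seg_integral (g : C -> C) (p u : C) : C :=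
  (u * CInt (fun s => g (p + s * u)) 0 1)%C.

(** The contour is the parallelogram with corner [p] and sides [u] and
    [v]; parallelograms, and not only rectangles, are swept by a line that is
    translated by a complex number. *)
Definition boundary_integral (g : C -> C) (p u v : C) : C :=
  (seg_integral g p u + seg_integral g (p + u) v - seg_integral g (p + v) u - seg_integral g p v)%C.

Lemma seg_halves (g : C -> C) (p u : C) :
  (forall z, Ccont g z) ->
  seg_integral g p u = (seg_integral g p (u / 2) + seg_integral g (p + u / 2) (u / 2))%C.
Proof.
intros Hg; unfold seg_integral.
assert (Hc : forall q w x, Rcont (fun s : R => g (q + s * w)%C) x)
  by (intros; apply Rcont_line, Hg).
rewrite <- (CInt_Chasles _ 0 (1 / 2) 1) by apply Hc.
pose proof (CInt_lin (fun s : R => g (p + s * u)%C) (1 / 2) 0 0 1 (Hc p u)) as E1.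
pose proof (CInt_lin (fun s : R => g (p + s * u)%C) (1 / 2) (1 / 2) 0 1 (Hc p u)) as E2.
replace (1 / 2 * 0 + 0) with 0 in E1 by field.
replace (1 / 2 * 1 + 0) with (1 / 2) in E1 by field.
replace (1 / 2 * 0 + 1 / 2) with (1 / 2) in E2 by field.
replace (1 / 2 * 1 + 1 / 2) with 1 in E2 by field.
rewrite <- E1, <- E2.
assert (Hh : RtoC (1 / 2) = (/ 2)%C) by (unfold Rdiv; rewrite RtoC_mult, RtoC_inv by lra; ring).
rewrite (CInt_ext _ (fun s : R => RtoC (1 / 2) * g (p + s * (u / 2)))%C).
2:{ intros x; f_equal; f_equal.
    rewrite RtoC_plus, RtoC_mult, Hh. unfold Cdiv; ring. }
rewrite (CInt_ext (fun y => RtoC (1 / 2) * g (p + RtoC (1 / 2 * y + 1 / 2) * u))%C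
  (fun s : R => RtoC (1 / 2) * g (p + u / 2 + s * (u / 2)))%C).
2:{ intros x; f_equal; f_equal.
    rewrite RtoC_plus, RtoC_mult, Hh. unfold Cdiv; ring. }
rewrite !CInt_scal by apply Hc.
rewrite Hh; unfold Cdiv; ring.
Qed.

(** The four inner edges are run through twice, in opposite directions. *)
Lemma boundary_quarters (g : C -> C) (p u v : C) :
  (forall z, Ccont g z) ->
  boundary_integral g p u v =
  (boundary_integral g p (u / 2) (v / 2) + boundary_integral g (p + u / 2) (u / 2) (v / 2)
   + boundary_integral g (p + v / 2) (u / 2) (v / 2)
   + boundary_integral g (p + u / 2 + v / 2) (u / 2) (v / 2))%C.
Proof.
intros Hg; unfold boundary_integral.
rewrite (seg_halves g p u), (seg_halves g (p + u) v), (seg_halves g (p + v) u),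
  (seg_halves g p v) by exact Hg.
replace (p + u / 2 + u / 2)%C with (p + u)%C by field.
replace (p + v / 2 + v / 2)%C with (p + v)%C by field.
replace (p + u / 2 + v / 2 + u / 2)%C with (p + u + v / 2)%C by field.
replace (p + v / 2 + u / 2)%C with (p + u / 2 + v / 2)%C by field.
replace (p + u / 2 + v / 2 + v / 2)%C with (p + v + u / 2)%C by field.
ring.
Qed.

Lemma seg_primitive (h H : C -> C) (p u : C) :
  (forall z, Cdiff H z (h z)) -> (forall z, Ccont h z) ->
  seg_integral h p u = (H (p + u) - H p)%C.
Proof.
intros HH Hh; unfold seg_integral; rewrite <- CInt_scal by (intros; apply Rcont_line, Hh).
rewrite (CInt_FTC H h p u 0 1 HH Hh).
f_equal; [f_equal; ring|f_equal; f_equal; ring].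
Qed.

Lemma seg_bound (r : C -> C) (p u : C) (M : R) :
  (forall z, Ccont r z) ->
  (forall s : R, 0 <= s <= 1 -> Cmod (r (p + s * u)%C) <= M) ->
  Cmod (seg_integral r p u) <= Cmod u * M.
Proof.
intros Hr HM; unfold seg_integral; rewrite Cmod_mult.
apply Rmult_le_compat_l; [apply Cmod_ge_0|].
eapply Rle_trans; [apply (CInt_bound_const _ M); [lra| |exact HM]|lra].
intros; apply Rcont_line, Hr.
Qed.

Lemma Ccont_minus (f g : C -> C) (z : C) :
  Ccont f z -> Ccont g z -> Ccont (fun x => f x - g x)%C z.
Proof.
intros Hf Hg eps He.
destruct (Hf (eps / 2)) as (d1 & Hd1 & H1); [lra|].
destruct (Hg (eps / 2)) as (d2 & Hd2 & H2); [lra|].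
exists (Rmin d1 d2); split; [now apply Rmin_pos|]; intros w Hw.
specialize (H1 w (Rlt_le_trans _ _ _ Hw (Rmin_l _ _))).
specialize (H2 w (Rlt_le_trans _ _ _ Hw (Rmin_r _ _))).
replace (f w - g w - (f z - g z))%C with ((f w - f z) + - (g w - g z))%C by ring.
eapply Rle_lt_trans; [apply Cmod_triangle|]; rewrite Cmod_opp; lra.
Qed.

Lemma seg_minus (f g : C -> C) (p u : C) :
  (forall z, Ccont f z) -> (forall z, Ccont g z) ->
  seg_integral (fun x => f x - g x)%C p u = (seg_integral f p u - seg_integral g p u)%C.
Proof.
intros Hf Hg; unfold seg_integral.
rewrite (CInt_minus (fun s : R => f (p + s * u)%C) (fun s : R => g (p + s * u)%C))
  by (intros; now apply Rcont_line).
ring.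
Qed.

(** The affine function [g q + (z - q) l] has a primitive and contributes
    nothing, so only the deviation of [g] from it counts. *)
Lemma boundary_small (g : C -> C) (p u v q l : C) (eta D : R) :
  (forall z, Ccont g z) ->
  (forall s t : R, 0 <= s <= 1 -> 0 <= t <= 1 ->
     Cmod (g (p + s * u + t * v) - g q - (p + s * u + t * v - q) * l)%C <= eta * D) ->
  Cmod (boundary_integral g p u v) <= 2 * (Cmod u + Cmod v) * (eta * D).
Proof.
intros Hg H.
set (h := fun w : C => (g q + (w - q) * l)%C).
set (H1 := fun w : C => (w * g q + (w - q) * (w - q) * (l / 2))%C).
assert (HH : forall z, Cdiff H1 z (h z)).
{ intros z; unfold H1, h; eapply Cdiff_val; [cdiff|field]. }
assert (Hh : forall z, Ccont h z).
{ intros z; apply holo_Ccont; unfold h; holo. }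
set (r := fun w : C => (g w - h w)%C).
assert (Hr : forall z, Ccont r z) by (intros; now apply Ccont_minus).
assert (E : boundary_integral g p u v = boundary_integral r p u v).
{ assert (Es : forall p' u', seg_integral r p' u' = (seg_integral g p' u' - (H1 (p' + u') - H1 p'))%C).
  { intros; unfold r; rewrite seg_minus by assumption.
    now rewrite (seg_primitive h H1). }
  unfold boundary_integral; rewrite !Es.
  replace (p + u + v)%C with (p + v + u)%C by ring.
  ring. }
assert (B : forall s t : R, 0 <= s <= 1 -> 0 <= t <= 1 ->
  Cmod (r (p + s * u + t * v)%C) <= eta * D).
{ intros s t Hs Ht; specialize (H s t Hs Ht); unfold r, h.
  replace (g (p + s * u + t * v) - (g q + (p + s * u + t * v - q) * l))%C
    with (g (p + s * u + t * v) - g q - (p + s * u + t * v - q) * l)%C by ring.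
  exact H. }
rewrite E; unfold boundary_integral, Cminus.
eapply Rle_trans; [apply Cmod_triangle|].
eapply Rle_trans; [apply Rplus_le_compat_r, Cmod_triangle|].
eapply Rle_trans; [apply Rplus_le_compat_r, Rplus_le_compat_r, Cmod_triangle|].
rewrite !Cmod_opp.
assert (B1 : Cmod (seg_integral r p u) <= Cmod u * (eta * D)).
{ apply seg_bound; [exact Hr|]; intros s Hs.
  replace (p + s * u)%C with (p + s * u + 0 * v)%C by ring; apply B; lra. }
assert (B2 : Cmod (seg_integral r (p + u) v) <= Cmod v * (eta * D)).
{ apply seg_bound; [exact Hr|]; intros s Hs.
  replace (p + u + s * v)%C with (p + 1 * u + s * v)%C by ring; apply B; lra. }
assert (B3 : Cmod (seg_integral r (p + v) u) <= Cmod u * (eta * D)).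
{ apply seg_bound; [exact Hr|]; intros s Hs.
  replace (p + v + s * u)%C with (p + s * u + 1 * v)%C by ring; apply B; lra. }
assert (B4 : Cmod (seg_integral r p v) <= Cmod v * (eta * D)).
{ apply seg_bound; [exact Hr|]; intros s Hs.
  replace (p + s * v)%C with (p + 0 * u + s * v)%C by ring; apply B; lra. }
lra.
Qed.

Lemma four_quarters (a b c d : C) (m : R) :
  m <= Cmod (a + b + c + d)%C -> ~ m / 4 <= Cmod a -> ~ m / 4 <= Cmod b ->
  ~ m / 4 <= Cmod c -> m / 4 <= Cmod d.
Proof.
intros H Ha Hb Hc.
pose proof (Cmod_triangle (a + b + c)%C d); pose proof (Cmod_triangle (a + b)%C c).
pose proof (Cmod_triangle a b); lra.
Qed.

(** Bisection: among the four quarters, one carries at least a quarter of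
    the integral.  The quarters chosen successively shrink to a point [q], and
    differentiability at [q] makes the integral over the n-th one
    [o(4 ^ (- n))]. *)
Theorem Goursat (g : C -> C) (p u v : C) :
  holo g -> boundary_integral g p u v = RtoC 0.
Proof.
intros Hd.
assert (Hg : forall z, Ccont g z) by (intros; now apply holo_Ccont).
apply Cmod_eq_0; destruct (Req_dec (Cmod (boundary_integral g p u v)) 0) as [|Hne]; [assumption|exfalso].
set (c := Cmod (boundary_integral g p u v)) in *.
assert (Hc : 0 < c) by (pose proof (Cmod_ge_0 (boundary_integral g p u v)); unfold c in *; lra).
set (h := fun n : nat => (/ 2) ^ n).
assert (hS : forall n, h (S n) = h n / 2) by (intros; unfold h; simpl; field).
assert (hp : forall n, 0 < h n) by (intros; apply pow_lt; lra).
set (P := fun st : R * R => (p + fst st * u + snd st * v)%C).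
set (J := fun n st => Cmod (boundary_integral g (P st) (h n * u)%C (h n * v)%C)).
(* The pair [st] gives the corner [P st] of the current parallelogram in units
   of [u] and [v]; [step] selects a quarter that carries at least a quarter of
   the integral. *)
set (step := fun n st =>
  let q := c * (/ 4) ^ S n in let e := h (S n) in
  if Rle_dec q (J (S n) st) then st
  else if Rle_dec q (J (S n) (fst st + e, snd st)) then (fst st + e, snd st)
  else if Rle_dec q (J (S n) (fst st, snd st + e)) then (fst st, snd st + e)
  else (fst st + e, snd st + e)).
set (Q := fix Q n := match n with O => (0, 0) | S k => step k (Q k) end).
assert (HQ : forall n, c * (/ 4) ^ n <= J n (Q n)).
{ induction n as [|n IH].
  - simpl; unfold J, P, h; simpl.
    rewrite !Cmult_1_l, !Cmult_0_l, !Cplus_0_r; fold c; lra.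
  - simpl Q; unfold step at 1; cbv zeta.
    unfold J in IH.
    rewrite boundary_quarters in IH by exact Hg.
    assert (Eh : forall w : C, (RtoC (h n) * w / 2)%C = (RtoC (h (S n)) * w)%C).
    { intros w; rewrite hS; unfold Rdiv; rewrite RtoC_mult, RtoC_inv by lra; field. }
    rewrite !Eh in IH.
    assert (E4 : c * (/ 4) ^ S n = c * (/ 4) ^ n / 4) by (simpl; field).
    destruct (Q n) as [s t]; simpl fst; simpl snd.
    assert (Eu : (P (s, t) + h (S n) * u)%C = P (s + h (S n), t))
      by (unfold P; simpl; rewrite RtoC_plus; ring).
    assert (Ev : (P (s, t) + h (S n) * v)%C = P (s, t + h (S n)))
      by (unfold P; simpl; rewrite RtoC_plus; ring).
    assert (Euv : (P ((s + h (S n))%R, t) + h (S n) * v)%C = P (s + h (S n), t + h (S n)))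
      by (unfold P; simpl; rewrite !RtoC_plus; ring).
    rewrite Eu, Ev, Euv in IH.
    destruct (Rle_dec _ (J (S n) (s, t))) as [H1|H1]; [exact H1|].
    destruct (Rle_dec _ (J (S n) (s + h (S n), t))) as [H2|H2]; [exact H2|].
    destruct (Rle_dec _ (J (S n) (s, t + h (S n)))) as [H3|H3]; [exact H3|].
    rewrite E4 in *; unfold J in *.
    exact (four_quarters _ _ _ _ _ IH H1 H2 H3). }
assert (Hst : forall n, (fst (Q n) <= fst (Q (S n)) <= fst (Q n) + h (S n)) /\
                        (snd (Q n) <= snd (Q (S n)) <= snd (Q n) + h (S n))).
{ intros n; simpl Q; unfold step; cbv zeta; pose proof (hp (S n)).
  repeat match goal with |- context [if ?b then _ else _] => destruct b end;
    cbv beta iota delta [fst snd]; destruct (Q n); lra. }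
assert (lim : forall a : nat -> R, (forall n, a n <= a (S n) <= a n + h (S n)) ->
  exists s, forall n, a n <= s <= a n + h n).
{ intros a Ha.
  assert (Hup : forall n, a n + h n <= a O + 1).
  { induction n; [unfold h; simpl; lra|].
    pose proof (Ha n); pose proof (hS n); lra. }
  destruct (ex_finite_lim_seq_incr a (a O + 1)) as [s Hs].
  - intros n; apply Ha.
  - intros n; pose proof (Hup n); pose proof (hp n); lra.
  - exists s; intros n; split.
    + apply (is_lim_seq_incr_compare a s Hs); intros; apply Ha.
    + assert (Hs2 : is_lim_seq (fun n => a n + h n) s).
      { replace (Finite s) with (Rbar_plus s 0) by (simpl; f_equal; ring).
        apply is_lim_seq_plus'; [exact Hs|].
        apply is_lim_seq_geom; rewrite Rabs_pos_eq; lra. }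
      apply (is_lim_seq_decr_compare (fun n => a n + h n) s Hs2).
      intros k; pose proof (Ha k); pose proof (hS k); lra. }
destruct (lim (fun n => fst (Q n)) (fun n => proj1 (Hst n))) as [s Hs].
destruct (lim (fun n => snd (Q n)) (fun n => proj2 (Hst n))) as [t Ht].
set (q := P (s, t)).
set (U := Cmod u + Cmod v).
assert (HU : 0 <= U) by (pose proof (Cmod_ge_0 u); pose proof (Cmod_ge_0 v); unfold U; lra).
destruct (Hd q) as [l Hl]; rewrite Cdiff_eps in Hl.
(* At scale [h] the bound of [boundary_small] is [2 eta (h U) ^ 2]; this choice
   makes it smaller than [c h ^ 2]. *)
set (eta := c / (4 * (U + 1) * (U + 1))).
assert (Heta : 0 < eta) by (apply Rdiv_lt_0_compat; nra).
destruct (Hl eta Heta) as (d & Hdp & Hd').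
destruct (pow_lt_1_zero (/ 2) ltac:(rewrite Rabs_pos_eq; lra) (d / (U + 1))
  ltac:(apply Rdiv_lt_0_compat; lra)) as [n Hn].
specialize (Hn n (le_n n)); fold (h n) in Hn; rewrite Rabs_pos_eq in Hn by (left; apply hp).
assert (HnU : h n * (U + 1) < d).
{ apply Rlt_div_mult in Hn; [|lra]; lra. }
pose proof (hp n) as hn.
assert (B := boundary_small g (P (Q n)) (h n * u) (h n * v) q l eta (h n * U) Hg).
assert (B' : Cmod (boundary_integral g (P (Q n)) (h n * u) (h n * v)) <=
  2 * (Cmod (h n * u) + Cmod (h n * v)) * (eta * (h n * U))).
{ apply B; intros x y Hx Hy.
  assert (Ed : (P (Q n) + x * (h n * u) + y * (h n * v) - q)%C =
    (RtoC (fst (Q n) + x * h n - s) * u + RtoC (snd (Q n) + y * h n - t) * v)%C).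
  { unfold q, P; simpl; rewrite !RtoC_minus, !RtoC_plus, !RtoC_mult; ring. }
  assert (Bd : Cmod (P (Q n) + x * (h n * u) + y * (h n * v) - q)%C <= h n * U).
  { rewrite Ed; eapply Rle_trans; [apply Cmod_triangle|]; rewrite !Cmod_mult, !Cmod_R.
    specialize (Hs n); specialize (Ht n).
    assert (Rabs (fst (Q n) + x * h n - s) <= h n) by (apply Rabs_le; nra).
    assert (Rabs (snd (Q n) + y * h n - t) <= h n) by (apply Rabs_le; nra).
    pose proof (Cmod_ge_0 u); pose proof (Cmod_ge_0 v); unfold U; nra. }
  eapply Rle_trans; [apply Hd'|].
  - nra.
  - apply Rmult_le_compat_l; lra. }
clear B.
pose proof (HQ n) as HQn; unfold J in HQn.
rewrite !Cmod_mult, !Cmod_R, !(Rabs_pos_eq (h n)) in B' by lra.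
assert (E4 : (/ 4) ^ n = h n * h n).
{ unfold h; rewrite <- Rpow_mult_distr; f_equal; field. }
rewrite E4 in HQn.
assert (Ee : eta * (4 * (U + 1) * (U + 1)) = c) by (unfold eta; field; lra).
replace (2 * (h n * Cmod u + h n * Cmod v) * (eta * (h n * U)))
  with (h n * h n * (2 * eta * U * U)) in B' by (unfold U; ring).
assert (c * (h n * h n) <= h n * h n * (2 * eta * U * U)) by lra.
assert (0 < h n * h n) by nra.
assert (c <= 2 * eta * U * U) by nra.
assert (2 * eta * U * U < eta * (4 * (U + 1) * (U + 1))) by nra.
lra.
Qed.

(** * The identity theorem for entire functions *)

Lemma Cdiff_local (f g : C -> C) (z l : C) (d : R) :
  0 < d -> (forall w, Cmod (w - z) < d -> f w = g w) -> Cdiff f z l -> Cdiff g z l.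
Proof.
intros Hd H; rewrite !Cdiff_eps; intros Hf eps He.
destruct (Hf eps He) as (d' & Hd' & H').
exists (Rmin d d'); split; [now apply Rmin_pos|]; intros w Hw.
rewrite <- (H w), <- (H z).
- apply H'; eapply Rlt_le_trans; [exact Hw|apply Rmin_r].
- replace (z - z)%C with (RtoC 0) by ring; rewrite Cmod_0; exact Hd.
- eapply Rlt_le_trans; [exact Hw|apply Rmin_l].
Qed.

Lemma Cdiff_inv (z : C) : z <> RtoC 0 -> Cdiff Cinv z (- / (z * z))%C.
Proof.
intros Hz; rewrite Cdiff_eps; intros eps He.
assert (Hm := proj1 (Cmod_gt_0 z) Hz); set (m := Cmod z) in *.
exists (Rmin (m / 2) (eps * (m * m * m) / 2)); split.
{ apply Rmin_pos; [lra|]. assert (0 < eps * (m * m * m)) by (repeat apply Rmult_lt_0_compat; lra); lra. }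
intros w Hw.
assert (H1 := Rlt_le_trans _ _ _ Hw (Rmin_l _ _)).
assert (H2 := Rlt_le_trans _ _ _ Hw (Rmin_r _ _)).
assert (Hwm : m / 2 <= Cmod w).
{ pose proof (Cmod_triangle w (z - w)%C) as T.
  replace (w + (z - w))%C with z in T by ring.
  replace (z - w)%C with (- (w - z))%C in T by ring; rewrite Cmod_opp in T.
  fold m in T; lra. }
assert (Hw0 : w <> RtoC 0) by (apply Cmod_gt_0; lra).
replace (/ w - / z - (w - z) * - / (z * z))%C
  with ((w - z) * (w - z) / (w * (z * z)))%C by (field; auto).
rewrite Cmod_div by (repeat apply Cmult_neq_0; assumption).
rewrite !Cmod_mult; fold m.
pose proof (Cmod_ge_0 (w - z)%C) as Hn; set (n := Cmod (w - z)%C) in *.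
set (k := Cmod w) in *.
assert (Hd : 0 < k * (m * m)) by (apply Rmult_lt_0_compat; [lra|nra]).
apply Rmult_le_reg_r with (k * (m * m)); [exact Hd|].
unfold Rdiv at 1; rewrite Rmult_assoc, Rinv_l by lra.
assert (m / 2 * (m * m) <= k * (m * m)) by (apply Rmult_le_compat_r; nra).
assert (n <= eps * (k * (m * m))) by nra.
nra.
Qed.

(** The function [Q (w + exp zeta)] has period [2 pi i], so by Goursat's
    theorem its integral over a vertical period does not depend on the abscissa;
    as the abscissa tends to [- oo], the integral tends to [2 pi i Q w]. *)
Lemma circle_bound (Q : C -> C) (w : C) (x M : R) :
  holo Q ->
  (forall s : R, 0 <= s <= 1 -> Cmod (Q (w + Cexp (x + s * (2 * PI * Ci))))%C <= M) ->
  Cmod (Q w) <= M.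
Proof.
intros HQ HM.
set (v := (2 * PI * Ci)%C).
set (G := fun z : C => Q (w + Cexp z)%C).
assert (HG : holo G) by (unfold G; holo).
assert (HGc : forall z, Ccont G z) by (intros; now apply holo_Ccont).
assert (Per : forall z, G (z + v)%C = G z).
{ intros z; unfold G; f_equal; f_equal; rewrite Cexp_plus.
  replace (Cexp v) with (RtoC 1); [ring|].
  unfold Cexp, v; simpl.
  replace ((2 * PI - 0 * 0) * 0 - (2 * 0 + 0 * PI) * 1) with 0 by ring.
  replace ((2 * PI - 0 * 0) * 1 + (2 * 0 + 0 * PI) * 0) with (2 * PI) by ring.
  rewrite exp_0, cos_2PI, sin_2PI; unfold RtoC; f_equal; ring. }
assert (Hv : 0 < Cmod v).
{ unfold v; rewrite !Cmod_mult, !Cmod_R, Cmod_Ci, !Rabs_pos_eq; pose proof PI_RGT_0; lra. }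
assert (Hconst : forall y : R, seg_integral G x v = seg_integral G y v).
{ intros y; pose proof (Goursat G x (RtoC (y - x)) v HG) as E.
  unfold boundary_integral in E.
  replace (seg_integral G (x + v) (y - x)%R) with (seg_integral G x (y - x)%R) in E.
  - replace (RtoC x + RtoC (y - x))%C with (RtoC y) in E by (rewrite RtoC_minus; ring).
    replace (seg_integral G x v) with (seg_integral G x v + (seg_integral G x (y - x)%R + seg_integral G y v - seg_integral G x (y - x)%R - seg_integral G x v))%C
      by (rewrite E; ring).
    ring.
  - unfold seg_integral; f_equal; apply CInt_ext; intros s.
    rewrite <- (Per (x + s * (y - x)%R)%C); f_equal; ring. }
assert (Heq : seg_integral G x v = (v * Q w)%C).
{ destruct (Ceq_dec (seg_integral G x v - v * Q w)%C (RtoC 0)) as [E|Hne].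
  { rewrite <- (Cplus_0_r (v * Q w)), <- E; ring. }
  exfalso; apply Cmod_gt_0 in Hne; set (e := Cmod _) in Hne.
  destruct (holo_Ccont Q w HQ (e / (2 * Cmod v))) as (d & Hd & H').
  { apply Rdiv_lt_0_compat; lra. }
  assert (B : e <= Cmod v * (e / (2 * Cmod v))).
  { unfold e at 1; rewrite (Hconst (ln (d / 2))); unfold seg_integral.
    replace (v * CInt (fun s => G (ln (d / 2) + s * v)) 0 1 - v * Q w)%C
      with (v * (CInt (fun s => G (ln (d / 2) + s * v)) 0 1 - CInt (fun _ => Q w) 0 1))%C
      by (rewrite CInt_const; rewrite RtoC_minus; ring).
    rewrite <- CInt_minus; [|intros; apply Rcont_line, HGc|intros; apply Rcont_const].
    rewrite Cmod_mult; apply Rmult_le_compat_l; [lra|].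
    eapply Rle_trans; [apply CInt_bound_const with (M := e / (2 * Cmod v)); [lra| |]|lra].
    - intros; apply Rcont_minus; [apply Rcont_line, HGc|apply Rcont_const].
    - intros s _; left; apply H'.
      replace (w + Cexp (ln (d / 2) + s * v) - w)%C with (Cexp (ln (d / 2) + s * v)) by ring.
      rewrite Cmod_Cexp.
      replace (Re (ln (d / 2) + s * v)%C) with (ln (d / 2)) by (unfold v, Re; simpl; ring).
      rewrite exp_ln; lra. }
  replace (Cmod v * (e / (2 * Cmod v))) with (e / 2) in B by (field; lra).
  lra. }
apply Rmult_le_reg_l with (Cmod v); [exact Hv|].
rewrite <- Cmod_mult, <- Heq.
apply seg_bound; [exact HGc|exact HM].
Qed.

Lemma quotient_entire (g : C -> C) (rho : R) :
  0 < rho -> holo g -> (forall z, Cmod z < rho -> g z = RtoC 0) ->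
  holo (fun z => g z * / z)%C.
Proof.
intros Hr Hg H0 z; destruct (Rlt_dec (Cmod z) rho) as [Hz|Hz].
- exists (RtoC 0); apply (Cdiff_local (fun _ => RtoC 0) _ z _ (rho - Cmod z)); [lra| |apply Cdiff_const].
  intros w Hw; rewrite H0; [ring|].
  replace w with (w - z + z)%C by ring.
  pose proof (Cmod_triangle (w - z)%C z); lra.
- destruct (Hg z) as [l Hl]; eexists.
  apply (Cdiff_mult g Cinv); [exact Hl|apply Cdiff_inv, Cmod_gt_0; lra].
Qed.

(** For every [n] the function [D z / z ^ n] is entire.  Its values at
    distance [3 |w|] from [w] are [O((2 |w|) ^ (- n))], so the maximum principle
    gives [D w = O(2 ^ (- n))]. *)
Lemma entire_zero (D : C -> C) (rho : R) :
  0 < rho -> holo D -> (forall z, Cmod z < rho -> D z = RtoC 0) ->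
  forall z, D z = RtoC 0.
Proof.
intros Hr HD H0 w.
destruct (Rlt_dec (Cmod w) rho) as [Hw|Hw]; [now apply H0|].
set (m := Cmod w) in *; assert (Hm : 0 < m) by lra.
set (Q := fix Q n z := match n with O => D z | S k => (Q k z * / z)%C end).
assert (HQ : forall n, holo (Q n) /\
                       (forall z, Cmod z < rho -> Q n z = RtoC 0)).
{ induction n as [|n [I1 I2]]; [now split|]; split.
  - now apply (quotient_entire (Q n) rho).
  - intros z Hz; simpl; rewrite I2 by exact Hz; ring. }
assert (HDQ : forall n z, z <> RtoC 0 -> Cmod (D z) = Cmod (Q n z) * Cmod z ^ n).
{ induction n as [|n IH]; intros z Hz; simpl; [ring|].
  rewrite Cmod_mult, Cmod_inv, (IH z Hz) by exact Hz.
  apply Cmod_gt_0 in Hz; field; lra. }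
(* The circle of radius [3 m] about [w] keeps a distance [2 m] from 0. *)
set (circ := fun s : R => (w + Cexp (ln (3 * m) + s * (2 * PI * Ci)))%C).
assert (Hcirc : forall s, 2 * m <= Cmod (circ s)).
{ intros s; unfold circ.
  pose proof (Cmod_triangle (circ s) (- w)%C) as T; unfold circ in T.
  replace (w + Cexp (ln (3 * m) + s * (2 * PI * Ci)) + - w)%C
    with (Cexp (ln (3 * m) + s * (2 * PI * Ci))) in T by ring.
  rewrite Cmod_Cexp, Cmod_opp in T.
  replace (Re (ln (3 * m) + s * (2 * PI * Ci))%C) with (ln (3 * m)) in T
    by (unfold Re; simpl; ring).
  rewrite exp_ln in T by lra; fold m in T; lra. }
assert (HM : exists M, forall s, 0 <= s <= 1 -> Cmod (D (circ s)) <= M).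
{ destruct (continuity_ab_maj (fun s => Cmod (D (circ s))) 0 1) as [x [Hx _]]; [lra| |].
  - intros s _; apply continuity_pt_filterlim.
    apply (filterlim_locally (fun s => Cmod (D (circ s)))); intros eps.
    assert (Hc : Rcont (fun s : R => D (circ s)) s).
    { set (G := fun z : C => D (w + Cexp z)%C).
      apply (Rcont_line G (ln (3 * m)) (2 * PI * Ci)%C s).
      apply holo_Ccont; unfold G; holo. }
    destruct (proj1 (Rcont_eps _ _) Hc eps (cond_pos eps)) as (d & Hd & H').
    exists (mkposreal d Hd); intros y Hy.
    specialize (H' y Hy); unfold ball; simpl; unfold AbsRing_ball, abs, minus, plus, opp; simpl.
    eapply Rle_lt_trans; [|exact H'].
    set (a := D (circ y)); set (b := D (circ s)).
    pose proof (Cmod_triangle (a - b)%C b) as T1; pose proof (Cmod_triangle (b - a)%C a) as T2.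
    replace (a - b + b)%C with a in T1 by ring; replace (b - a + a)%C with b in T2 by ring.
    replace (b - a)%C with (- (a - b))%C in T2 by ring; rewrite Cmod_opp in T2.
    apply Rabs_le; lra.
  - exists (Cmod (D (circ x))); exact Hx. }
destruct HM as [M HM].
assert (HM0 : 0 <= M) by (eapply Rle_trans; [apply Cmod_ge_0|apply (HM 0); lra]).
assert (Hn : forall n, Cmod (D w) <= M * (/ 2) ^ n).
{ intros n.
  assert (B : Cmod (Q n w) <= M / (2 * m) ^ n).
  { apply (circle_bound (Q n) w (ln (3 * m))); [apply HQ|].
    intros s Hs; fold (circ s).
    assert (Hp : 0 < (2 * m) ^ n) by (apply pow_lt; lra).
    apply Rmult_le_reg_r with ((2 * m) ^ n); [exact Hp|].
    unfold Rdiv; rewrite Rmult_assoc, Rinv_l, Rmult_1_r by lra.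
    eapply Rle_trans; [|apply (HM s Hs)].
    rewrite (HDQ n) by (apply Cmod_gt_0; specialize (Hcirc s); lra).
    apply Rmult_le_compat_l; [apply Cmod_ge_0|].
    apply pow_incr; specialize (Hcirc s); lra. }
  rewrite (HDQ n) by (apply Cmod_gt_0; exact Hm).
  fold m; assert (0 < m ^ n) by (apply pow_lt; lra).
  replace (M * (/ 2) ^ n) with (M / (2 * m) ^ n * m ^ n).
  - apply Rmult_le_compat_r; lra.
  - rewrite Rpow_mult_distr, pow_inv; field; split; [apply pow_nonzero|apply Rgt_not_eq, pow_lt]; lra. }
apply Cmod_eq_0; pose proof (Cmod_ge_0 (D w)).
destruct (Req_dec (Cmod (D w)) 0) as [|Hne]; [assumption|exfalso].
destruct (pow_lt_1_zero (/ 2) ltac:(rewrite Rabs_pos_eq; lra) (Cmod (D w) / (M + 1))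
  ltac:(apply Rdiv_lt_0_compat; lra)) as [n H1].
specialize (H1 n (le_n n)); rewrite Rabs_pos_eq in H1 by (apply pow_le; lra).
specialize (Hn n).
apply Rlt_div_mult in H1; [|lra].
assert (0 < (/ 2) ^ n) by (apply pow_lt; lra).
nra.
Qed.

Theorem identity_theorem (F G : C -> C) (z0 : C) (rho : R) :
  holo F -> holo G ->
  0 < rho -> (forall z, Cmod (z - z0) < rho -> F z = G z) ->
  forall z, F z = G z.
Proof.
intros HF HG Hr H z.
set (D := fun h : C => (F (z0 + h * 1) - G (z0 + h * 1))%C).
assert (E : D (z - z0)%C = RtoC 0).
{ apply (entire_zero D rho Hr).
  - unfold D; holo.
  - intros h Hh; unfold D; rewrite (H (z0 + h * 1)%C); [ring|].
    replace (z0 + h * 1 - z0)%C with h by ring; exact Hh. }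
unfold D in E; replace (z0 + (z - z0) * 1)%C with z in E by ring.
replace (F z) with (F z - G z + G z)%C by ring; rewrite E; ring.
Qed.

(** * Finite parts of integrals over the real line *)

Definition lim_m_infty (h : R -> C) (l : C) : Prop :=
  forall eps, 0 < eps -> exists M, forall p, p <= - M -> Cmod (h p - l)%C < eps.

Definition lim_p_infty (h : R -> C) (l : C) : Prop :=
  forall eps, 0 < eps -> exists M, forall q, M <= q -> Cmod (h q - l)%C < eps.

(** The Hadamard finite part of [int f] over the line.  The counterterm [S]
    is a primitive of the part of [f] that is not integrable at [- oo], and the
    choice of its additive constant is what distinguishes the finite part from
    other regularizations. *)
Definition is_fp (f S : R -> C) (l : C) : Prop :=
  forall eps, 0 < eps -> exists M, forall p q, p <= - M -> M <= q ->
    Cmod (CInt f p q + S p - l)%C < eps.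

Lemma Cmod_small_eq (x y : C) :
  (forall eps, 0 < eps -> Cmod (x - y)%C < eps) -> x = y.
Proof.
intros H; destruct (Ceq_dec (x - y)%C (RtoC 0)) as [E|Hne].
- replace x with (x - y + y)%C by ring; rewrite E; ring.
- apply Cmod_gt_0 in Hne; specialize (H _ Hne); lra.
Qed.

Lemma fp_unique (f S : R -> C) (l l' : C) : is_fp f S l -> is_fp f S l' -> l = l'.
Proof.
intros H H'; apply Cmod_small_eq; intros eps He.
destruct (H (eps / 2)) as [M HM]; [lra|]; destruct (H' (eps / 2)) as [M' HM']; [lra|].
pose proof (Rmax_l M M'); pose proof (Rmax_r M M'); set (q := Rmax M M') in *.
specialize (HM (- q) q ltac:(lra) ltac:(lra)); specialize (HM' (- q) q ltac:(lra) ltac:(lra)).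
set (X := (CInt f (- q)%R q + S (- q)%R)%C) in *.
replace (l - l')%C with ((X - l') + - (X - l))%C by ring.
eapply Rle_lt_trans; [apply Cmod_triangle|]; rewrite Cmod_opp; lra.
Qed.

Lemma fp_ext (f g S T : R -> C) (l l' : C) :
  (forall x, f x = g x) -> (forall x, S x = T x) -> l = l' -> is_fp f S l -> is_fp g T l'.
Proof.
intros Hf HS <- H eps He; destruct (H eps He) as [M HM]; exists M; intros p q Hp Hq.
rewrite <- HS, <- (CInt_ext f g) by exact Hf; now apply HM.
Qed.

Lemma fp_plus (f g S T : R -> C) (l k : C) :
  (forall x, Rcont f x) -> (forall x, Rcont g x) ->
  is_fp f S l -> is_fp g T k ->
  is_fp (fun x => f x + g x)%C (fun x => S x + T x)%C (l + k)%C.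
Proof.
intros Cf Cg H H' eps He.
destruct (H (eps / 2)) as [M HM]; [lra|]; destruct (H' (eps / 2)) as [M' HM']; [lra|].
exists (Rmax M M'); intros p q Hp Hq.
pose proof (Rmax_l M M'); pose proof (Rmax_r M M').
specialize (HM p q ltac:(lra) ltac:(lra)); specialize (HM' p q ltac:(lra) ltac:(lra)).
rewrite CInt_plus by assumption.
replace (CInt f p q + CInt g p q + (S p + T p) - (l + k))%C
  with ((CInt f p q + S p - l) + (CInt g p q + T p - k))%C by ring.
eapply Rle_lt_trans; [apply Cmod_triangle|]; lra.
Qed.

Lemma fp_scal (c : C) (f S : R -> C) (l : C) :
  (forall x, Rcont f x) -> is_fp f S l ->
  is_fp (fun x => c * f x)%C (fun x => c * S x)%C (c * l)%C.
Proof.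
intros Cf H eps He; pose proof (Cmod_ge_0 c).
destruct (H (eps / (1 + Cmod c))) as [M HM]; [apply Rdiv_lt_0_compat; lra|].
exists M; intros p q Hp Hq; specialize (HM p q Hp Hq).
rewrite CInt_scal by assumption.
replace (c * CInt f p q + c * S p - c * l)%C with (c * (CInt f p q + S p - l))%C by ring.
rewrite Cmod_mult; set (x := Cmod (CInt f p q + S p - l)%C) in *.
assert (0 <= x) by apply Cmod_ge_0.
apply Rlt_div_mult in HM; [|lra]; nra.
Qed.

Lemma fp_zero : is_fp (fun _ => RtoC 0) (fun _ => RtoC 0) (RtoC 0).
Proof.
intros eps He; exists 0; intros p q _ _; rewrite CInt_const.
replace (RtoC (q - p) * RtoC 0 + RtoC 0 - RtoC 0)%C with (RtoC 0) by ring.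
now rewrite Cmod_0.
Qed.

Lemma fp_Csum (f S : nat -> R -> C) (l : nat -> C) (N : nat) :
  (forall k x, Rcont (f k) x) -> (forall k, (k < N)%nat -> is_fp (f k) (S k) (l k)) ->
  is_fp (fun x => Csum (fun k => f k x) N) (fun x => Csum (fun k => S k x) N) (Csum l N).
Proof.
intros Cf; induction N as [|N IH]; intros H; simpl.
- apply fp_zero.
- apply fp_plus; [intros; now apply Rcont_Csum|apply Cf| |apply H; lia].
  apply IH; intros; apply H; lia.
Qed.

Lemma fp_change (f S T : R -> C) (l k : C) :
  lim_m_infty (fun p => T p - S p)%C k -> is_fp f S l -> is_fp f T (l + k)%C.
Proof.
intros H H' eps He.
destruct (H (eps / 2)) as [M HM]; [lra|]; destruct (H' (eps / 2)) as [M' HM']; [lra|].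
exists (Rmax M M'); intros p q Hp Hq.
pose proof (Rmax_l M M'); pose proof (Rmax_r M M').
specialize (HM p ltac:(lra)); specialize (HM' p q ltac:(lra) ltac:(lra)).
replace (CInt f p q + T p - (l + k))%C
  with ((CInt f p q + S p - l) + (T p - S p - k))%C by ring.
eapply Rle_lt_trans; [apply Cmod_triangle|]; lra.
Qed.

Lemma fp_halves (f S : R -> C) (l1 l2 : C) :
  (forall x, Rcont f x) ->
  lim_m_infty (fun p => CInt f p 0 + S p)%C l1 -> lim_p_infty (fun q => CInt f 0 q) l2 ->
  is_fp f S (l1 + l2)%C.
Proof.
intros Cf H H' eps He.
destruct (H (eps / 2)) as [M HM]; [lra|]; destruct (H' (eps / 2)) as [M' HM']; [lra|].
exists (Rmax M M'); intros p q Hp Hq.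
pose proof (Rmax_l M M'); pose proof (Rmax_r M M').
specialize (HM p ltac:(lra)); specialize (HM' q ltac:(lra)).
rewrite <- (CInt_Chasles f p 0 q Cf).
replace (CInt f p 0 + CInt f 0 q + S p - (l1 + l2))%C
  with ((CInt f p 0 + S p - l1) + (CInt f 0 q - l2))%C by ring.
eapply Rle_lt_trans; [apply Cmod_triangle|]; lra.
Qed.

Lemma fp_translate (f S : R -> C) (l : C) (t : R) :
  (forall x, Rcont f x) -> is_fp f S l ->
  is_fp (fun x => f (x + t)) (fun x => S (x + t)) l.
Proof.
intros Cf H eps He; destruct (H eps He) as [M HM].
exists (M + Rabs t); intros p q Hp Hq.
pose proof (Rle_abs t); pose proof (Rle_abs (- t)) as Ht; rewrite Rabs_Ropp in Ht.
specialize (HM (p + t) (q + t) ltac:(lra) ltac:(lra)).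
replace (CInt (fun x => f (x + t)) p q) with (CInt f (p + t) (q + t)); [exact HM|].
pose proof (CInt_lin f 1 t p q Cf) as E.
rewrite !Rmult_1_l in E; rewrite <- E; apply CInt_ext; intros x.
rewrite Rmult_1_l; ring.
Qed.

Lemma ball_C (x y : C) (eps : R) :
  Cmod (y - x)%C < eps -> @ball CV x eps y.
Proof. exact (C_NormedModule_mixin_compat1 x y eps). Qed.

Lemma filterlim_C {T} (F : (T -> Prop) -> Prop) {FF : Filter F} (h : T -> C) (l : C) (eps : R) :
  filterlim h F (@locally CV l) -> 0 < eps ->
  F (fun x => Cmod (h x - l)%C < eps).
Proof.
intros H He.
assert (S2 : 0 < sqrt 2) by (apply sqrt_lt_R0; lra).
assert (He' : 0 < eps / sqrt 2) by (apply Rdiv_lt_0_compat; lra).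
assert (H' := proj1 (filterlim_locally (U := CV) h l) H (mkposreal _ He')).
revert H'; apply filter_imp; intros x Hx; simpl in Hx.
pose proof (C_NormedModule_mixin_compat2 l (h x) (mkposreal _ He') Hx) as B.
simpl in B; replace eps with (sqrt 2 * (eps / sqrt 2)) by (field; lra).
exact B.
Qed.

Lemma lim_p_infty_Cauchy (h : R -> C) :
  (forall eps, 0 < eps -> exists M, forall p q, M <= p -> p <= q -> Cmod (h q - h p)%C < eps) ->
  exists l, lim_p_infty h l.
Proof.
intros H.
destruct (proj1 (filterlim_locally_cauchy (U := CV)
  (F := Rbar_locally p_infty) h)) as [l Hl].
- intros eps; destruct (H eps (cond_pos eps)) as [M HM].
  exists (fun x => M < x); split; [now exists M|].
  intros u v Hu Hv; apply ball_C; destruct (Rle_lt_dec u v).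
  + apply HM; lra.
  + replace (h v - h u)%C with (- (h u - h v))%C by ring; rewrite Cmod_opp; apply HM; lra.
- exists l; intros eps He.
  destruct (filterlim_C _ _ _ _ Hl He) as [M HM].
  exists (M + 1); intros q Hq; apply HM; lra.
Qed.

Lemma lim_m_infty_Cauchy (h : R -> C) :
  (forall eps, 0 < eps -> exists M, forall p q, p <= - M -> q <= p -> Cmod (h q - h p)%C < eps) ->
  exists l, lim_m_infty h l.
Proof.
intros H; destruct (lim_p_infty_Cauchy (fun x => h (- x))) as [l Hl].
- intros eps He; destruct (H eps He) as [M HM]; exists M; intros p q Hp Hq; apply HM; lra.
- exists l; intros eps He; destruct (Hl eps He) as [M HM]; exists M; intros p Hp.
  specialize (HM (- p) ltac:(lra)); now rewrite Ropp_involutive in HM.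
Qed.

(** Both ends use this bound: at [- oo] with [k > 0], at [+ oo] with
    [k = -1]. *)
Lemma CInt_exp_bound (f : R -> C) (K k p q : R) :
  k <> 0 -> p <= q -> (forall x, Rcont f x) ->
  (forall x, p <= x <= q -> Cmod (f x) <= K * exp (k * x)) ->
  Cmod (CInt f p q) <= K / k * (exp (k * q) - exp (k * p)).
Proof.
intros Hk Hpq Cf H.
assert (C : forall x, continuous (fun x => K * exp (k * x)) x).
{ intros x; apply (ex_derive_continuous (V := R_NormedModule)); auto_derive; auto. }
eapply Rle_trans; [apply (CInt_bound f (fun x => K * exp (k * x))); auto|].
right.
transitivity (K / k * exp (k * q) - K / k * exp (k * p)); [|ring].
apply is_RInt_unique.
apply (is_RInt_derive (V := R_CompleteNormedModule) (fun x => K / k * exp (k * x))).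
- intros x _; auto_derive; [auto|field; exact Hk].
- intros x _; apply C.
Qed.

Lemma exp_small (k eps : R) : 0 < k -> 0 < eps ->
  exists M, forall x, x <= - M -> exp (k * x) < eps.
Proof.
intros Hk He; exists (- (ln eps - 1) / k); intros x Hx.
rewrite <- (exp_ln eps) by exact He; apply exp_increasing.
assert (k * x <= ln eps - 1); [|lra].
replace (ln eps - 1) with (k * - (- (ln eps - 1) / k)) by (field; lra).
apply Rmult_le_compat_l; lra.
Qed.

Lemma lim_m_infty_dominated (f : R -> C) (K k : R) :
  0 < k -> (forall x, Rcont f x) ->
  (forall x, x <= 0 -> Cmod (f x) <= K * exp (k * x)) ->
  exists l, lim_m_infty (fun p => CInt f p 0) l /\ Cmod l <= K / k.
Proof.
intros Hk Cf H.
assert (HK : 0 <= K).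
{ specialize (H 0 (Rle_refl 0)); rewrite Rmult_0_r, exp_0 in H.
  pose proof (Cmod_ge_0 (f 0)); lra. }
assert (HKk : 0 <= K / k) by (apply Rdiv_le_0_compat; lra).
destruct (lim_m_infty_Cauchy (fun p => CInt f p 0)) as [l Hl].
- intros eps He.
  destruct (exp_small k (eps / (1 + K / k)) Hk) as [M HM]; [apply Rdiv_lt_0_compat; lra|].
  exists (Rmax M 0); intros p q Hp Hq.
  pose proof (Rmax_l M 0); pose proof (Rmax_r M 0).
  rewrite <- (CInt_Chasles f q p 0 Cf).
  replace (CInt f q p + CInt f p 0 - CInt f p 0)%C with (CInt f q p) by ring.
  eapply Rle_lt_trans; [apply (CInt_exp_bound f K k); [lra|lra|exact Cf|]|].
  + intros x Hx; apply H; lra.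
  + specialize (HM p ltac:(lra)).
    pose proof (exp_pos (k * q)); pose proof (exp_pos (k * p)).
    apply Rlt_div_mult in HM; [|lra].
    nra.
- exists l; split; [exact Hl|].
  apply le_epsilon; intros eps He; destruct (Hl eps He) as [M HM].
  set (p := - Rmax M 0); pose proof (Rmax_l M 0); pose proof (Rmax_r M 0).
  specialize (HM p ltac:(unfold p; lra)).
  pose proof (CInt_exp_bound f K k p 0 ltac:(lra) ltac:(unfold p; lra) Cf
    (fun x Hx => H x (proj2 Hx))) as B.
  rewrite Rmult_0_r, exp_0 in B.
  pose proof (exp_pos (k * p)).
  assert (Cmod (CInt f p 0) <= K / k) by nra.
  replace l with (CInt f p 0 + - (CInt f p 0 - l))%C by ring.
  eapply Rle_trans; [apply Cmod_triangle|]; rewrite Cmod_opp; lra.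
Qed.

Lemma lim_p_infty_dominated (f : R -> C) (K : R) :
  (forall x, Rcont f x) ->
  (forall x, 0 <= x -> Cmod (f x) <= K * exp (- x)) ->
  exists l, lim_p_infty (fun q => CInt f 0 q) l /\ Cmod l <= K.
Proof.
intros Cf H.
destruct (lim_m_infty_dominated (fun x => f (- x)) K 1) as (l & Hl & B).
- lra.
- intros x.
  apply Rcont_eps; intros eps He.
  destruct (proj1 (Rcont_eps f (- x)) (Cf (- x)) eps He) as (d & Hd & H').
  exists d; split; [exact Hd|]; intros y Hy; apply H'.
  replace (- y - - x) with (- (y - x)) by ring; now rewrite Rabs_Ropp.
- intros x Hx; rewrite Rmult_1_l; specialize (H (- x) ltac:(lra)).
  now rewrite Ropp_involutive in H.
- exists l; split; [|lra].
  intros eps He; destruct (Hl eps He) as [M HM]; exists M; intros q Hq.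
  specialize (HM (- q) ltac:(lra)).
  replace (CInt f 0 q) with (CInt (fun x => f (- x)) (- q) 0); [exact HM|].
  pose proof (CInt_lin f (-1) 0 (- q) 0 Cf) as E.
  replace (-1 * - q + 0) with q in E by ring; replace (-1 * 0 + 0) with 0 in E by ring.
  rewrite CInt_scal in E.
  + rewrite (CInt_ext (fun x => f (- x)) (fun y => f (-1 * y + 0)%R))
      by (intros; f_equal; ring).
    pose proof (CInt_Chasles f 0 q 0 Cf) as Ch; rewrite <- E in Ch.
    replace (CInt f 0 0) with (RtoC 0) in Ch.
    * set (X := CInt (fun y => f (-1 * y + 0)) (- q) 0) in *.
      replace X with (CInt f 0 q + RtoC (-1) * X + X - CInt f 0 q + CInt f 0 q)%C
        by (rewrite Ch; ring).
      replace (RtoC (-1)) with (- RtoC 1)%C by (now rewrite <- RtoC_opp).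
      ring.
    * pose proof (CInt_Chasles f 0 0 0 Cf) as Z.
      replace (CInt f 0 0) with (CInt f 0 0 + CInt f 0 0 - CInt f 0 0)%C by ring.
      rewrite Z; ring.
  + intros x; apply Rcont_eps; intros e1 He1.
    destruct (proj1 (Rcont_eps f (-1 * x + 0)) (Cf _) e1 He1) as (d & Hd & H').
    exists d; split; [exact Hd|]; intros y Hy; apply H'.
    replace (-1 * y + 0 - (-1 * x + 0)) with (- (y - x)) by ring; now rewrite Rabs_Ropp.
Qed.

Lemma fp_dominated (f : R -> C) (K k : R) :
  0 < k -> (forall x, Rcont f x) ->
  (forall x, x <= 0 -> Cmod (f x) <= K * exp (k * x)) ->
  (forall x, 0 <= x -> Cmod (f x) <= K * exp (- x)) ->
  exists l, is_fp f (fun _ => RtoC 0) l /\ Cmod l <= K / k + K.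
Proof.
intros Hk Cf H1 H2.
destruct (lim_m_infty_dominated f K k Hk Cf H1) as (l1 & L1 & B1).
destruct (lim_p_infty_dominated f K Cf H2) as (l2 & L2 & B2).
exists (l1 + l2)%C; split.
- apply fp_halves; [exact Cf| |exact L2].
  intros eps He; destruct (L1 eps He) as [M HM]; exists M; intros p Hp.
  rewrite Cplus_0_r; now apply HM.
- eapply Rle_trans; [apply Cmod_triangle|]; lra.
Qed.

(** Goursat's theorem on the parallelogram with corners [p], [q],
    [q + Lam], [p + Lam].  The edge at [q] disappears in the limit; on the edge
    at [p] the function [f] may be replaced by [E], whose integral there is
    [S (p + Lam) - S p]. *)
Lemma fp_shift (f E S : C -> C) (Lam l : C) :
  holo f -> (forall z, Cdiff S z (E z)) -> (forall z, Ccont E z) ->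
  (forall eps, 0 < eps -> exists M, forall q t : R, M <= q -> 0 <= t <= 1 ->
     Cmod (f (q + t * Lam))%C <= eps) ->
  (forall eps, 0 < eps -> exists M, forall p t : R, p <= - M -> 0 <= t <= 1 ->
     Cmod (f (p + t * Lam) - E (p + t * Lam))%C <= eps) ->
  is_fp (fun x => f (RtoC x)) (fun x => S (RtoC x)) l ->
  is_fp (fun x => f (x + Lam)%C) (fun x => S (x + Lam)%C) l.
Proof.
intros Hf HS HE HR HL H eps He.
assert (Cf : forall z, Ccont f z) by (intros; now apply holo_Ccont).
pose proof (Cmod_ge_0 Lam) as HLam.
set (e := eps / (3 * (1 + Cmod Lam))).
assert (He0 : 0 < e) by (apply Rdiv_lt_0_compat; lra).
assert (HeL : Cmod Lam * e < eps / 3).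
{ unfold e; apply Rmult_lt_reg_r with (3 * (1 + Cmod Lam)); [lra|].
  replace (Cmod Lam * (eps / (3 * (1 + Cmod Lam))) * (3 * (1 + Cmod Lam)))
    with (Cmod Lam * eps) by (field; lra).
  nra. }
destruct (HR e He0) as [M1 H1]; destruct (HL e He0) as [M2 H2].
destruct (H (eps / 3)) as [M3 H3]; [lra|].
exists (Rmax M1 (Rmax M2 M3)); intros p q Hp Hq.
pose proof (Rmax_l M1 (Rmax M2 M3)); pose proof (Rmax_r M1 (Rmax M2 M3)).
pose proof (Rmax_l M2 M3); pose proof (Rmax_r M2 M3).
specialize (H3 p q ltac:(lra) ltac:(lra)).
assert (Seg : forall c : C, seg_integral f (p + c) (q - p)%R = CInt (fun x => f (x + c)%C) p q).
{ intros c; unfold seg_integral.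
  rewrite <- CInt_scal by (intros; apply Rcont_line, Cf).
  assert (Cc : forall x : R, Rcont (fun x : R => f (x + c)%C) x).
  { intros x; apply Rcont_ext with (fun x : R => f (c + x * 1)%C).
    - intros y; f_equal; ring.
    - apply Rcont_line, Cf. }
  pose proof (CInt_lin (fun x : R => f (x + c)%C) (q - p) p 0 1 Cc) as E1.
  replace ((q - p) * 0 + p) with p in E1 by ring.
  replace ((q - p) * 1 + p) with q in E1 by ring.
  rewrite <- E1; apply CInt_ext; intros s; f_equal; f_equal.
  rewrite RtoC_plus, RtoC_mult; ring. }
assert (G := Goursat f p (RtoC (q - p)) Lam Hf); unfold boundary_integral in G.
replace (RtoC p + RtoC (q - p))%C with (RtoC q) in G by (rewrite RtoC_minus; ring).
rewrite Seg in G.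
replace (RtoC p) with (RtoC p + RtoC 0)%C in G at 1 by ring; rewrite Seg in G.
rewrite (CInt_ext (fun x => f (x + RtoC 0)%C) (fun x => f (RtoC x))) in G
  by (intros; f_equal; ring).
assert (ES : seg_integral f p Lam = (seg_integral (fun z => f z - E z) p Lam + (S (p + Lam) - S p))%C).
{ rewrite seg_minus by assumption.
  rewrite (seg_primitive E S p Lam HS HE); ring. }
rewrite ES in G.
replace (CInt (fun x : R => f (x + Lam)%C) p q + S (p + Lam) - l)%C
  with ((CInt (fun x => f (RtoC x)) p q + S p - l) + seg_integral f q Lam
        + - seg_integral (fun z => f z - E z)%C p Lam)%C.
2:{ set (X := CInt (fun x : R => f (x + Lam)%C) p q) in *.
    set (Y := CInt (fun x => f (RtoC x)) p q) in *.
    set (Z := seg_integral (fun z => f z - E z)%C p Lam) in *.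
    replace X with (X + (Y + seg_integral f q Lam - X - (Z + (S (p + Lam) - S p))))%C
      by (rewrite G; ring).
    ring. }
assert (B1 : Cmod (seg_integral f q Lam) <= Cmod Lam * e).
{ apply seg_bound; [exact Cf|]; intros t Ht; apply H1; lra. }
assert (B2 : Cmod (seg_integral (fun z => f z - E z)%C p Lam) <= Cmod Lam * e).
{ apply seg_bound; [intros; now apply Ccont_minus|]; intros t Ht; apply H2; lra. }
eapply Rle_lt_trans; [apply Cmod_triangle|].
eapply Rle_lt_trans; [apply Rplus_le_compat_r, Cmod_triangle|].
rewrite Cmod_opp; lra.
Qed.

(** * The integrand in the logarithmic variable *)

Lemma Csum_ext (f g : nat -> C) (N : nat) :
  (forall k, (k < N)%nat -> f k = g k) -> Csum f N = Csum g N.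
Proof.
induction N as [|N IH]; intros H; simpl; [reflexivity|].
rewrite IH, H; [reflexivity|lia|intros; apply H; lia].
Qed.

Lemma Csum_scal (c : C) (f : nat -> C) (N : nat) :
  Csum (fun k => c * f k)%C N = (c * Csum f N)%C.
Proof. induction N as [|N IH]; simpl; [ring|rewrite IH; ring]. Qed.

Lemma Csum_plus (f g : nat -> C) (N : nat) :
  Csum (fun k => f k + g k)%C N = (Csum f N + Csum g N)%C.
Proof. induction N as [|N IH]; simpl; [ring|rewrite IH; ring]. Qed.

Lemma Csum_zero (N : nat) : Csum (fun _ => RtoC 0) N = RtoC 0.
Proof. induction N as [|N IH]; simpl; [reflexivity|rewrite IH; ring]. Qed.

Lemma Csum_exchange (f : nat -> nat -> C) (N M : nat) :
  Csum (fun n => Csum (fun m => f n m) M) N = Csum (fun m => Csum (fun n => f n m) N) M.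
Proof.
induction N as [|N IH]; simpl; [now rewrite Csum_zero|].
now rewrite IH, Csum_plus.
Qed.

Lemma Csum_shift (f : nat -> C) (N : nat) :
  Csum f (S N) = (f O + Csum (fun k => f (S k)) N)%C.
Proof.
induction N as [|N IH]; [simpl; ring|].
change (Csum f (S (S N))) with (Csum f (S N) + f (S N))%C.
rewrite IH; simpl; ring.
Qed.

Lemma Csum_head (f : nat -> C) (N : nat) :
  (1 <= N)%nat -> (forall k, (1 <= k)%nat -> f k = RtoC 0) -> Csum f N = f O.
Proof.
destruct N as [|N]; [lia|]; intros _ H.
rewrite Csum_shift, (Csum_ext _ (fun _ => RtoC 0)), Csum_zero by (intros; apply H; lia).
ring.
Qed.

Definition exp_coef (u : C) (n : nat) : C := (u ^ n / INR (fact n))%C.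

(** The Taylor polynomial of the exponential with [N] terms, of degree
    [N - 1]; [exp_rem] is the corresponding remainder. *)
Definition exp_poly (N : nat) (u : C) : C := Csum (exp_coef u) N.

Definition exp_rem (N : nat) (u : C) : C := (Cexp u - exp_poly N u)%C.

Lemma fact_nz (n : nat) : RtoC (INR (fact n)) <> RtoC 0.
Proof. intros H; apply RtoC_inj in H; now apply (INR_fact_neq_0 n). Qed.

Lemma exp_coef_0 (u : C) : exp_coef u 0 = RtoC 1.
Proof. unfold exp_coef; simpl; field; intros H; apply RtoC_inj in H; lra. Qed.

Lemma exp_coef_S (u : C) (n : nat) : (INR (S n) * exp_coef u (S n) = u * exp_coef u n)%C.
Proof.
unfold exp_coef; rewrite Cpow_S.
replace (fact (S n)) with (S n * fact n)%nat by reflexivity.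
rewrite mult_INR, RtoC_mult; field.
split; [apply fact_nz|].
intros H; apply RtoC_inj in H; now apply (not_0_INR (S n)).
Qed.

Lemma Cdiff_exp_coef (n : nat) (u : C) :
  Cdiff (fun u => exp_coef u (S n)) u (exp_coef u n).
Proof.
induction n as [|n IH].
- apply Cdiff_ext with (fun u : C => u).
  + intros x; unfold exp_coef; simpl; field; intros H; apply RtoC_inj in H; lra.
  + rewrite exp_coef_0; apply Cdiff_id.
- assert (Hn : RtoC (INR (S (S n))) <> RtoC 0).
  { intros H; apply RtoC_inj in H; now apply (not_0_INR (S (S n))). }
  apply Cdiff_ext with (fun u => / INR (S (S n)) * (u * exp_coef u (S n)))%C.
  + intros x; rewrite <- exp_coef_S; field; exact Hn.
  + eapply Cdiff_val.
    * apply (Cdiff_scal (/ INR (S (S n)))%C (fun u => u * exp_coef u (S n))%C).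
      apply (Cdiff_mult (fun u => u)); [apply Cdiff_id|exact IH].
    * cbv beta; rewrite <- exp_coef_S.
      rewrite (S_INR (S n)), RtoC_plus in *.
      set (k := RtoC (INR (S n))) in *; field; exact Hn.
Qed.

Lemma Cdiff_exp_poly (N : nat) (u : C) : Cdiff (exp_poly (S N)) u (exp_poly N u).
Proof.
apply Cdiff_ext with (fun u => exp_coef u 0 + Csum (fun k => exp_coef u (S k)) N)%C.
{ intros x; unfold exp_poly; now rewrite Csum_shift. }
eapply Cdiff_val.
- apply (Cdiff_plus (fun u => exp_coef u 0)).
  + apply Cdiff_ext with (fun _ => RtoC 1); [intros; now rewrite exp_coef_0|apply Cdiff_const].
  + apply (Cdiff_Csum (fun k u => exp_coef u (S k)) (exp_coef u)).
    intros; apply Cdiff_exp_coef.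
- unfold exp_poly; ring.
Qed.

Lemma Cdiff_exp_rem (N : nat) (u : C) : Cdiff (exp_rem (S N)) u (exp_rem N u).
Proof. apply (Cdiff_minus Cexp (exp_poly (S N))); [apply Cdiff_Cexp|apply Cdiff_exp_poly]. Qed.

Lemma exp_rem_0 (N : nat) : exp_rem (S N) (RtoC 0) = RtoC 0.
Proof.
unfold exp_rem, exp_poly; rewrite Cexp_0, Csum_shift, exp_coef_0.
rewrite (Csum_ext _ (fun _ => RtoC 0)), Csum_zero; [ring|].
intros k _; unfold exp_coef; rewrite Cpow_S; unfold Cdiv; ring.
Qed.

Lemma holo_exp_rem (N : nat) : holo (exp_rem N).
Proof.
destruct N as [|N]; [|intros u; eexists; apply Cdiff_exp_rem].
apply (holo_minus Cexp (exp_poly 0)); [apply holo_Cexp|exact (holo_const (RtoC 0))].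
Qed.

Lemma Ccont_exp_rem (N : nat) (u : C) : Ccont (exp_rem N) u.
Proof. apply holo_Ccont, holo_exp_rem. Qed.

(** The derivative of [exp_rem (N + 1)] is [exp_rem N], and the mean
    value inequality on the segment from 0 to [u] gives an induction on [N].  The
    factor [1 / N!] is lost, which is harmless here. *)
Lemma exp_rem_bound (N : nat) : forall (u : C) (M : R),
  (forall s, 0 <= s <= 1 -> exp (s * Re u) <= M) -> Cmod (exp_rem N u) <= M * Cmod u ^ N.
Proof.
induction N as [|N IH]; intros u M HM.
- unfold exp_rem, exp_poly; simpl; rewrite Rmult_1_r.
  replace (Cexp u - 0)%C with (Cexp u) by ring.
  rewrite Cmod_Cexp; specialize (HM 1 ltac:(lra)); now rewrite Rmult_1_l in HM.
- assert (HM0 : 0 <= M) by (specialize (HM 0 ltac:(lra)); pose proof (exp_pos (0 * Re u)); lra).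
  replace (exp_rem (S N) u) with (exp_rem (S N) u - exp_rem (S N) (RtoC 0))%C by (rewrite exp_rem_0; ring).
  eapply Rle_trans.
  { apply (Cdiff_mean_value (exp_rem (S N)) (exp_rem N) (RtoC 0) u (M * Cmod u ^ N)).
    - apply Cdiff_exp_rem.
    - apply Ccont_exp_rem.
    - intros s Hs.
      replace (0 + s * (u - 0))%C with (RtoC s * u)%C by ring.
      eapply Rle_trans; [apply (IH (RtoC s * u)%C M)|].
      + intros s' Hs'; rewrite re_scal_l, <- Rmult_assoc; apply HM; nra.
      + apply Rmult_le_compat_l; [exact HM0|].
        apply pow_incr; split; [apply Cmod_ge_0|].
        rewrite Cmod_mult, Cmod_R, Rabs_pos_eq by lra.
        pose proof (Cmod_ge_0 u); nra. }
  replace (u - 0)%C with u by ring; simpl; right; ring.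
Qed.

Lemma Re_le_Cmod (z : C) : Re z <= Cmod z.
Proof. eapply Rle_trans; [apply Rle_abs|apply re_le_Cmod]. Qed.

Lemma exp_le (x y : R) : x <= y -> exp x <= exp y.
Proof. intros [H| ->]; [left; now apply exp_increasing|lra]. Qed.

Lemma exp_rem_bound_gen (N : nat) (u : C) : Cmod (exp_rem N u) <= exp (Cmod u) * Cmod u ^ N.
Proof.
apply exp_rem_bound; intros s Hs; apply exp_le.
pose proof (Re_le_Cmod u); pose proof (Cmod_ge_0 u); nra.
Qed.

Lemma exp_rem_bound_neg (N : nat) (u : C) : Re u <= 0 -> Cmod (exp_rem N u) <= Cmod u ^ N.
Proof.
intros Hu; rewrite <- Rmult_1_l; apply exp_rem_bound; intros s Hs.
rewrite <- exp_0; apply exp_le; nra.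
Qed.

Lemma exp_poly_bound (N : nat) (u : C) : Cmod (exp_poly N u) <= exp (Cmod u) * (1 + Cmod u ^ N).
Proof.
replace (exp_poly N u) with (Cexp u + - exp_rem N u)%C by (unfold exp_rem; ring).
eapply Rle_trans; [apply Cmod_triangle|]; rewrite Cmod_opp, Cmod_Cexp.
pose proof (exp_rem_bound_gen N u); pose proof (exp_le _ _ (Re_le_Cmod u)); lra.
Qed.

(** The primitive of [exp (w L)] without constant term.  For [w <> 0] and
    [L = ln t] it is [t ^ w / w], for [w = 0] it is [ln t]; these are the
    counterterms of Hadamard's finite part. *)
Definition exp_prim (w L : C) : C :=
  if Ceq_dec w (RtoC 0) then L else (Cexp (w * L) / w)%C.

Lemma Cdiff_exp_prim (w L : C) : Cdiff (exp_prim w) L (Cexp (w * L)).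
Proof.
unfold exp_prim; destruct (Ceq_dec w (RtoC 0)) as [->|Hw].
- replace (RtoC 0 * L)%C with (RtoC 0) by ring; rewrite Cexp_0; apply Cdiff_id.
- apply Cdiff_ext with (fun L => / w * Cexp (w * L))%C; [intros; unfold Cdiv; ring|].
  eapply Cdiff_val.
  + apply (Cdiff_scal (/ w)%C (fun L => Cexp (w * L)%C)).
    apply (Cdiff_comp Cexp (fun L => w * L)%C); [apply Cdiff_Cexp|].
    apply (Cdiff_scal w (fun L => L)), Cdiff_id.
  + field; exact Hw.
Qed.

Lemma exp_prim_shift (w L Lam : C) :
  exp_prim w (L + Lam) =
  (Cexp (w * Lam) * exp_prim w L + if Ceq_dec w (RtoC 0) then Lam else RtoC 0)%C.
Proof.
unfold exp_prim; destruct (Ceq_dec w (RtoC 0)) as [->|Hw].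
- replace (RtoC 0 * Lam)%C with (RtoC 0) by ring; rewrite Cexp_0; ring.
- replace (w * (L + Lam))%C with (w * Lam + w * L)%C by ring; rewrite Cexp_plus; field; exact Hw.
Qed.

Lemma exp_prim_lim (w : C) : 0 < Re w -> lim_m_infty (fun p => exp_prim w p) (RtoC 0).
Proof.
intros Hw eps He.
assert (Hw0 : w <> RtoC 0) by (intros ->; simpl in Hw; lra).
assert (Hm := proj1 (Cmod_gt_0 w) Hw0).
destruct (exp_small (Re w) (eps * Cmod w) Hw) as [M HM]; [nra|].
exists M; intros p Hp; unfold exp_prim; destruct (Ceq_dec w (RtoC 0)) as [|_]; [contradiction|].
unfold Cminus; rewrite <- RtoC_opp, Ropp_0, Cplus_0_r, Cmod_div, Cmod_Cexp, re_scal_r by exact Hw0.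
apply Rmult_lt_reg_r with (Cmod w); [exact Hm|].
unfold Rdiv; rewrite Rmult_assoc, Rinv_l, Rmult_1_r by lra; apply HM, Hp.
Qed.

Lemma lim_m_infty_ext (f g : R -> C) (l : C) :
  (forall x, f x = g x) -> lim_m_infty f l -> lim_m_infty g l.
Proof.
intros H Hf eps He; destruct (Hf eps He) as [M HM]; exists M; intros p Hp.
rewrite <- H; now apply HM.
Qed.

Lemma lim_m_infty_plus (f g : R -> C) (l k : C) :
  lim_m_infty f l -> lim_m_infty g k -> lim_m_infty (fun x => f x + g x)%C (l + k)%C.
Proof.
intros H H' eps He.
destruct (H (eps / 2)) as [M HM]; [lra|]; destruct (H' (eps / 2)) as [M' HM']; [lra|].
exists (Rmax M M'); intros p Hp.
pose proof (Rmax_l M M'); pose proof (Rmax_r M M').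
specialize (HM p ltac:(lra)); specialize (HM' p ltac:(lra)).
replace (f p + g p - (l + k))%C with ((f p - l) + (g p - k))%C by ring.
eapply Rle_lt_trans; [apply Cmod_triangle|]; lra.
Qed.

Lemma lim_m_infty_val (f : R -> C) (l k : C) : lim_m_infty f l -> l = k -> lim_m_infty f k.
Proof. now intros H <-. Qed.

Lemma lim_m_infty_const (c : C) : lim_m_infty (fun _ => c) c.
Proof.
intros eps He; exists 0; intros p _.
replace (c - c)%C with (RtoC 0) by ring; now rewrite Cmod_0.
Qed.

Lemma lim_m_infty_scal (c : C) (f : R -> C) (l : C) :
  lim_m_infty f l -> lim_m_infty (fun x => c * f x)%C (c * l)%C.
Proof.
intros H eps He; pose proof (Cmod_ge_0 c).
destruct (H (eps / (1 + Cmod c))) as [M HM]; [apply Rdiv_lt_0_compat; lra|].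
exists M; intros p Hp; specialize (HM p Hp).
replace (c * f p - c * l)%C with (c * (f p - l))%C by ring.
rewrite Cmod_mult; set (x := Cmod (f p - l)%C) in *.
assert (0 <= x) by apply Cmod_ge_0.
apply Rlt_div_mult in HM; [|lra]; nra.
Qed.

Lemma lim_m_infty_Csum (f : nat -> R -> C) (l : nat -> C) (N : nat) :
  (forall k, (k < N)%nat -> lim_m_infty (f k) (l k)) ->
  lim_m_infty (fun x => Csum (fun k => f k x) N) (Csum l N).
Proof.
induction N as [|N IH]; intros H; simpl; [apply lim_m_infty_const|].
apply lim_m_infty_plus; [apply IH; intros; apply H; lia|apply H; lia].
Qed.

(** In the variable [L = ln t] this is
    [t ^ b exp (- a t ^ alpha - lam t)]; the factor [t] that distinguishes
    [t ^ beta dt] from [t ^ (beta + 1) dL] is contained in [b = beta + 1]. *)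
Definition integrand (alpha : R) (b a lam L : C) : C :=
  Cexp (b * L - a * Cexp (alpha * L) - lam * Cexp L)%C.

(** The counterterm of [exp (w L - lam exp L)].  All exponents
    [w + m] with [m < N] occur, also those with positive real part, whose terms
    tend to 0 at [- oo] and do not change the finite part. *)
Definition laplace_prim (N : nat) (lam w L : C) : C :=
  Csum (fun m => exp_coef (- lam) m * exp_prim (w + INR m) L)%C N.

(** The counterterm of [integrand], with the exponents
    [b + n alpha + m] for [m, n < N]. *)
Definition singular_prim (N : nat) (alpha : R) (b a lam L : C) : C :=
  Csum (fun n => exp_coef (- a) n * laplace_prim N lam (b + INR n * alpha) L)%C N.

(** The sum of the exponentials whose primitive is [singular_prim], in
    factored form; [singular_part_sum] is the expanded form. *)
Definition singular_part (N : nat) (alpha : R) (b a lam L : C) : C :=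
  (Cexp (b * L) * (exp_poly N (- a * Cexp (alpha * L)) * exp_poly N (- lam * Cexp L)))%C.

Lemma holo_integrand (alpha : R) (b a lam : C) : holo (integrand alpha b a lam).
Proof. unfold integrand; holo. Qed.

Lemma Rcont_integrand (alpha : R) (b a lam : C) (x : R) :
  Rcont (fun t : R => integrand alpha b a lam t) x.
Proof. apply (Rcont_holo (integrand alpha b a lam)), holo_integrand. Qed.

Lemma exp_coef_mult_l (c x : C) (n : nat) : exp_coef (c * x) n = (exp_coef c n * x ^ n)%C.
Proof. unfold exp_coef; rewrite Cpow_mult_l; unfold Cdiv; ring. Qed.

Lemma singular_part_sum (N : nat) (alpha : R) (b a lam L : C) :
  singular_part N alpha b a lam L =
  Csum (fun n => exp_coef (- a) n *
    Csum (fun m => exp_coef (- lam) m * Cexp ((b + INR n * alpha + INR m) * L)) N)%C N.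
Proof.
unfold singular_part, exp_poly.
transitivity (Csum (fun n => Cexp (b * L) * Csum (exp_coef (- lam * Cexp L)) N
   * exp_coef (- a * Cexp (alpha * L)) n)%C N).
- rewrite (Csum_scal (Cexp (b * L) * Csum (exp_coef (- lam * Cexp L)) N)
    (exp_coef (- a * Cexp (alpha * L)))); ring.
- apply Csum_ext; intros n _.
  rewrite (Csum_ext (fun m => exp_coef (- lam) m * Cexp ((b + INR n * alpha + INR m) * L))%C
    (fun m => Cexp ((b + INR n * alpha) * L) * exp_coef (- lam * Cexp L) m)%C).
  + rewrite (Csum_scal (Cexp ((b + INR n * alpha) * L)) (exp_coef (- lam * Cexp L))).
    rewrite (exp_coef_mult_l (- a)), Cexp_pow.
    replace ((b + INR n * alpha) * L)%C with (b * L + INR n * (alpha * L))%C by ring.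
    rewrite Cexp_plus; ring.
  + intros m _; rewrite (exp_coef_mult_l (- lam)), Cexp_pow.
    replace ((b + INR n * alpha + INR m) * L)%C
      with ((b + INR n * alpha) * L + INR m * L)%C by ring.
    rewrite Cexp_plus; ring.
Qed.

Lemma Cdiff_laplace_prim (N : nat) (lam w L : C) :
  Cdiff (laplace_prim N lam w) L (Csum (fun m => exp_coef (- lam) m * Cexp ((w + INR m) * L))%C N).
Proof.
unfold laplace_prim.
apply (Cdiff_Csum (fun m L => exp_coef (- lam) m * exp_prim (w + INR m) L)%C
  (fun m => exp_coef (- lam) m * Cexp ((w + INR m) * L))%C).
intros m _; apply (Cdiff_scal (exp_coef (- lam) m) (exp_prim (w + INR m))), Cdiff_exp_prim.
Qed.

Lemma Cdiff_singular_prim (N : nat) (alpha : R) (b a lam L : C) :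
  Cdiff (singular_prim N alpha b a lam) L (singular_part N alpha b a lam L).
Proof.
rewrite singular_part_sum; unfold singular_prim.
apply (Cdiff_Csum (fun n L => exp_coef (- a) n * laplace_prim N lam (b + INR n * alpha) L)%C
  (fun n => exp_coef (- a) n *
    Csum (fun m => exp_coef (- lam) m * Cexp ((b + INR n * alpha + INR m) * L)) N)%C).
intros n _; apply (Cdiff_scal (exp_coef (- a) n) (laplace_prim N lam (b + INR n * alpha))), Cdiff_laplace_prim.
Qed.

Lemma holo_singular_part (N : nat) (alpha : R) (b a lam : C) : holo (singular_part N alpha b a lam).
Proof.
eapply holo_ext; [intros L; symmetry; apply singular_part_sum|holo].
Qed.

Definition taylor_const (N : nat) (a lam : C) : R :=
  exp (Cmod a) * exp (Cmod lam) *
  (Cmod a ^ N + (1 + Cmod a ^ N) * Cmod lam ^ N).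

Lemma Cmod_exp_le (c L : C) (k : R) : 1 <= k -> Re L <= 0 ->
  Cmod (- c * Cexp (k * L))%C <= Cmod c * exp (Re L).
Proof.
intros Hk HL; rewrite Cmod_mult, Cmod_opp, Cmod_Cexp, re_scal_l.
apply Rmult_le_compat_l; [apply Cmod_ge_0|]; apply exp_le; nra.
Qed.

Lemma exp_INR (n : nat) (x : R) : exp x ^ n = exp (INR n * x).
Proof.
induction n as [|n IH]; [simpl; now rewrite Rmult_0_l, exp_0|].
rewrite <- tech_pow_Rmult, IH, <- exp_plus, S_INR; f_equal; ring.
Qed.

(** For [u = - a exp (alpha L)] and [v = - lam exp L], the difference
    [exp u exp v - exp_poly N u exp_poly N v] has in each summand a factor of
    order [N] in [u] or [v], and both are [O(exp (Re L))],
    uniformly in [Im L], as needed for translations. *)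
Lemma integrand_taylor (N : nat) (alpha : R) (b a lam L : C) :
  1 <= alpha -> Re L <= 0 ->
  Cmod (integrand alpha b a lam L - singular_part N alpha b a lam L)%C
  <= taylor_const N a lam * exp (Re (b * L)%C + INR N * Re L).
Proof.
intros Ha HL.
set (u := (- a * Cexp (alpha * L))%C); set (v := (- lam * Cexp L)%C).
assert (Hu : Cmod u <= Cmod a * exp (Re L)) by now apply Cmod_exp_le.
assert (Hv : Cmod v <= Cmod lam * exp (Re L)).
{ unfold v; replace L with (1 * L)%C at 1 by ring; apply Cmod_exp_le; lra. }
assert (He : exp (Re L) <= 1) by (rewrite <- exp_0; now apply exp_le).
pose proof (exp_pos (Re L)) as Hp.
assert (E : (integrand alpha b a lam L - singular_part N alpha b a lam L)%C =
  (Cexp (b * L) * (exp_rem N u * Cexp v + exp_poly N u * exp_rem N v))%C).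
{ unfold integrand, singular_part; fold u; fold v; unfold exp_rem.
  replace (b * L - a * Cexp (alpha * L) - lam * Cexp L)%C with (b * L + (u + v))%C
    by (unfold u, v; ring).
  rewrite !Cexp_plus; ring. }
rewrite E, Cmod_mult, Cmod_Cexp, exp_plus.
pose proof (Cmod_ge_0 a) as A0; pose proof (Cmod_ge_0 lam) as L0.
pose proof (Cmod_ge_0 u) as U0; pose proof (Cmod_ge_0 v) as V0.
set (y := exp (INR N * Re L)).
assert (Hy : y = exp (Re L) ^ N) by (symmetry; apply exp_INR).
assert (Hy0 : 0 < y) by apply exp_pos.
assert (Ua : Cmod u <= Cmod a) by nra.
assert (Vl : Cmod v <= Cmod lam) by nra.
assert (Up : Cmod u ^ N <= Cmod a ^ N * y).
{ rewrite Hy, <- Rpow_mult_distr; apply pow_incr; lra. }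
assert (Vp : Cmod v ^ N <= Cmod lam ^ N * y).
{ rewrite Hy, <- Rpow_mult_distr; apply pow_incr; lra. }
assert (Eu := exp_le _ _ Ua); assert (Ev := exp_le _ _ Vl).
pose proof (exp_pos (Cmod u)); pose proof (exp_pos (Cmod v)).
pose proof (exp_pos (Cmod a)); pose proof (exp_pos (Cmod lam)).
assert (0 <= Cmod a ^ N) by (now apply pow_le).
assert (0 <= Cmod lam ^ N) by (now apply pow_le).
assert (0 <= Cmod u ^ N) by (now apply pow_le).
assert (0 <= Cmod v ^ N) by (now apply pow_le).
assert (B1 : Cmod (exp_rem N u) <= exp (Cmod a) * (Cmod a ^ N * y)).
{ eapply Rle_trans; [apply exp_rem_bound_gen|]; apply Rmult_le_compat; lra. }
assert (B2 : Cmod (Cexp v) <= exp (Cmod lam)).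
{ rewrite Cmod_Cexp; pose proof (exp_le _ _ (Re_le_Cmod v)); lra. }
assert (B3 : Cmod (exp_poly N u) <= exp (Cmod a) * (1 + Cmod a ^ N)).
{ eapply Rle_trans; [apply exp_poly_bound|]; apply Rmult_le_compat; try lra.
  apply Rplus_le_compat_l, pow_incr; lra. }
assert (B4 : Cmod (exp_rem N v) <= exp (Cmod lam) * (Cmod lam ^ N * y)).
{ eapply Rle_trans; [apply exp_rem_bound_gen|]; apply Rmult_le_compat; lra. }
apply Rle_trans with (exp (Re (b * L)%C) *
  (exp (Cmod a) * (Cmod a ^ N * y) * exp (Cmod lam)
   + exp (Cmod a) * (1 + Cmod a ^ N) * (exp (Cmod lam) * (Cmod lam ^ N * y)))).
- apply Rmult_le_compat_l; [left; apply exp_pos|].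
  eapply Rle_trans; [apply Cmod_triangle|]; rewrite !Cmod_mult.
  apply Rplus_le_compat; apply Rmult_le_compat; auto using Cmod_ge_0.
- unfold taylor_const; right; ring.
Qed.

Lemma taylor_const_pos (N : nat) (a lam : C) : 0 <= taylor_const N a lam.
Proof.
unfold taylor_const.
pose proof (exp_pos (Cmod a)); pose proof (exp_pos (Cmod lam)).
assert (0 <= Cmod a ^ N) by (apply pow_le, Cmod_ge_0).
assert (0 <= Cmod lam ^ N) by (apply pow_le, Cmod_ge_0).
repeat (apply Rmult_le_pos || apply Rplus_le_le_0_compat); lra.
Qed.

(** The integrand minus its singular part is integrable at [- oo], and the
    integral of the singular part is cancelled by the counterterm up to its value
    at 0. *)
Lemma lower_finite_part (N : nat) (alpha : R) (b a lam : C) :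
  1 <= alpha -> 0 < Re b + INR N ->
  exists l, lim_m_infty (fun p => CInt (fun x : R => integrand alpha b a lam x) p 0
                                + singular_prim N alpha b a lam p)%C l.
Proof.
intros Ha Hb.
set (r := fun x : R => (integrand alpha b a lam x - singular_part N alpha b a lam x)%C).
assert (CE : forall x : R, Rcont (fun t : R => singular_part N alpha b a lam t) x)
  by (intros; apply (Rcont_holo (singular_part N alpha b a lam)), holo_singular_part).
assert (Cr : forall x, Rcont r x)
  by (intros; apply Rcont_minus; [apply Rcont_integrand|apply CE]).
destruct (lim_m_infty_dominated r (taylor_const N a lam) (Re b + INR N) Hb Cr) as (l & Hl & _).
{ intros x Hx; eapply Rle_trans; [apply integrand_taylor; [exact Ha|exact Hx]|].
  right; f_equal; f_equal; rewrite re_scal_r; simpl; ring. }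
exists (l + singular_prim N alpha b a lam (RtoC 0))%C.
apply lim_m_infty_ext with (fun p => CInt r p 0 + singular_prim N alpha b a lam (RtoC 0))%C.
2:{ apply lim_m_infty_plus; [exact Hl|apply lim_m_infty_const]. }
intros p; unfold r.
rewrite CInt_minus by (intros; apply Rcont_integrand || apply CE).
pose proof (CInt_FTC (singular_prim N alpha b a lam) (singular_part N alpha b a lam) (RtoC 0) (RtoC 1) p 0) as F.
rewrite (CInt_ext _ (fun x : R => singular_part N alpha b a lam x)) in F
  by (intros; rewrite Cmult_1_l; f_equal; ring).
rewrite F; [|intros; apply Cdiff_singular_prim|intros; apply holo_Ccont, holo_singular_part].
replace (0 + 0 * 1)%C with (RtoC 0) by ring.
replace (0 + p * 1)%C with (RtoC p) by ring.
ring.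
Qed.

(** * Translation of the line of integration *)

Lemma exp_ge_square (x : R) : 0 <= x -> x * x / 4 <= exp x.
Proof.
intros Hx; replace x with (x / 2 + x / 2) at 3 by field; rewrite exp_plus.
destruct (Req_dec x 0) as [->|Hne].
- pose proof (exp_pos (0 / 2)); nra.
- pose proof (exp_ineq1 (x / 2) ltac:(lra)); nra.
Qed.

Lemma linear_minus_exp (b c : R) : 0 < c ->
  exists K, forall x, 0 <= x -> b * x - c * exp x <= K - x.
Proof.
intros Hc; exists ((b + 1) * (b + 1) / c); intros x Hx.
pose proof (exp_ge_square x Hx) as He.
assert (c * (x * x / 4) <= c * exp x) by (apply Rmult_le_compat_l; lra).
assert ((b + 1) * x - c * (x * x / 4) <= (b + 1) * (b + 1) / c); [|lra].
assert (0 <= (c * x / 2 - (b + 1)) * (c * x / 2 - (b + 1)) / c).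
{ apply Rdiv_le_0_compat; [apply (Rle_0_sqr (c * x / 2 - (b + 1)))|lra]. }
replace ((b + 1) * (b + 1) / c)
  with ((c * x / 2 - (b + 1)) * (c * x / 2 - (b + 1)) / c + (b + 1) * x - c * (x * x / 4))
  by (field; lra).
lra.
Qed.

(** As [exp (alpha x) >= exp x (1 + (alpha - 1) x)], the last term wins
    over [Lam exp x] for large [x]; this is where [alpha > 1] is used for the
    convergence on rotated rays. *)
Lemma superexp_bound (alpha b c Lam : R) : 1 < alpha -> 0 < c ->
  exists K, forall x, 0 <= x -> b * x + Lam * exp x - c * exp (alpha * x) <= K - x.
Proof.
intros Ha Hc.
set (A := Rabs (b + 1) + Rabs Lam).
assert (HA : 0 <= A) by (unfold A; pose proof (Rabs_pos (b + 1)); pose proof (Rabs_pos Lam); lra).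
assert (Hk : 0 < c * (alpha - 1)) by nra.
set (X := A / (c * (alpha - 1))).
exists (exp X * A); intros x Hx.
assert (H1 : (b + 1) * x <= Rabs (b + 1) * exp x).
{ assert (x <= exp x).
  { destruct (Req_dec x 0) as [->|]; [rewrite exp_0; lra|].
    pose proof (exp_ineq1 x ltac:(lra)); lra. }
  pose proof (Rle_abs (b + 1)); pose proof (Rabs_pos (b + 1)); nra. }
assert (H2 : Lam * exp x <= Rabs Lam * exp x).
{ pose proof (Rle_abs Lam); pose proof (exp_pos x); nra. }
assert (H3 : exp x * ((alpha - 1) * x) <= exp (alpha * x)).
{ replace (alpha * x) with (x + (alpha - 1) * x) by ring; rewrite exp_plus.
  apply Rmult_le_compat_l; [left; apply exp_pos|].
  destruct (Req_dec ((alpha - 1) * x) 0) as [->|]; [rewrite exp_0; lra|].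
  pose proof (exp_ineq1 ((alpha - 1) * x) ltac:(auto)); lra. }
assert (H4 : c * (exp x * ((alpha - 1) * x)) <= c * exp (alpha * x))
  by (apply Rmult_le_compat_l; lra).
assert (H5 : exp x * (A - c * (alpha - 1) * x) <= exp X * A).
{ pose proof (exp_pos x); pose proof (exp_pos X).
  destruct (Rle_lt_dec X x) as [Hxx|Hxx].
  - assert (A <= c * (alpha - 1) * x).
    { replace A with (c * (alpha - 1) * X) by (unfold X; field; lra).
      apply Rmult_le_compat_l; lra. }
    assert (exp x * (A - c * (alpha - 1) * x) <= 0) by nra; nra.
  - assert (exp x <= exp X) by (apply exp_le; lra).
    assert (0 <= c * (alpha - 1) * x) by nra.
    apply Rle_trans with (exp x * A); [apply Rmult_le_compat_l; lra|].
    apply Rmult_le_compat_r; lra. }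
unfold A in H5; unfold A; lra.
Qed.

Lemma Cmod_integrand (alpha : R) (b a lam L : C) :
  Cmod (integrand alpha b a lam L) =
  exp (Re (b * L)%C - Re (a * Cexp (alpha * L))%C - Re (lam * Cexp L)%C).
Proof.
unfold integrand; rewrite Cmod_Cexp; f_equal; unfold Re, Cminus; simpl; ring.
Qed.

Lemma Re_Cexp_split (a L : C) (x : R) :
  Re (a * Cexp (x + L))%C = exp x * Re (a * Cexp L)%C.
Proof.
rewrite Cexp_plus, Cexp_R, <- re_scal_l; f_equal; ring.
Qed.

Definition is_integrand_fp (N : nat) (alpha : R) (b a lam l : C) : Prop :=
  is_fp (fun x : R => integrand alpha b a lam x) (fun x : R => singular_prim N alpha b a lam x) l.

(** The coefficient of [x] in [singular_prim]: only exponents equal to 0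
    contribute. *)
Definition pole_sum (N : nat) (alpha : R) (b a lam : C) : C :=
  Csum (fun n => exp_coef (- a) n * Csum (fun m =>
    if Ceq_dec (b + INR n * alpha + INR m)%C (RtoC 0) then exp_coef (- lam) m else RtoC 0) N)%C N.

Lemma integrand_shift (alpha : R) (b a lam L Lam : C) :
  integrand alpha b a lam (L + Lam) =
  (Cexp (b * Lam) * integrand alpha b (a * Cexp (alpha * Lam)) (lam * Cexp Lam) L)%C.
Proof.
unfold integrand; rewrite <- Cexp_plus; f_equal.
replace (alpha * (L + Lam))%C with (alpha * L + alpha * Lam)%C by ring.
rewrite !Cexp_plus; ring.
Qed.

Lemma singular_prim_shift (N : nat) (alpha : R) (b a lam L Lam : C) :
  singular_prim N alpha b a lam (L + Lam) =
  (Cexp (b * Lam) * singular_prim N alpha b (a * Cexp (alpha * Lam)) (lam * Cexp Lam) L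
   + Lam * pole_sum N alpha b a lam)%C.
Proof.
unfold singular_prim, pole_sum, laplace_prim; rewrite <- !Csum_scal, <- Csum_plus.
apply Csum_ext; intros n _.
replace (- (a * Cexp (alpha * Lam)))%C with (- a * Cexp (alpha * Lam))%C by ring.
rewrite exp_coef_mult_l, Cexp_pow.
match goal with |- (?u * ?A)%C = (?e * (?u * ?x * ?B) + Lam * (?u * ?D))%C =>
  transitivity (u * (e * x * B + Lam * D))%C; [f_equal|ring] end.
rewrite <- !Csum_scal, <- Csum_plus.
apply Csum_ext; intros m _.
replace (- (lam * Cexp Lam))%C with (- lam * Cexp Lam)%C by ring.
rewrite exp_coef_mult_l, Cexp_pow, exp_prim_shift.
replace ((b + INR n * alpha + INR m) * Lam)%C
  with (b * Lam + INR n * (alpha * Lam) + INR m * Lam)%C by ring.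
rewrite !Cexp_plus.
destruct (Ceq_dec _ _); ring.
Qed.

(** A translation by [Lam] multiplies the integrand by [exp (b Lam)] and
    rotates [a] and [lam].  The counterterm follows, except that each exponent 0
    adds [Lam] times its coefficient. *)
Lemma integrand_fp_shift (N : nat) (alpha : R) (b a lam Lam l : C) (c : R) :
  1 <= alpha -> 0 < Re b + INR N -> 0 < c ->
  (forall t : R, 0 <= t <= 1 ->
     0 <= Re (a * Cexp (alpha * (t * Lam)))%C /\ c <= Re (lam * Cexp (t * Lam))%C) ->
  is_integrand_fp N alpha b a lam l ->
  is_integrand_fp N alpha b (a * Cexp (alpha * Lam)) (lam * Cexp Lam)
    (Cexp (- (b * Lam)) * (l - Lam * pole_sum N alpha b a lam)).
Proof.
intros Ha Hb Hc Hpos H.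
assert (Sh : is_fp (fun x => integrand alpha b a lam (x + Lam)%C)
  (fun x => singular_prim N alpha b a lam (x + Lam)%C) l).
{ apply (fp_shift (integrand alpha b a lam) (singular_part N alpha b a lam) (singular_prim N alpha b a lam)).
  - apply holo_integrand.
  - apply Cdiff_singular_prim.
  - intros z; apply holo_Ccont, holo_singular_part.
  - intros eps He.
    destruct (linear_minus_exp (Re b) c Hc) as [K HK].
    destruct (exp_small 1 (eps / exp (K + Cmod (b * Lam)%C)) Rlt_0_1) as [M HM].
    { apply Rdiv_lt_0_compat; [exact He|apply exp_pos]. }
    exists (Rmax M 0); intros q t Hq Ht.
    pose proof (Rmax_l M 0); pose proof (Rmax_r M 0).
    destruct (Hpos t Ht) as [P1 P2].
    rewrite Cmod_integrand, Re_Cexp_split.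
    replace (alpha * (q + t * Lam))%C with (RtoC (alpha * q) + alpha * (t * Lam))%C
      by (rewrite RtoC_mult; ring).
    rewrite Re_Cexp_split.
    assert (E : Re (b * (q + t * Lam))%C <= Re b * q + Cmod (b * Lam)%C).
    { replace (b * (q + t * Lam))%C with (b * q + t * (b * Lam))%C by ring.
      rewrite re_plus, re_scal_r, re_scal_l.
      pose proof (Re_le_Cmod (b * Lam)%C); pose proof (Cmod_ge_0 (b * Lam)%C); nra. }
    specialize (HK q ltac:(lra)).
    pose proof (exp_pos q); pose proof (exp_pos (alpha * q)).
    assert (c * exp q <= exp q * Re (lam * Cexp (t * Lam))%C) by nra.
    assert (0 <= exp (alpha * q) * Re (a * Cexp (alpha * (t * Lam)))%C) by nra.
    apply Rle_trans with (exp (K + Cmod (b * Lam)%C + 1 * - q)); [apply exp_le; lra|].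
    rewrite exp_plus; specialize (HM (- q) ltac:(lra)).
    pose proof (exp_pos (K + Cmod (b * Lam)%C)).
    left; rewrite Rmult_comm; apply Rlt_div_mult; assumption.
  - intros eps He.
    set (T := taylor_const N a lam); set (D := Cmod (b * Lam)%C + INR N * Cmod Lam).
    assert (HT : 0 <= T) by apply taylor_const_pos.
    assert (HTD : 0 < 1 + T * exp D) by (pose proof (exp_pos D); nra).
    destruct (exp_small (Re b + INR N) (eps / (1 + T * exp D)) Hb) as [M HM].
    { apply Rdiv_lt_0_compat; lra. }
    exists (Rmax M (Cmod Lam)); intros p t Hp Ht.
    pose proof (Rmax_l M (Cmod Lam)); pose proof (Rmax_r M (Cmod Lam)).
    pose proof (Re_le_Cmod Lam); pose proof (Cmod_ge_0 Lam).
    assert (ER : Re (p + t * Lam)%C = p + t * Re Lam) by (rewrite re_plus, re_RtoC, re_scal_l; ring).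
    assert (tL : t * Re Lam <= Cmod Lam) by nra.
    eapply Rle_trans; [apply integrand_taylor; [exact Ha|rewrite ER; lra]|].
    rewrite ER; fold T.
    assert (E : Re (b * (p + t * Lam))%C <= Re b * p + Cmod (b * Lam)%C).
    { replace (b * (p + t * Lam))%C with (b * p + t * (b * Lam))%C by ring.
      rewrite re_plus, re_scal_r, re_scal_l.
      pose proof (Re_le_Cmod (b * Lam)%C); pose proof (Cmod_ge_0 (b * Lam)%C); nra. }
    apply Rle_trans with (T * exp (D + (Re b + INR N) * p)).
    + apply Rmult_le_compat_l; [exact HT|]; apply exp_le.
      pose proof (pos_INR N).
      assert (INR N * (p + t * Re Lam) <= INR N * (p + Cmod Lam))
        by (apply Rmult_le_compat_l; lra).
      unfold D; lra.
    + rewrite exp_plus; specialize (HM p ltac:(lra)).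
      apply Rlt_div_mult in HM; [|exact HTD].
      pose proof (exp_pos ((Re b + INR N) * p)); nra.
  - exact H. }
assert (Sc := fp_scal (Cexp (- (b * Lam))) _ _ _
  ltac:(intros x; apply (Rcont_holo (fun L => integrand alpha b a lam (L + Lam)%C));
        apply (holo_comp (integrand alpha b a lam) (fun L => L + Lam)%C);
        [apply holo_integrand|holo]) Sh).
assert (EE : (Cexp (- (b * Lam)) * Cexp (b * Lam))%C = RtoC 1).
{ rewrite <- Cexp_plus; replace (- (b * Lam) + b * Lam)%C with (RtoC 0) by ring; apply Cexp_0. }
set (P := pole_sum N alpha b a lam) in *.
unfold is_integrand_fp.
eapply fp_ext; [| | |apply (fp_change _ _ (fun x : R =>
   Cexp (- (b * Lam)) * singular_prim N alpha b a lam (x + Lam) - Cexp (- (b * Lam)) * (Lam * P))%C _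
   (- (Cexp (- (b * Lam)) * (Lam * P)))%C) with (2 := Sc)].
- intros x; cbv beta; rewrite integrand_shift, Cmult_assoc, EE; ring.
- intros x; cbv beta; rewrite singular_prim_shift; fold P.
  match goal with |- (_ * (_ * ?s + _) - _)%C = _ => replace s with (RtoC 1 * s)%C at 2 by ring end.
  rewrite <- EE; ring.
- ring.
- apply lim_m_infty_ext with (fun _ => (- (Cexp (- (b * Lam)) * (Lam * P)))%C);
    [intros; ring|apply lim_m_infty_const].
Qed.

(** * The finite part that defines F *)

Lemma log_substitution (f g : R -> C) (a b : R) :
  0 < a -> 0 < b -> (forall x, Rcont f x) ->
  (forall t, 0 < t -> g t = (f (ln t) * RtoC (/ t))%C) ->
  @is_RInt CV g a b (CInt f (ln a) (ln b)).
Proof.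
intros Ha Hb Cf Hg.
assert (Hpos : forall x, Rmin a b <= x <= Rmax a b -> 0 < x).
{ intros x Hx; pose proof (Rmin_pos a b Ha Hb); lra. }
apply (is_RInt_ext (V := CV)
  (fun t : R => @scal R_AbsRing CV (/ t) (f (ln t)))).
- intros x Hx; rewrite Hg by (apply Hpos; lra).
  rewrite Cmult_comm; apply (scal_R_Cmult (/ x) (f (ln x))).
- with_strategy transparent [CInt] unfold CInt.
  apply (is_RInt_comp (V := CV) f ln Rinv).
  + intros x _. with_strategy transparent [Rcont] exact (Cf (ln x)).
  + intros x Hx; specialize (Hpos x Hx); split.
    * apply is_derive_Reals, derivable_pt_lim_ln, Hpos.
    * apply continuous_Rinv; lra.
Qed.

Lemma locally_C (l : C) (P : C -> Prop) :
  @locally CV l P ->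
  exists eps, 0 < eps /\ forall y, Cmod (y - l)%C < eps -> P y.
Proof.
intros [e He]; exists e; split; [apply e|]; intros y Hy; apply He, ball_C, Hy.
Qed.

Lemma RInt_gen_log (Fa Fb : (R -> Prop) -> Prop) {FFa : ProperFilter' Fa} {FFb : ProperFilter' Fb}
  (f g : R -> C) (l : C) :
  (forall x, Rcont f x) -> (forall t, 0 < t -> g t = (f (ln t) * RtoC (/ t))%C) ->
  (forall eps, 0 < eps -> filter_prod Fa Fb (fun ab => 0 < fst ab /\ 0 < snd ab /\
     Cmod (CInt f (ln (fst ab)) (ln (snd ab)) - l)%C < eps)) ->
  RInt_gen (V := CV) g Fa Fb = l.
Proof.
intros Cf Hg Hl; apply (is_RInt_gen_unique (V := CV)).
intros P HP; destruct (locally_C l P HP) as (eps & He & HP').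
destruct (Hl eps He) as [A B HA HB HAB].
apply (Filter_prod _ _ _ A B HA HB); intros x y Hx Hy; simpl.
destruct (HAB x y Hx Hy) as (Px & Py & Hlt).
exists (CInt f (ln x) (ln y)); split; [now apply log_substitution|now apply HP'].
Qed.

Lemma at_right_exp (M : R) : at_right 0 (fun x => 0 < x /\ ln x <= - M).
Proof.
exists (mkposreal _ (exp_pos (- M))); intros y Hy Hy0; split; [exact Hy0|].
unfold ball in Hy; simpl in Hy; unfold AbsRing_ball, abs, minus, plus, opp in Hy; simpl in Hy.
rewrite Ropp_0, Rplus_0_r, Rabs_pos_eq in Hy by lra.
rewrite <- (ln_exp (- M)); apply ln_le; lra.
Qed.

Lemma p_infty_exp (M : R) : Rbar_locally p_infty (fun x => 0 < x /\ M <= ln x).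
Proof.
exists (exp M); intros y Hy; pose proof (exp_pos M); split; [lra|].
rewrite <- (ln_exp M); apply ln_le; lra.
Qed.

Lemma RInt_gen_upper (f g : R -> C) (l : C) :
  (forall x, Rcont f x) -> (forall t, 0 < t -> g t = (f (ln t) * RtoC (/ t))%C) ->
  lim_p_infty (fun q => CInt f 0 q) l ->
  RInt_gen (V := CV) g (at_point 1) (Rbar_locally p_infty) = l.
Proof.
intros Cf Hg Hl; apply (RInt_gen_log _ _ f g l Cf Hg); intros eps He.
destruct (Hl eps He) as [M HM].
apply (Filter_prod _ _ _ (fun x => x = 1) _ (eq_refl : at_point 1 (fun x => x = 1)) (p_infty_exp M)).
intros x y -> [Hy Hly]; simpl; rewrite ln_1; repeat split; [lra|exact Hy|now apply HM].
Qed.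

Lemma RInt_gen_lower (f g : R -> C) (l : C) :
  (forall x, Rcont f x) -> (forall t, 0 < t -> g t = (f (ln t) * RtoC (/ t))%C) ->
  lim_m_infty (fun p => CInt f p 0) l ->
  RInt_gen (V := CV) g (at_right 0) (at_point 1) = l.
Proof.
intros Cf Hg Hl; apply (RInt_gen_log _ _ f g l Cf Hg); intros eps He.
destruct (Hl eps He) as [M HM].
apply (Filter_prod _ _ _ _ (fun x => x = 1) (at_right_exp M)
  (eq_refl : at_point 1 (fun x => x = 1))).
intros x y [Hx Hlx] ->; simpl; rewrite ln_1; repeat split; [exact Hx|lra|now apply HM].
Qed.

Lemma RInt_gen_line (f g : R -> C) (l : C) :
  (forall x, Rcont f x) -> (forall t, 0 < t -> g t = (f (ln t) * RtoC (/ t))%C) ->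
  is_fp f (fun _ => RtoC 0) l ->
  RInt_gen (V := CV) g (at_right 0) (Rbar_locally p_infty) = l.
Proof.
intros Cf Hg Hl; apply (RInt_gen_log _ _ f g l Cf Hg); intros eps He.
destruct (Hl eps He) as [M HM].
apply (Filter_prod _ _ _ _ _ (at_right_exp M) (p_infty_exp M)).
intros x y [Hx Hlx] [Hy Hly]; simpl; repeat split; [exact Hx|exact Hy|].
rewrite <- (Cplus_0_r (CInt _ _ _)); now apply HM.
Qed.

Lemma upper_limit (alpha : R) (b a lam : C) :
  0 <= Re a -> 0 < Re lam ->
  exists l, lim_p_infty (fun q => CInt (fun x : R => integrand alpha b a lam x) 0 q) l.
Proof.
intros Ha Hl; destruct (linear_minus_exp (Re b) (Re lam) Hl) as [K HK].
destruct (lim_p_infty_dominated (fun x : R => integrand alpha b a lam x) (exp K)) as (l & Hlim & _).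
- apply Rcont_integrand.
- intros x Hx; rewrite Cmod_integrand, <- exp_plus; apply exp_le.
  specialize (HK x Hx).
  rewrite <- RtoC_mult, !Cexp_R, !re_scal_r.
  pose proof (exp_pos (alpha * x)); nra.
- now exists l.
Qed.

Lemma Csum_extend (f : nat -> C) (M N : nat) :
  (M <= N)%nat -> (forall k, (M <= k)%nat -> f k = RtoC 0) -> Csum f N = Csum f M.
Proof.
intros HMN H; induction HMN as [|N HMN IH]; [reflexivity|].
simpl; rewrite IH, H by exact HMN; ring.
Qed.

(** Sums over [low_sum] are extended to squares [m, n < N] with a common
    [N], so that sums for different exponents can be compared term by term. *)
Definition square_sum (N : nat) (c : nat -> nat -> C) : C :=
  Csum (fun n => Csum (fun m => c m n) N) N.

Lemma low_sum_square (alpha : R) (beta : C) (c : nat -> nat -> C) (N : nat) :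
  1 <= alpha -> (index_bound beta <= N)%nat ->
  low_sum alpha beta c =
  square_sum N (fun m n => if Rle_dec (INR m + INR n * alpha + Re beta) (-1) then c m n else RtoC 0).
Proof.
intros Ha HN; unfold square_sum; rewrite Csum_exchange; unfold low_sum.
set (g := fun m n => if Rle_dec (INR m + INR n * alpha + Re beta) (-1) then c m n else RtoC 0).
assert (H0 : forall m n, (index_bound beta <= m \/ index_bound beta <= n)%nat -> g m n = RtoC 0).
{ intros m n H; unfold g; destruct (Rle_dec _ _) as [Hle|]; [|reflexivity].
  destruct (index_bound_spec alpha beta m n Ha Hle); lia. }
transitivity (Csum (fun m => Csum (fun n => g m n) N) (index_bound beta)).
- apply Csum_ext; intros m _; symmetry; apply Csum_extend; [exact HN|].
  intros n Hn; apply H0; now right.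
- symmetry; apply Csum_extend; [exact HN|]; intros m Hm.
  rewrite (Csum_ext _ (fun _ => RtoC 0)), Csum_zero; [reflexivity|].
  intros n _; apply H0; now left.
Qed.

Lemma square_sum_ext (N : nat) (c d : nat -> nat -> C) :
  (forall m n, (m < N)%nat -> (n < N)%nat -> c m n = d m n) -> square_sum N c = square_sum N d.
Proof. intros H; apply Csum_ext; intros n Hn; apply Csum_ext; intros m Hm; now apply H. Qed.

Lemma square_sum_plus (N : nat) (c d : nat -> nat -> C) :
  square_sum N (fun m n => c m n + d m n)%C = (square_sum N c + square_sum N d)%C.
Proof.
unfold square_sum; rewrite <- Csum_plus; apply Csum_ext; intros; now rewrite Csum_plus.
Qed.

Lemma square_sum_scal (N : nat) (k : C) (c : nat -> nat -> C) :
  square_sum N (fun m n => k * c m n)%C = (k * square_sum N c)%C.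
Proof.
unfold square_sum; rewrite <- Csum_scal; apply Csum_ext; intros; now rewrite Csum_scal.
Qed.

Lemma lim_m_infty_square (N : nat) (c : nat -> nat -> R -> C) :
  (forall m n, lim_m_infty (c m n) (RtoC 0)) ->
  lim_m_infty (fun p => square_sum N (fun m n => c m n p)) (RtoC 0).
Proof.
intros H; unfold square_sum.
replace (RtoC 0) with (Csum (fun _ => RtoC 0) N) by apply Csum_zero.
apply (lim_m_infty_Csum (fun n p => Csum (fun m => c m n p) N)); intros n _.
replace (RtoC 0) with (Csum (fun _ => RtoC 0) N) by apply Csum_zero.
apply (lim_m_infty_Csum (fun m p => c m n p)); intros m _; apply H.
Qed.

Lemma singular_prim_square (N : nat) (alpha : R) (b a lam L : C) :
  singular_prim N alpha b a lam L =
  square_sum N (fun m n => exp_coef (- a) n * exp_coef (- lam) m * exp_prim (b + INR n * alpha + INR m) L)%C.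
Proof.
unfold singular_prim, laplace_prim, square_sum; apply Csum_ext; intros n _.
rewrite <- Csum_scal; apply Csum_ext; intros; ring.
Qed.

Lemma pole_sum_square (N : nat) (alpha : R) (b a lam : C) :
  pole_sum N alpha b a lam =
  square_sum N (fun m n => if Ceq_dec (b + INR n * alpha + INR m)%C (RtoC 0)
                           then exp_coef (- a) n * exp_coef (- lam) m else RtoC 0)%C.
Proof.
unfold pole_sum, square_sum; apply Csum_ext; intros n _.
rewrite <- Csum_scal; apply Csum_ext; intros m _; destruct (Ceq_dec _ _); ring.
Qed.

Lemma F_coef_exp_coef (z : C) (m n : nat) :
  F_coef z m n = (exp_coef (- - Ci) n * exp_coef (- (Ci * z)) m)%C.
Proof.
unfold F_coef, exp_coef.
replace (- - Ci)%C with Ci by ring; replace (- (Ci * z))%C with (- Ci * z)%C by ring.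
field; split; apply fact_nz.
Qed.

Lemma F_exponent_eq (alpha : R) (beta : C) (m n : nat) :
  F_exponent alpha beta m n = (beta + 1 + INR n * alpha + INR m)%C.
Proof. unfold F_exponent; ring. Qed.

Lemma index_bound_large (beta : C) (N : nat) :
  (index_bound beta <= N)%nat -> 0 < Re (beta + 1)%C + INR N.
Proof.
intros H; apply le_INR in H; unfold index_bound in H.
destruct (archimed (- 1 - Re beta)) as [Hu _].
assert (IZR (up (- 1 - Re beta)) <= INR (Z.to_nat (up (- 1 - Re beta)))).
{ rewrite INR_IZR_INZ; apply IZR_le; lia. }
rewrite re_plus, re_RtoC; lra.
Qed.

Lemma Rpower_exp (t k : R) : RtoC (Rpower t k) = Cexp (k * ln t).
Proof. unfold Rpower; rewrite <- RtoC_mult, Cexp_R; reflexivity. Qed.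

Lemma Rinv_exp (t : R) : 0 < t -> RtoC (/ t) = Cexp (- ln t).
Proof.
intros Ht; rewrite <- RtoC_opp, Cexp_R, exp_Ropp, exp_ln by exact Ht; reflexivity.
Qed.

(** The integral over [(1, + oo)] is the upper half of the finite part.
    The integral over [(0, 1)] has the terms of [low_sum] subtracted, and the last
    sum in the definition of [F_finite_part] adds the values at 0 of their
    primitives [exp_prim], so the result is the lower half of the finite part. *)
Lemma F_integrand_fp (N : nat) (alpha : R) (beta z : C) :
  1 < alpha -> Im z < 0 -> (index_bound beta <= N)%nat ->
  is_integrand_fp N alpha (beta + 1) (- Ci) (Ci * z) (F_finite_part alpha beta z).
Proof.
intros Ha Hz HN.
pose proof (index_bound_large beta N HN) as Hb.
set (b := (beta + 1)%C) in *; set (lam := (Ci * z)%C).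
set (f := fun x : R => integrand alpha b (- Ci) lam x).
assert (Cf : forall x, Rcont f x) by apply Rcont_integrand.
destruct (lower_finite_part N alpha b (- Ci) lam ltac:(lra) Hb) as [l1 H1]; fold f in H1.
destruct (upper_limit alpha b (- Ci) lam) as [l2 H2].
{ simpl; lra. }
{ unfold lam; rewrite Cmult_comm, re_mult_Ci; lra. }
fold f in H2.
set (w := fun m n : nat => (b + INR n * alpha + INR m)%C).
set (c := fun m n => F_coef z m n).
set (low := fun (m n : nat) (x y : C) =>
  if Rle_dec (INR m + INR n * alpha + Re beta) (-1) then x else y).
assert (ELow : forall d, low_sum alpha beta d = square_sum N (fun m n => low m n (d m n) (RtoC 0)))
  by (intros d; apply low_sum_square; [lra|exact HN]).
set (e := fun x : R => square_sum N (fun m n => low m n (c m n * Cexp (w m n * x)) (RtoC 0))%C).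
set (T := fun L : C => square_sum N (fun m n => low m n (c m n * exp_prim (w m n) L) (RtoC 0))%C).
assert (CDT : forall L : C, Cdiff T L (square_sum N (fun m n => low m n (c m n * Cexp (w m n * L)) (RtoC 0)))%C).
{ intros L; unfold T, square_sum.
  apply (Cdiff_Csum (fun n L => Csum (fun m => low m n (c m n * exp_prim (w m n) L) (RtoC 0)) N)%C
    (fun n => Csum (fun m => low m n (c m n * Cexp (w m n * L)) (RtoC 0)) N)%C); intros n _.
  apply (Cdiff_Csum (fun m L => low m n (c m n * exp_prim (w m n) L) (RtoC 0))%C
    (fun m => low m n (c m n * Cexp (w m n * L)) (RtoC 0))%C); intros m _.
  unfold low; destruct (Rle_dec _ _); [|apply Cdiff_const].
  apply (Cdiff_scal (c m n) (exp_prim (w m n))), Cdiff_exp_prim. }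
assert (Ce' : forall L : C, Ccont (fun L => square_sum N (fun m n => low m n (c m n * Cexp (w m n * L)) (RtoC 0)))%C L).
{ intros L; apply holo_Ccont; unfold square_sum.
  apply (holo_Csum (fun n L => Csum (fun m => low m n (c m n * Cexp (w m n * L)) (RtoC 0)) N)%C).
  intros n; apply (holo_Csum (fun m L => low m n (c m n * Cexp (w m n * L)) (RtoC 0))%C).
  intros m; unfold low; destruct (Rle_dec _ _); holo. }
assert (Ce : forall x, Rcont e x).
{ intros x; apply Rcont_ext with (fun x : R => square_sum N (fun m n => low m n (c m n * Cexp (w m n * (0 + x * 1))) (RtoC 0)))%C.
  - intros y; unfold e; replace (0 + y * 1)%C with (RtoC y) by ring; reflexivity.
  - apply (Rcont_line (fun L => square_sum N (fun m n => low m n (c m n * Cexp (w m n * L)) (RtoC 0)))%C), Ce'. }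
assert (Ie : forall p, CInt e p 0 = (T (RtoC 0) - T (RtoC p))%C).
{ intros p; pose proof (CInt_FTC T _ (RtoC 0) (RtoC 1) p 0 CDT Ce') as F.
  replace (0 + 0 * 1)%C with (RtoC 0) in F by ring.
  replace (0 + p * 1)%C with (RtoC p) in F by ring.
  rewrite <- F; apply CInt_ext; intros x; unfold e.
  replace (0 + x * 1)%C with (RtoC x) by ring; ring. }
assert (HT : lim_m_infty (fun p : R => singular_prim N alpha b (- Ci) lam p - T p)%C (RtoC 0)).
{ apply lim_m_infty_ext with (fun p : R =>
    square_sum N (fun m n => low m n (RtoC 0) (c m n * exp_prim (w m n) p)))%C.
  - intros p; rewrite singular_prim_square; unfold T.
    match goal with |- ?X = (?Y - ?Z)%C => replace Y with (X + Z)%C; [ring|] end.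
    rewrite <- square_sum_plus; apply square_sum_ext; intros m n _ _.
    unfold c, w, low; rewrite F_coef_exp_coef; fold lam; destruct (Rle_dec _ _); ring.
  - apply (lim_m_infty_square N (fun m n p => low m n (RtoC 0) (c m n * exp_prim (w m n) p)))%C.
    intros m n; unfold low; destruct (Rle_dec _ _) as [|Hgt]; [apply lim_m_infty_const|].
    replace (RtoC 0) with (c m n * RtoC 0)%C by ring.
    apply (lim_m_infty_scal (c m n)), exp_prim_lim.
    unfold w, b; rewrite !re_plus, re_scal_l, !re_RtoC; lra. }
assert (HL : lim_m_infty (fun p => CInt (fun x => f x - e x)%C p 0) (l1 - T (RtoC 0))%C).
{ apply lim_m_infty_ext with (fun p : R => (CInt f p 0 + singular_prim N alpha b (- Ci) lam p)
    + ((-1)%R * (singular_prim N alpha b (- Ci) lam p - T p) + - T (RtoC 0)))%C.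
  - intros p; rewrite CInt_minus, Ie by assumption; ring.
  - replace (l1 - T (RtoC 0))%C with (l1 + ((-1)%R * RtoC 0 + - T (RtoC 0)))%C by ring.
    apply lim_m_infty_plus; [exact H1|].
    apply lim_m_infty_plus; [now apply lim_m_infty_scal|apply lim_m_infty_const]. }
unfold is_integrand_fp; fold f.
replace (F_finite_part alpha beta z) with (l1 + l2)%C; [now apply fp_halves|].
unfold F_finite_part.
assert (Ef : forall t, 0 < t -> (Rcpow t beta * F_exp alpha z t)%C = (f (ln t) * RtoC (/ t))%C).
{ intros t Ht; unfold f, integrand, Rcpow, F_exp; rewrite Rinv_exp, <- !Cexp_plus by exact Ht.
  f_equal; unfold b, lam; rewrite Rpower_exp, Cexp_R, exp_ln by exact Ht.
  ring. }
rewrite (RInt_gen_upper f _ l2 Cf Ef H2).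
rewrite (RInt_gen_lower (fun x => f x - e x)%C _ (l1 - T (RtoC 0))%C); [| | |exact HL].
- rewrite ELow.
  match goal with |- _ = (_ + _ + ?X)%C => replace X with (T (RtoC 0)); [ring|] end.
  unfold T; apply square_sum_ext; intros m n _ _.
  unfold low; destruct (Rle_dec _ _); [|reflexivity].
  unfold exp_prim; rewrite F_exponent_eq; fold b (w m n) (c m n).
  destruct (Ceq_dec _ _); [ring|].
  rewrite Cmult_0_r, Cexp_0; reflexivity.
- intros x; now apply Rcont_minus.
- intros t Ht.
  replace (Rcpow t beta * (F_exp alpha z t - low_sum alpha beta (fun m n =>
      F_coef z m n * Rpower t (INR n * alpha + INR m))))%C
    with (Rcpow t beta * F_exp alpha z t - Rcpow t beta * low_sum alpha beta (fun m n =>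
      F_coef z m n * Rpower t (INR n * alpha + INR m)))%C by ring.
  rewrite Ef by exact Ht.
  match goal with |- (_ - ?X)%C = _ => replace X with (e (ln t) * RtoC (/ t))%C; [ring|] end.
  rewrite ELow; unfold e.
  rewrite Cmult_comm, <- !square_sum_scal; apply square_sum_ext; intros m n _ _.
  unfold low; destruct (Rle_dec _ _); [|ring].
  fold (c m n); rewrite Rpower_exp, Rinv_exp by exact Ht; unfold Rcpow.
  transitivity (c m n * (Cexp (- ln t) * Cexp (w m n * ln t)))%C; [ring|].
  transitivity (c m n * (Cexp (beta * ln t) * Cexp (RtoC (INR n * alpha + INR m) * ln t)))%C; [|ring].
  f_equal; rewrite <- !Cexp_plus; f_equal.
  unfold w, b; rewrite RtoC_plus, RtoC_mult; ring.
Qed.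

(** * The finite part as an entire function *)

(** The mean value inequality, once for [exp_rem (K + 2)] minus its
    linear part and once for [exp_rem (K + 1)]. *)
Lemma exp_rem_second_order (K : nat) (u v : C) :
  Cmod (exp_rem (S (S K)) (u + v) - exp_rem (S (S K)) u - v * exp_rem (S K) u)%C
  <= Cmod v * Cmod v * (exp (Cmod u + Cmod v) * (Cmod u + Cmod v) ^ K).
Proof.
set (M := exp (Cmod u + Cmod v) * (Cmod u + Cmod v) ^ K).
pose proof (Cmod_ge_0 u); pose proof (Cmod_ge_0 v).
assert (HM : 0 <= M).
{ apply Rmult_le_pos; [left; apply exp_pos|apply pow_le; lra]. }
assert (HK : forall w, Cmod w <= Cmod u + Cmod v -> Cmod (exp_rem K w) <= M).
{ intros w Hw; eapply Rle_trans; [apply exp_rem_bound_gen|].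
  apply Rmult_le_compat; [left; apply exp_pos|apply pow_le, Cmod_ge_0|now apply exp_le|].
  apply pow_incr; split; [apply Cmod_ge_0|exact Hw]. }
assert (Huv : forall s, 0 <= s <= 1 -> Cmod (u + s * v)%C <= Cmod u + Cmod v).
{ intros s Hs; eapply Rle_trans; [apply Cmod_triangle|].
  rewrite Cmod_mult, Cmod_R, Rabs_pos_eq by lra; nra. }
set (g := fun w : C => (exp_rem (S (S K)) w - w * exp_rem (S K) u)%C).
set (dg := fun w : C => (exp_rem (S K) w - exp_rem (S K) u)%C).
assert (Hg : forall w, Cdiff g w (dg w)).
{ intros w; eapply Cdiff_val.
  - apply (Cdiff_minus (exp_rem (S (S K))) (fun w => w * exp_rem (S K) u)%C); [apply Cdiff_exp_rem|cdiff].
  - unfold dg; ring. }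
assert (Hdg : forall w, Ccont dg w).
{ intros w; apply (Cdiff_cont dg w (exp_rem K w - 0)%C).
  apply (Cdiff_minus (exp_rem (S K)) (fun _ => exp_rem (S K) u)); [apply Cdiff_exp_rem|apply Cdiff_const]. }
assert (B := Cdiff_mean_value g dg u (u + v) (M * Cmod v) Hg Hdg).
replace (u + v - u)%C with v in B by ring.
replace (exp_rem (S (S K)) (u + v) - exp_rem (S (S K)) u - v * exp_rem (S K) u)%C
  with (g (u + v) - g u)%C by (unfold g; ring).
eapply Rle_trans; [apply B|right; unfold M; ring].
intros s Hs; unfold dg.
assert (B2 := Cdiff_mean_value (exp_rem (S K)) (exp_rem K) u (u + s * v) M (Cdiff_exp_rem K) (Ccont_exp_rem K)).
replace (u + s * v - u)%C with (s * v)%C in B2 by ring.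
eapply Rle_trans; [apply B2|].
- intros s' Hs'; replace (u + s' * (s * v))%C with (u + RtoC (s' * s) * v)%C
    by (rewrite RtoC_mult; ring).
  apply HK, Huv; nra.
- rewrite Cmod_mult, Cmod_R, Rabs_pos_eq by lra.
  apply Rmult_le_compat_l; [exact HM|]; nra.
Qed.

(** The constant [K] is chosen before [A] and [g]; in [remainder_entire],
    [A] is quadratic in the increment of [lam], with the same [K]. *)
Lemma superexp_integral (alpha k c Lam : R) :
  1 < alpha -> 0 < k -> 0 < c -> 0 <= Lam ->
  exists K, 0 <= K /\ forall (A : R) (g : R -> C), 0 <= A -> (forall x, Rcont g x) ->
    (forall x, Cmod (g x) <= A * exp (k * x + Lam * exp x - c * exp (alpha * x))) ->
    exists l, is_fp g (fun _ => RtoC 0) l /\ Cmod l <= A * K.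
Proof.
intros Ha Hk Hc HL; destruct (superexp_bound alpha k c Lam Ha Hc) as [K0 H0].
set (K1 := exp Lam + exp K0).
assert (HK1 : 0 < K1) by (pose proof (exp_pos Lam); pose proof (exp_pos K0); unfold K1; lra).
exists (K1 / k + K1); split.
{ pose proof (Rdiv_lt_0_compat K1 k HK1 Hk); lra. }
intros A g HA Cg Hg.
destruct (fp_dominated g (A * K1) k Hk Cg) as (l & Hl & B).
- intros x Hx; eapply Rle_trans; [apply Hg|]; rewrite Rmult_assoc.
  apply Rmult_le_compat_l; [exact HA|].
  apply Rle_trans with (exp Lam * exp (k * x)).
  + rewrite <- exp_plus; apply exp_le.
    assert (exp x <= 1) by (rewrite <- exp_0; now apply exp_le).
    pose proof (exp_pos (alpha * x)); nra.
  + pose proof (exp_pos K0); pose proof (exp_pos (k * x)); unfold K1; nra.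
- intros x Hx; eapply Rle_trans; [apply Hg|]; rewrite Rmult_assoc.
  apply Rmult_le_compat_l; [exact HA|].
  apply Rle_trans with (exp K0 * exp (- x)).
  + rewrite <- exp_plus; apply exp_le; specialize (H0 x Hx); lra.
  + pose proof (exp_pos Lam); pose proof (exp_pos (- x)); unfold K1; nra.
- exists l; split; [exact Hl|]; eapply Rle_trans; [exact B|right; field; lra].
Qed.

Lemma Rcont_exp_rem (N : nat) (lam : C) (x : R) :
  Rcont (fun t : R => exp_rem N (- lam * Cexp t)%C) x.
Proof.
apply (Rcont_holo (fun L => exp_rem N (- lam * Cexp L)%C)).
apply (holo_comp (exp_rem N) (fun L => - lam * Cexp L)%C); [apply holo_exp_rem|holo].
Qed.

Lemma Rcont_Cexp (x : R) : Rcont (fun t : R => Cexp t) x.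
Proof. apply (Rcont_holo Cexp), holo_Cexp. Qed.

Lemma Cmod_integrand_0 (alpha : R) (b a : C) (x : R) :
  Cmod (integrand alpha b a (RtoC 0) x) = exp (Re b * x - Re a * exp (alpha * x)).
Proof.
rewrite Cmod_integrand, <- RtoC_mult, !Cexp_R, !re_scal_r, re_RtoC; f_equal; ring.
Qed.

Lemma Cmod_lam_exp (lam : C) (x : R) : Cmod (- lam * Cexp x)%C = Cmod lam * exp x.
Proof. rewrite Cmod_mult, Cmod_opp, Cmod_Cexp, re_RtoC; reflexivity. Qed.

Lemma pow_exp_bound (x y : R) (N : nat) : 0 <= y ->
  (y * exp x) ^ N = y ^ N * exp (INR N * x).
Proof. intros Hy; now rewrite Rpow_mult_distr, exp_INR. Qed.

Lemma holo_exp_coef (m : nat) : holo (fun u => exp_coef u m).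
Proof.
destruct m as [|m]; [|intros u; eexists; apply Cdiff_exp_coef].
apply holo_ext with (fun _ => RtoC 1); [intros; now rewrite exp_coef_0|apply holo_const].
Qed.

Lemma holo_exp_coef_opp (m : nat) : holo (fun lam => exp_coef (- lam) m).
Proof. apply (holo_comp (fun u => exp_coef u m) (fun lam => - lam)%C); [apply holo_exp_coef|holo]. Qed.

Section Entire.

Context (K : nat) (alpha : R) (b a : C).
Context (Halpha : 1 < alpha) (Ha : 0 < Re a) (Hb : 0 < Re b + INR (S (S K))).

Let N := S (S K).
Let h (x : R) : C := integrand alpha b a (RtoC 0) x.

Lemma remainder_integral (lam : C) :
  exists l, is_fp (fun x => h x * exp_rem N (- lam * Cexp x))%C (fun _ => RtoC 0) l.
Proof.
destruct (superexp_integral alpha (Re b + INR N) (Re a) (Cmod lam) Halpha Hb Ha (Cmod_ge_0 lam))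
  as (C0 & _ & H).
destruct (H (Cmod lam ^ N) (fun x => h x * exp_rem N (- lam * Cexp x))%C) as (l & Hl & _).
- apply pow_le, Cmod_ge_0.
- intros x; apply Rcont_mult; [apply Rcont_integrand|apply Rcont_exp_rem].
- intros x; unfold h; rewrite Cmod_mult, Cmod_integrand_0.
  eapply Rle_trans; [apply Rmult_le_compat_l; [left; apply exp_pos|apply exp_rem_bound_gen]|].
  rewrite Cmod_lam_exp, pow_exp_bound by apply Cmod_ge_0.
  right.
  replace ((Re b + INR N) * x + Cmod lam * exp x - Re a * exp (alpha * x))
    with ((Re b * x - Re a * exp (alpha * x)) + (Cmod lam * exp x) + INR N * x) by ring.
  rewrite !exp_plus; ring.
- now exists l.
Qed.

Lemma remainder_derivative_integral (lam : C) :
  exists l, is_fp (fun x => h x * (- Cexp x * exp_rem (S K) (- lam * Cexp x)))%C (fun _ => RtoC 0) l.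
Proof.
destruct (superexp_integral alpha (Re b + INR N) (Re a) (Cmod lam) Halpha Hb Ha (Cmod_ge_0 lam))
  as (C0 & _ & H).
destruct (H (Cmod lam ^ S K) (fun x => h x * (- Cexp x * exp_rem (S K) (- lam * Cexp x)))%C) as (l & Hl & _).
- apply pow_le, Cmod_ge_0.
- intros x; apply Rcont_mult; [apply Rcont_integrand|].
  apply Rcont_mult; [apply (Rcont_holo (fun L => - Cexp L)%C); holo|apply Rcont_exp_rem].
- intros x; unfold h; rewrite !Cmod_mult, Cmod_opp, Cmod_integrand_0, Cmod_Cexp, re_RtoC.
  eapply Rle_trans; [apply Rmult_le_compat_l; [left; apply exp_pos|
    apply Rmult_le_compat_l; [left; apply exp_pos|apply exp_rem_bound_gen]]|].
  rewrite Cmod_lam_exp, pow_exp_bound by apply Cmod_ge_0.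
  right.
  replace ((Re b + INR N) * x + Cmod lam * exp x - Re a * exp (alpha * x))
    with ((Re b * x - Re a * exp (alpha * x)) + (Cmod lam * exp x) + (INR (S K) * x + x))
    by (unfold N; rewrite (S_INR (S K)); ring).
  rewrite !exp_plus; ring.
- now exists l.
Qed.

(** Differentiation under the integral sign: the second order Taylor
    remainder of [exp_rem N] in [lam] is integrated with [superexp_integral]. *)
Lemma remainder_entire : exists Psi : C -> C,
  (forall lam, is_fp (fun x => h x * exp_rem N (- lam * Cexp x))%C (fun _ => RtoC 0) (Psi lam)) /\
  holo Psi.
Proof.
destruct (functional_choice _ remainder_integral) as [Psi HPsi].
exists Psi; split; [exact HPsi|]; intros lam.
destruct (remainder_derivative_integral lam) as [D HD].
exists D; apply Cdiff_eps; intros eps He.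
pose proof (Cmod_ge_0 lam) as HL.
destruct (superexp_integral alpha (Re b + INR N) (Re a) (Cmod lam + 1) Halpha Hb Ha ltac:(lra))
  as (C0 & HC0 & H).
set (Q := (Cmod lam + 1) ^ K * C0).
assert (HQ : 0 <= Q) by (apply Rmult_le_pos; [apply pow_le; lra|exact HC0]).
exists (Rmin 1 (eps / (1 + Q))); split.
{ apply Rmin_pos; [lra|apply Rdiv_lt_0_compat; lra]. }
intros w Hw; set (k := (w - lam)%C) in *.
assert (Hk1 := Rlt_le_trans _ _ _ Hw (Rmin_l _ _)).
assert (Hk2 := Rlt_le_trans _ _ _ Hw (Rmin_r _ _)).
pose proof (Cmod_ge_0 k) as Hk0.
set (g := fun x : R => (h x * (exp_rem N (- w * Cexp x) - exp_rem N (- lam * Cexp x)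
   - (- k * Cexp x) * exp_rem (S K) (- lam * Cexp x)))%C).
destruct (H (Cmod k * Cmod k * (Cmod lam + 1) ^ K) g) as (l & Hl & Bl).
- apply Rmult_le_pos; [nra|apply pow_le; lra].
- intros x; unfold g; apply Rcont_mult; [apply Rcont_integrand|].
  apply Rcont_minus; [apply Rcont_minus; apply Rcont_exp_rem|].
  apply Rcont_mult; [apply Rcont_scal, Rcont_Cexp|apply Rcont_exp_rem].
- intros x; unfold g, h; rewrite Cmod_mult, Cmod_integrand_0.
  set (u := (- lam * Cexp x)%C); set (v := (- k * Cexp x)%C).
  replace (- w * Cexp x)%C with (u + v)%C by (unfold u, v, k; ring).
  eapply Rle_trans; [apply Rmult_le_compat_l; [left; apply exp_pos|apply exp_rem_second_order]|].
  unfold u, v; rewrite !Cmod_lam_exp.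
  pose proof (exp_pos x).
  assert (Hs : 0 <= Cmod lam * exp x + Cmod k * exp x <= (Cmod lam + 1) * exp x) by nra.
  apply Rle_trans with (exp (Re b * x - Re a * exp (alpha * x)) *
    (Cmod k * exp x * (Cmod k * exp x) *
      (exp ((Cmod lam + 1) * exp x) * ((Cmod lam + 1) * exp x) ^ K))).
  + apply Rmult_le_compat_l; [left; apply exp_pos|].
    apply Rmult_le_compat_l; [repeat apply Rmult_le_pos; lra|].
    apply Rmult_le_compat; [left; apply exp_pos|apply pow_le; lra|apply exp_le; lra|].
    apply pow_incr; lra.
  + rewrite pow_exp_bound by lra; right.
    replace ((Re b + INR N) * x + (Cmod lam + 1) * exp x - Re a * exp (alpha * x))
      with ((Re b * x - Re a * exp (alpha * x)) + ((Cmod lam + 1) * exp x) + (INR K * x + x + x))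
      by (unfold N; rewrite (S_INR (S K)), (S_INR K); ring).
    rewrite !exp_plus; ring.
- assert (E : l = (Psi w + (-1)%R * Psi lam + (-1)%R * k * D)%C).
  { refine (fp_unique _ _ _ _ Hl _).
    assert (C1 : forall m x, Rcont (fun x => h x * exp_rem N (- m * Cexp x))%C x)
      by (intros; apply Rcont_mult; [apply Rcont_integrand|apply Rcont_exp_rem]).
    assert (C2 : forall x, Rcont (fun x => h x * (- Cexp x * exp_rem (S K) (- lam * Cexp x)))%C x).
    { intros x; apply Rcont_mult; [apply Rcont_integrand|].
      apply Rcont_mult; [apply (Rcont_holo (fun L => - Cexp L)%C); holo|apply Rcont_exp_rem]. }
    eapply fp_ext; [| | |apply fp_plus; [| |apply fp_plus;
       [| |apply (HPsi w)|apply fp_scal with (c := RtoC (-1)); [|apply (HPsi lam)]]|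
       apply fp_scal with (c := (RtoC (-1) * k)%C); [|apply HD]]].
    - intros x; cbv beta; unfold g; ring.
    - intros x; cbv beta; ring.
    - reflexivity.
    - intros x; apply Rcont_plus; [apply C1|apply Rcont_scal, C1].
    - intros x; apply Rcont_scal, C2.
    - intros x; apply C1.
    - intros x; apply Rcont_scal, C1.
    - intros x; apply C1.
    - intros x; apply C2. }
  replace (Psi w - Psi lam - k * D)%C with l by (rewrite E; ring).
  eapply Rle_trans; [exact Bl|].
  replace (Cmod k * Cmod k * (Cmod lam + 1) ^ K * C0) with (Cmod k * Q * Cmod k) by (unfold Q; ring).
  apply Rmult_le_compat_r; [exact Hk0|].
  apply Rlt_div_mult in Hk2; [|lra]; nra.
Qed.

(** The coefficients of the Taylor expansion in [lam], which carry all the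
    finite parts: the remainder in [remainder_integral] converges absolutely. *)
Lemma moment (m : nat) :
  exists l, is_fp (fun x : R => h x * Cexp x ^ m)%C
    (fun x : R => Csum (fun n => exp_coef (- a) n * exp_prim (b + INR n * alpha + INR m) x)%C N) l.
Proof.
assert (Hbm : 0 < Re (b + INR m)%C + INR N).
{ rewrite re_plus, re_RtoC; pose proof (pos_INR m); unfold N; lra. }
destruct (lower_finite_part N alpha (b + INR m) a (RtoC 0) ltac:(lra) Hbm) as [l1 H1].
destruct (superexp_bound alpha (Re (b + INR m)%C) (Re a) 0 Halpha Ha) as [K0 HK0].
destruct (lim_p_infty_dominated (fun x : R => integrand alpha (b + INR m) a (RtoC 0) x) (exp K0)) as (l2 & H2 & _).
- apply Rcont_integrand.
- intros x Hx; rewrite Cmod_integrand_0, <- exp_plus; apply exp_le.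
  specialize (HK0 x Hx); lra.
- exists (l1 + l2)%C.
  eapply fp_ext; [| | |apply fp_halves; [|exact H1|exact H2]; apply Rcont_integrand].
  + intros x; unfold h, integrand; rewrite Cexp_pow, <- Cexp_plus; f_equal; ring.
  + intros x; cbv beta; unfold singular_prim; apply Csum_ext; intros n _; f_equal.
    unfold laplace_prim; rewrite Csum_head.
    * rewrite exp_coef_0, Cmult_1_l; f_equal; simpl; ring.
    * unfold N; lia.
    * intros k Hk; destruct k as [|k]; [lia|].
      unfold exp_coef; rewrite Cpow_S; unfold Cdiv; ring.
  + reflexivity.
Qed.

(** A polynomial in [lam] with the finite parts [moment] as
    coefficients, plus an absolutely convergent remainder. *)
Lemma entire_finite_part : exists Phi : C -> C,
  (forall lam, is_integrand_fp N alpha b a lam (Phi lam)) /\ holo Phi.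
Proof.
destruct remainder_entire as (Psi & HPsi & DPsi).
destruct (functional_choice _ moment) as [M HM].
exists (fun lam => Psi lam + Csum (fun m => exp_coef (- lam) m * M m) N)%C; split.
- intros lam; unfold is_integrand_fp.
  assert (C1 : forall x, Rcont (fun x => h x * exp_rem N (- lam * Cexp x))%C x)
    by (intros; apply Rcont_mult; [apply Rcont_integrand|apply Rcont_exp_rem]).
  assert (C2 : forall m x, Rcont (fun x : R => h x * Cexp x ^ m)%C x).
  { intros m x; apply Rcont_ext with (fun t : R => integrand alpha (b + INR m) a (RtoC 0) t).
    - intros y; unfold h, integrand; rewrite Cexp_pow, <- Cexp_plus; f_equal; ring.
    - apply Rcont_integrand. }
  assert (C3 : forall m x, Rcont (fun x : R => exp_coef (- lam) m * (h x * Cexp x ^ m))%C x)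
    by (intros; apply Rcont_scal, C2).
  eapply fp_ext; [| | |apply fp_plus; [exact C1| |apply HPsi|
    apply (fp_Csum (fun m (x : R) => exp_coef (- lam) m * (h x * Cexp x ^ m))%C
      (fun m (x : R) => exp_coef (- lam) m * Csum (fun n => exp_coef (- a) n * exp_prim (b + INR n * alpha + INR m) x) N)%C
      (fun m => exp_coef (- lam) m * M m)%C N); [exact C3|]]].
  + intros x; cbv beta.
    rewrite (Csum_ext _ (fun m => h x * exp_coef (- lam * Cexp x) m)%C)
      by (intros; rewrite exp_coef_mult_l; ring).
    rewrite (Csum_scal (h x) (exp_coef (- lam * Cexp x))).
    unfold exp_rem, exp_poly.
    transitivity (h x * Cexp (- lam * Cexp x))%C; [ring|].
    unfold h, integrand; rewrite <- Cexp_plus; f_equal; ring.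
  + intros x; cbv beta; rewrite Cplus_0_l.
    unfold singular_prim, laplace_prim.
    rewrite (Csum_ext _ (fun m => Csum (fun n => exp_coef (- lam) m * (exp_coef (- a) n * exp_prim (b + INR n * alpha + INR m) x)) N)%C)
      by (intros; now rewrite Csum_scal).
    rewrite Csum_exchange; apply Csum_ext; intros n _.
    rewrite <- Csum_scal; apply Csum_ext; intros; ring.
  + reflexivity.
  + intros x; now apply Rcont_Csum.
  + intros m _; apply fp_scal; [apply C2|apply HM].
- apply (holo_plus Psi); [exact DPsi|].
  apply (holo_Csum (fun m lam => exp_coef (- lam) m * M m)%C); intros m.
  apply (holo_mult (fun lam => exp_coef (- lam) m)); [apply holo_exp_coef_opp|apply holo_const].
Qed.

End Entire.

(** * The finite part of Euler's integral *)

Definition gamma_integrand (w L : C) : C := Cexp (w * L - Cexp L).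

(** In the variable [t = exp x] this is the finite part of
    [int t ^ (w - 1) exp (- t) dt]. *)
Definition is_gamma_fp (N : nat) (w l : C) : Prop :=
  is_fp (fun x : R => gamma_integrand w x) (fun x : R => laplace_prim N 1 w x) l.

Lemma integrand_gamma (alpha : R) (w L : C) :
  integrand alpha w 0 1 L = gamma_integrand w L.
Proof. unfold integrand, gamma_integrand; f_equal; ring. Qed.

Lemma exp_coef_zero (n : nat) : (1 <= n)%nat -> exp_coef (RtoC 0) n = RtoC 0.
Proof.
destruct n as [|n]; [lia|]; intros _; unfold exp_coef; rewrite Cpow_S; unfold Cdiv; ring.
Qed.

Lemma singular_prim_zero (N : nat) (alpha : R) (w lam L : C) :
  (1 <= N)%nat -> singular_prim N alpha w 0 lam L = laplace_prim N lam w L.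
Proof.
intros HN; unfold singular_prim; replace (- RtoC 0)%C with (RtoC 0) by ring.
rewrite Csum_head; [|exact HN|intros k Hk; rewrite exp_coef_zero by exact Hk; ring].
rewrite exp_coef_0; simpl; replace (w + 0 * alpha)%C with w by ring; ring.
Qed.

Lemma Rcont_gamma (w : C) (x : R) : Rcont (fun t : R => gamma_integrand w t) x.
Proof.
apply Rcont_ext with (fun t : R => integrand 1 w 0 1 t); [intros; apply integrand_gamma|].
apply Rcont_integrand.
Qed.

Lemma Cmod_gamma (w : C) (x : R) : Cmod (gamma_integrand w x) = exp (Re w * x - exp x).
Proof.
rewrite <- (integrand_gamma 1), Cmod_integrand, <- RtoC_mult, !Cexp_R.
f_equal; rewrite !re_scal_r, !re_RtoC; ring.
Qed.

Lemma laplace_prim_lim (N : nat) (lam w : C) : 0 < Re w -> lim_m_infty (fun p : R => laplace_prim N lam w p) (RtoC 0).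
Proof.
intros Hw; unfold laplace_prim.
replace (RtoC 0) with (Csum (fun _ => RtoC 0) N) by apply Csum_zero.
apply (lim_m_infty_Csum (fun m (p : R) => exp_coef (- lam) m * exp_prim (w + INR m) p)%C); intros m _.
replace (RtoC 0) with (exp_coef (- lam) m * RtoC 0)%C by ring.
apply (lim_m_infty_scal (exp_coef (- lam) m)), exp_prim_lim.
rewrite re_plus, re_RtoC; pose proof (pos_INR m); lra.
Qed.

Lemma gamma_fp_convergent (N : nat) (w : C) :
  0 < Re w -> is_gamma_fp N w (Gamma_integral w).
Proof.
intros Hw; destruct (linear_minus_exp (Re w) 1 Rlt_0_1) as [K HK].
assert (Hpos := exp_pos K).
destruct (fp_dominated (fun x : R => gamma_integrand w x) (1 + exp K) (Re w) Hw) as (l & Hl & _).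
- apply Rcont_gamma.
- intros x _; rewrite Cmod_gamma.
  apply Rle_trans with (exp (Re w * x)); [apply exp_le; pose proof (exp_pos x); lra|].
  pose proof (exp_pos (Re w * x)); nra.
- intros x Hx; rewrite Cmod_gamma; specialize (HK x Hx).
  apply Rle_trans with (exp K * exp (- x)); [rewrite <- exp_plus; apply exp_le; lra|].
  pose proof (exp_pos (- x)); nra.
- assert (E : Gamma_integral w = l).
  { unfold Gamma_integral; apply (RInt_gen_line (fun x : R => gamma_integrand w x)); [|  |exact Hl].
    - apply Rcont_gamma.
    - intros t Ht; unfold gamma_integrand, Rcpow.
      rewrite Rinv_exp, <- Cexp_R, <- !Cexp_plus by exact Ht.
      f_equal; rewrite Cexp_R, exp_ln, RtoC_opp by exact Ht; ring. }
  rewrite E; unfold is_gamma_fp.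
  replace l with (l + RtoC 0)%C by ring.
  apply (fp_change _ (fun _ => RtoC 0)); [|exact Hl].
  apply lim_m_infty_ext with (fun p : R => laplace_prim N 1 w p); [intros; ring|now apply laplace_prim_lim].
Qed.

(** For [w = - k] with [k < N] this is the residue [(-1) ^ k / k!] of the
    gamma function, for other [w] it is 0. *)
Definition gamma_residue (N : nat) (w : C) : C :=
  Csum (fun m => if Ceq_dec (w + INR m)%C (RtoC 0) then exp_coef (- (1)) m else RtoC 0) N.

(** Up to one term that vanishes at [- oo], the counterterms for [w] and
    [w + 1] are related as the integrals are after integration by parts.  The
    residue appears because [v exp_prim v L] is [exp (v L)] for [v <> 0] but 0 for
    [v = 0]. *)
Lemma laplace_prim_recursion (n : nat) (w L : C) :
  (w * laplace_prim (S n) 1 w L - laplace_prim (S n) 1 (w + 1) L + gamma_residue (S n) w)%C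
  = (Cexp (w * L) * exp_poly (S n) (- Cexp L) - exp_coef (- (1)) n * exp_prim (w + INR (S n)) L)%C.
Proof.
assert (HB : forall m, ((w + INR m) * exp_prim (w + INR m) L
   + (if Ceq_dec (w + INR m)%C (RtoC 0) then 1 else 0))%C = Cexp ((w + INR m) * L)).
{ intros m; unfold exp_prim; destruct (Ceq_dec _ _) as [E|Hne]; [|field; exact Hne].
  rewrite E; replace (0 * L)%C with (RtoC 0) by ring; rewrite Cexp_0; ring. }
assert (HE : forall m, (Cexp (w * L) * exp_coef (- Cexp L) m)%C
   = (exp_coef (- (1)) m * Cexp ((w + INR m) * L))%C).
{ intros m; replace (- Cexp L)%C with (- (1) * Cexp L)%C by ring.
  rewrite exp_coef_mult_l, Cexp_pow.
  replace ((w + INR m) * L)%C with (w * L + INR m * L)%C by ring.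
  rewrite Cexp_plus; ring. }
assert (HS : forall m, (w + INR (S m))%C = (w + 1 + INR m)%C)
  by (intros; rewrite S_INR, RtoC_plus; ring).
induction n as [|n IH].
- unfold laplace_prim, gamma_residue, exp_poly; simpl Csum.
  specialize (HB O); specialize (HE O); rewrite (HS O).
  rewrite !exp_coef_0 in *.
  transitivity (Cexp ((w + INR 0) * L) - exp_prim (w + 1 + INR 0) L)%C.
  + rewrite <- HB; destruct (Ceq_dec _ _); simpl; ring.
  + rewrite <- (Cmult_1_l (Cexp ((w + INR 0) * L))), <- HE; ring.
- unfold laplace_prim, gamma_residue, exp_poly in *.
  set (M := S n) in *.
  assert (CsS : forall f, Csum f (S M) = (Csum f M + f M)%C) by reflexivity; rewrite !CsS.
  match type of IH with (w * ?A - ?B + ?P = ?E * ?Q - _)%C =>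
    transitivity ((w * A - B + P) + exp_coef (- (1)) M * (w * exp_prim (w + INR M) L
      - exp_prim (w + 1 + INR M) L + (if Ceq_dec (w + INR M)%C (RtoC 0) then 1 else 0)))%C;
    [destruct (Ceq_dec (w + INR M)%C (RtoC 0)); ring|rewrite IH]
  end.
  transitivity (Cexp (w * L) * Csum (exp_coef (- Cexp L)) M + Cexp (w * L) * exp_coef (- Cexp L) M
     - exp_coef (- (1)) M * exp_prim (w + INR (S M)) L)%C; [|ring].
  rewrite HE, <- HB, (HS M).
  assert (Hc : exp_coef (- (1)) n = (- (INR M * exp_coef (- (1)) M))%C).
  { unfold M; rewrite exp_coef_S; ring. }
  rewrite Hc; ring.
Qed.

Lemma Cdiff_gamma (w L : C) :
  Cdiff (gamma_integrand w) L (w * gamma_integrand w L - gamma_integrand (w + 1) L)%C.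
Proof.
unfold gamma_integrand; eapply Cdiff_val; [cdiff|].
replace ((w + 1) * L - Cexp L)%C with ((w * L - Cexp L) + L)%C by ring.
  rewrite (Cexp_plus _ L); ring.
Qed.

Lemma lim_m_infty_bound (f : R -> C) (k : R) :
  0 < k -> (forall x, x <= 0 -> Cmod (f x) <= exp (k * x)) -> lim_m_infty f (RtoC 0).
Proof.
intros Hk H eps He; destruct (exp_small k eps Hk He) as [M HM].
exists (Rmax M 0); intros p Hp; pose proof (Rmax_l M 0); pose proof (Rmax_r M 0).
replace (f p - 0)%C with (f p) by ring.
eapply Rle_lt_trans; [apply H; lra|apply HM; lra].
Qed.

(** The functional equation, by integrating the derivative
    [w f_w - f_(w + 1)] of [f_w = gamma_integrand w].  The boundary term at [- oo] agrees with its
    Taylor polynomial up to [o(1)] and cancels with the counterterms, except for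
    the constant term, which is the residue. *)
Lemma gamma_fp_recursion (n : nat) (w l : C) :
  w <> RtoC 0 -> 0 < Re w + INR (S n) ->
  is_gamma_fp (S n) (w + 1) l -> is_gamma_fp (S n) w ((l - gamma_residue (S n) w) / w).
Proof.
intros Hw HN H.
set (N := S n) in *; set (P := gamma_residue N w).
assert (HI : forall p q, (w * CInt (fun x : R => gamma_integrand w x) p q)%C =
  (CInt (fun x : R => gamma_integrand (w + 1) x) p q + gamma_integrand w q - gamma_integrand w p)%C).
{ intros p q.
  pose proof (CInt_FTC (gamma_integrand w) (fun L => w * gamma_integrand w L - gamma_integrand (w + 1) L)%C
    (RtoC 0) (RtoC 1) p q) as F.
  replace (0 + q * 1)%C with (RtoC q) in F by ring; replace (0 + p * 1)%C with (RtoC p) in F by ring.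
  rewrite (CInt_ext _ (fun x : R => w * gamma_integrand w x - gamma_integrand (w + 1) x)%C) in F.
  2:{ intros x; replace (0 + x * 1)%C with (RtoC x) by ring; ring. }
  rewrite CInt_minus, CInt_scal in F.
  - match type of F with ?A -> _ => assert A as HA by (intros; apply Cdiff_gamma); specialize (F HA); clear HA end.
    match type of F with ?A -> _ => assert A as HA end.
    { intros z; apply holo_Ccont; unfold gamma_integrand; holo. }
    specialize (F HA).
    match type of F with (?X - ?Y)%C = _ => transitivity (X - Y + Y)%C; [ring|rewrite F; ring] end.
  - apply Rcont_gamma.
  - intros; apply Rcont_scal, Rcont_gamma.
  - apply Rcont_gamma. }
assert (L1 : lim_m_infty (fun p : R => gamma_integrand w p - Cexp (w * p) * exp_poly N (- Cexp p))%C (RtoC 0)).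
{ apply (lim_m_infty_bound _ (Re w + INR N)); [exact HN|]; intros x Hx.
  replace (gamma_integrand w x - Cexp (w * x) * exp_poly N (- Cexp x))%C
    with (Cexp (w * x) * exp_rem N (- Cexp x))%C.
  2:{ unfold exp_rem, gamma_integrand; replace (w * x - Cexp x)%C with (w * x + - Cexp x)%C by ring.
      rewrite Cexp_plus; ring. }
  rewrite Cmod_mult, Cmod_Cexp, re_scal_r.
  eapply Rle_trans; [apply Rmult_le_compat_l; [left; apply exp_pos|apply exp_rem_bound_neg]|].
  - rewrite re_opp, Cexp_R, re_RtoC; pose proof (exp_pos x); lra.
  - rewrite Cmod_opp, Cmod_Cexp, re_RtoC, exp_INR, <- exp_plus; right; f_equal; ring. }
assert (L2 : lim_m_infty (fun p : R => exp_coef (- (1)) n * exp_prim (w + INR N) p)%C (RtoC 0)).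
{ replace (RtoC 0) with (exp_coef (- (1)) n * RtoC 0)%C by ring.
  apply (lim_m_infty_scal (exp_coef (- (1)) n)), exp_prim_lim.
  rewrite re_plus, re_RtoC; exact HN. }
intros eps He.
assert (Hm := proj1 (Cmod_gt_0 w) Hw).
assert (He' : 0 < eps * Cmod w / 4) by nra.
destruct (H _ He') as [M1 H1]; destruct (L1 _ He') as [M2 H2]; destruct (L2 _ He') as [M3 H3].
destruct (linear_minus_exp (Re w) 1 Rlt_0_1) as [K HK].
destruct (exp_small 1 (eps * Cmod w / 4 / exp K) Rlt_0_1) as [M4 H4].
{ apply Rdiv_lt_0_compat; [exact He'|apply exp_pos]. }
exists (Rmax (Rmax M1 M2) (Rmax M3 (Rmax M4 0))); intros p q Hp Hq.
pose proof (Rmax_l (Rmax M1 M2) (Rmax M3 (Rmax M4 0))); pose proof (Rmax_r (Rmax M1 M2) (Rmax M3 (Rmax M4 0))).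
pose proof (Rmax_l M1 M2); pose proof (Rmax_r M1 M2); pose proof (Rmax_l M3 (Rmax M4 0)).
pose proof (Rmax_r M3 (Rmax M4 0)); pose proof (Rmax_l M4 0); pose proof (Rmax_r M4 0).
specialize (H1 p q ltac:(lra) ltac:(lra)); specialize (H2 p ltac:(lra)).
specialize (H3 p ltac:(lra)); specialize (H4 (- q) ltac:(lra)).
assert (Hgq : Cmod (gamma_integrand w q) < eps * Cmod w / 4).
{ rewrite Cmod_gamma; specialize (HK q ltac:(lra)).
  apply Rle_lt_trans with (exp K * exp (1 * - q)); [rewrite <- exp_plus; apply exp_le; lra|].
  pose proof (exp_pos K).
  rewrite Rmult_comm; apply Rlt_div_mult; assumption. }
pose proof (laplace_prim_recursion n w p) as Rec; fold N P in Rec.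
set (I := CInt (fun x : R => gamma_integrand w x) p q) in *.
set (I' := CInt (fun x : R => gamma_integrand (w + 1) x) p q) in *.
specialize (HI p q); fold I I' in HI.
set (g := gamma_integrand w p) in *; set (gq := gamma_integrand w q) in *.
set (T := (exp_coef (- (1)) n * exp_prim (w + INR N) p)%C) in *.
set (E := (Cexp (w * p) * exp_poly N (- Cexp p))%C) in *.
set (Sw := laplace_prim N 1 w p) in *; set (Sw1 := laplace_prim N 1 (w + 1) p) in *.
assert (Key : (w * (I + Sw - (l - P) / w))%C =
  ((I' + Sw1 - l) + gq + - (g - E - 0) + - (T - 0))%C).
{ transitivity (w * I + (w * Sw - Sw1 + P) + Sw1 - l)%C; [field; exact Hw|].
  rewrite HI, Rec; ring. }
apply Rmult_lt_reg_l with (Cmod w); [exact Hm|].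
rewrite <- Cmod_mult, Key.
eapply Rle_lt_trans; [apply Cmod_triangle|].
eapply Rle_lt_trans; [apply Rplus_le_compat_r, Cmod_triangle|].
eapply Rle_lt_trans; [apply Rplus_le_compat_r, Rplus_le_compat_r, Cmod_triangle|].
rewrite !Cmod_opp; lra.
Qed.

(** The value at [u = 0] is the harmonic number, and the derivative with
    respect to [x] of [x + harmonic_poly n (exp x / n)] is
    [(1 - exp x / n) ^ n]. *)
Fixpoint harmonic_poly (n : nat) (u : R) : R :=
  match n with
  | O => 0
  | S k => harmonic_poly k u + (1 - u) ^ S k / INR (S k)
  end.

Lemma harmonic_S (n : nat) : harmonic (S n) = harmonic n + / INR (S n).
Proof. unfold harmonic; rewrite sum_n_Sm by lia; reflexivity. Qed.

Lemma harmonic_0 : harmonic 0 = 0.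
Proof. unfold harmonic; rewrite sum_n_m_zero by lia; reflexivity. Qed.

Lemma harmonic_poly_derive (n : nat) (u : R) : u <> 0 ->
  is_derive (harmonic_poly n) u (- (1 - (1 - u) ^ n) / u).
Proof.
intros Hu; induction n as [|n IH].
- apply (is_derive_ext (fun _ => 0)); [reflexivity|].
  replace (- (1 - (1 - u) ^ 0) / u) with 0 by (simpl; field; exact Hu).
  apply (is_derive_const (K := R_AbsRing) (V := R_NormedModule)).
- replace (- (1 - (1 - u) ^ S n) / u) with (- (1 - (1 - u) ^ n) / u + - (1 - u) ^ n)
    by (simpl; field; exact Hu).
  apply (is_derive_plus (harmonic_poly n) (fun u => (1 - u) ^ S n / INR (S n))); [exact IH|].
  assert (Hn : INR (S n) <> 0) by now apply not_0_INR.
  auto_derive; [auto|].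
  change (match n with O => 1 | S _ => INR n + 1 end) with (INR (S n)).
  unfold Rminus; field; exact Hn.
Qed.

Lemma harmonic_poly_1 (n : nat) : harmonic_poly n 1 = 0.
Proof.
induction n as [|n IH]; [reflexivity|]; simpl harmonic_poly; rewrite IH.
replace (1 - 1) with 0 by ring; unfold Rdiv; ring.
Qed.

Lemma Bernoulli_pow (u : R) (j : nat) : 0 <= u <= 1 -> 1 - INR j * u <= (1 - u) ^ j.
Proof.
intros Hu; induction j as [|j IH]; [simpl; lra|].
rewrite <- tech_pow_Rmult, S_INR; pose proof (pos_INR j); nra.
Qed.

Lemma harmonic_poly_bounds (n : nat) (u : R) : 0 <= u <= 1 ->
  harmonic n - INR n * u <= harmonic_poly n u <= harmonic n.
Proof.
intros Hu; induction n as [|n IH]; [rewrite harmonic_0; simpl; lra|].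
change (harmonic_poly (S n) u) with (harmonic_poly n u + (1 - u) ^ S n / INR (S n)).
rewrite harmonic_S, (S_INR n).
assert (Hn : 0 < INR n + 1) by (pose proof (pos_INR n); lra).
pose proof (Bernoulli_pow u (S n) Hu) as B.
assert (B2 : (1 - u) ^ S n <= 1).
{ eapply Rle_trans; [apply (pow_incr _ 1); lra|rewrite pow1; lra]. }
rewrite S_INR in B.
set (y := (1 - u) ^ S n) in *.
assert (y / (INR n + 1) <= / (INR n + 1)).
{ unfold Rdiv; rewrite <- (Rmult_1_l (/ (INR n + 1))) at 2.
  apply Rmult_le_compat_r; [left; apply Rinv_0_lt_compat|]; lra. }
assert (/ (INR n + 1) - u <= y / (INR n + 1)).
{ replace (/ (INR n + 1) - u) with ((1 - (INR n + 1) * u) / (INR n + 1)) by (field; lra).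
  apply Rmult_le_compat_r; [left; apply Rinv_0_lt_compat; lra|exact B]. }
lra.
Qed.

Lemma CInt_RtoC (g : R -> R) (a b : R) :
  (forall x, Rcont (fun t => RtoC (g t)) x) -> CInt (fun x => RtoC (g x)) a b = RtoC (RInt g a b).
Proof.
intros H; rewrite CInt_pair by exact H; unfold RtoC; simpl; f_equal.
rewrite RInt_const; unfold scal; simpl; unfold mult; simpl; ring.
Qed.

Lemma continuous_exp_exp (x : R) : continuous (fun t => exp (- exp t)) x.
Proof. apply (ex_derive_continuous (V := R_NormedModule)); auto_derive; auto. Qed.

Lemma RInt_exact (f df : R -> R) (a b : R) :
  (forall x, is_derive f x (df x)) -> (forall x, continuous df x) ->
  is_RInt df a b (f b - f a).
Proof.
intros Hd Hc; apply (is_RInt_derive (V := R_CompleteNormedModule) f df); intros; auto.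
Qed.

Lemma exp_pow_compare (n : nat) (t : R) : (1 <= n)%nat -> 0 <= t <= INR n ->
  0 <= exp (- t) - (1 - t / INR n) ^ n <= t * t / INR n * exp (- t).
Proof.
intros Hn Ht.
assert (Hn0 : 0 < INR n) by (apply lt_0_INR; lia).
set (x := t / INR n).
assert (Hx : 0 <= x <= 1).
{ unfold x; split; [apply Rdiv_le_0_compat; lra|].
  apply Rmult_le_reg_r with (INR n); [exact Hn0|].
  unfold Rdiv; rewrite Rmult_assoc, Rinv_l; lra. }
assert (Et : exp (- t) = exp (- x) ^ n) by (rewrite exp_INR; f_equal; unfold x; field; lra).
assert (E1 : 1 - x <= exp (- x)).
{ destruct (Req_dec x 0) as [->|Hne]; [rewrite Ropp_0, exp_0; lra|].
  pose proof (exp_ineq1 (- x) ltac:(lra)); lra. }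
assert (E2 : exp (- x) * (1 - x * x) <= 1 - x).
{ assert (exp (- x) * (1 + x) <= 1).
  { assert (1 + x <= exp x).
    { destruct (Req_dec x 0) as [->|Hne]; [rewrite exp_0; lra|].
      pose proof (exp_ineq1 x Hne); lra. }
    replace 1 with (exp (- x) * exp x) at 2 by (rewrite <- exp_plus, Rplus_opp_l; apply exp_0).
    apply Rmult_le_compat_l; [left; apply exp_pos|assumption]. }
  nra. }
rewrite Et; split.
- assert ((1 - x) ^ n <= exp (- x) ^ n) by (apply pow_incr; lra); lra.
- assert (B : 1 - INR n * (x * x) <= (1 - x * x) ^ n) by (apply Bernoulli_pow; nra).
  assert (P : (exp (- x) * (1 - x * x)) ^ n <= (1 - x) ^ n).
  { apply pow_incr; split; [|exact E2].
    apply Rmult_le_pos; [left; apply exp_pos|nra]. }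
  rewrite Rpow_mult_distr in P.
  assert (0 < exp (- x) ^ n) by (apply pow_lt, exp_pos).
  replace (t * t / INR n) with (INR n * (x * x)) by (unfold x; field; lra).
  nra.
Qed.

(** Euler's comparison of [exp (- t)] with [(1 - t / n) ^ n] on [0, n],
    where [t = exp x].  The integral of the latter is known from
    [harmonic_poly]. *)
Lemma log_integral_bounds (n : nat) (p q : R) :
  (1 <= n)%nat -> p <= 0 -> ln (INR n) <= q ->
  0 <= RInt (fun x => exp (- exp x)) p q + p - (ln (INR n) - harmonic n) <= 2 / INR n + exp p.
Proof.
intros Hn Hp Hq.
assert (Hn1 : 1 <= INR n) by (apply (le_INR 1); exact Hn).
assert (Hl : 0 <= ln (INR n)) by (rewrite <- ln_1; apply ln_le; lra).
set (m := ln (INR n)) in *.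
assert (Em : exp m = INR n) by (unfold m; apply exp_ln; lra).
set (f := fun x => exp (- exp x)).
assert (Exf : forall a b, ex_RInt f a b).
{ intros; apply (ex_RInt_continuous (V := R_CompleteNormedModule)); intros; apply continuous_exp_exp. }
rewrite <- (RInt_Chasles (V := R_CompleteNormedModule) f p m q) by apply Exf.
change (plus (RInt f p m) (RInt f m q)) with (RInt f p m + RInt f m q).
assert (T1 : 0 <= RInt f m q).
{ apply RInt_ge_0; [exact Hq|apply Exf|]; intros x _; left; apply exp_pos. }
assert (T2 : RInt f m q <= / INR n).
{ assert (I : is_RInt (fun x => exp x * exp (- exp x)) m q (- exp (- exp q) - - exp (- exp m))).
  { apply (RInt_exact (fun x => - exp (- exp x))).
    - intros x; auto_derive; [auto|ring].
    - intros x; apply (ex_derive_continuous (V := R_NormedModule)); auto_derive; auto. }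
  eapply Rle_trans.
  - apply (is_RInt_le f _ m q _ _ Hq (RInt_correct f m q (Exf m q)) I).
    intros x Hx; unfold f; rewrite <- (Rmult_1_l (exp (- exp x))) at 1.
    apply Rmult_le_compat_r; [left; apply exp_pos|].
    rewrite <- exp_0; apply exp_le; lra.
  - rewrite Em; pose proof (exp_pos (- exp q)).
    assert (exp (- INR n) <= / INR n); [|lra].
    rewrite exp_Ropp; apply Rinv_le_contravar; [lra|].
    pose proof (exp_ineq1 (INR n) ltac:(lra)); lra. }
set (g := fun x => (1 - exp x / INR n) ^ n).
assert (Cg : forall x, continuous g x).
{ intros x; apply (ex_derive_continuous (V := R_NormedModule)); unfold g; auto_derive; auto. }
(* At the upper end [exp m / n = 1], where [harmonic_poly] vanishes. *)
assert (Ig : is_RInt g p m (m + harmonic_poly n (exp m / INR n) - (p + harmonic_poly n (exp p / INR n)))).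
{ apply (RInt_exact (fun x => x + harmonic_poly n (exp x / INR n))); [|exact Cg].
  intros x; pose proof (exp_pos x).
  assert (Hne : exp x / INR n <> 0) by (apply Rgt_not_eq, Rdiv_lt_0_compat; lra).
  replace (g x) with (1 + exp x / INR n * (- (1 - (1 - exp x / INR n) ^ n) / (exp x / INR n)))
    by (unfold g; field; lra).
  apply (is_derive_plus (fun x => x) (fun x => harmonic_poly n (exp x / INR n))).
  - apply (is_derive_id (K := R_AbsRing)).
  - apply (is_derive_comp (harmonic_poly n) (fun x => exp x / INR n)).
    + now apply harmonic_poly_derive.
    + auto_derive; [auto|field; lra]. }
rewrite Em in Ig; replace (INR n / INR n) with 1 in Ig by (field; lra).
rewrite harmonic_poly_1 in Ig.
assert (Hu : 0 <= exp p / INR n <= 1).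
{ pose proof (exp_pos p); split; [apply Rdiv_le_0_compat; lra|].
  assert (exp p <= 1) by (rewrite <- exp_0; apply exp_le; lra).
  apply Rmult_le_reg_r with (INR n); [lra|].
  unfold Rdiv; rewrite Rmult_assoc, Rinv_l; lra. }
pose proof (harmonic_poly_bounds n _ Hu) as HB.
replace (INR n * (exp p / INR n)) with (exp p) in HB by (field; lra).
set (A := harmonic_poly n (exp p / INR n)) in *.
assert (Hfg : forall x, p < x < m -> 0 <= f x - g x <= exp x * exp x / INR n * exp (- exp x)).
{ intros x Hx; apply exp_pow_compare; [exact Hn|].
  split; [left; apply exp_pos|rewrite <- Em; apply exp_le; lra]. }
assert (Ifg : is_RInt (fun x => f x - g x) p m (RInt f p m - (m + 0 - (p + A)))).
{ apply (is_RInt_minus (V := R_NormedModule)); [apply (RInt_correct (V := R_CompleteNormedModule)), Exf|exact Ig]. }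
assert (Ih : is_RInt (fun x => exp x * exp x / INR n * exp (- exp x)) p m
  (- (1 + exp m) * exp (- exp m) / INR n - - (1 + exp p) * exp (- exp p) / INR n)).
{ apply (RInt_exact (fun x => - (1 + exp x) * exp (- exp x) / INR n)).
  - intros x; auto_derive; [auto|field; lra].
  - intros x; apply (ex_derive_continuous (V := R_NormedModule)); auto_derive; auto. }
assert (T3 : 0 <= RInt f p m - (m + 0 - (p + A))).
{ apply (is_RInt_ge_0 (fun x => f x - g x) p m); [lra|exact Ifg|].
  intros x Hx; apply Hfg, Hx. }
assert (T4 : RInt f p m - (m + 0 - (p + A)) <= / INR n).
{ eapply Rle_trans; [apply (is_RInt_le _ _ p m _ _ ltac:(lra) Ifg Ih)|].
  - intros x Hx; apply Hfg, Hx.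
  - assert ((1 + exp p) * exp (- exp p) <= 1).
    { rewrite exp_Ropp; pose proof (exp_ineq1 (exp p) ltac:(apply Rgt_not_eq, exp_pos)).
      pose proof (exp_pos (exp p)).
      apply Rmult_le_reg_r with (exp (exp p)); [assumption|].
      rewrite Rmult_assoc, Rinv_l; lra. }
    assert (0 <= (1 + exp m) * exp (- exp m) / INR n).
    { pose proof (exp_pos m); pose proof (exp_pos (- exp m)).
      apply Rdiv_le_0_compat; [nra|lra]. }
    assert ((1 + exp p) * exp (- exp p) / INR n <= / INR n).
    { unfold Rdiv; rewrite <- (Rmult_1_l (/ INR n)) at 2.
      apply Rmult_le_compat_r; [left; apply Rinv_0_lt_compat; lra|assumption]. }
    unfold Rdiv in *; lra. }
replace (2 / INR n) with (/ INR n + / INR n) by (field; lra).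
lra.
Qed.

(** The finite part exists for general reasons; by
    [log_integral_bounds] its value is the limit of [ln n - harmonic n]. *)
Lemma gamma_fp_zero (N : nat) :
  (1 <= N)%nat -> is_gamma_fp N 0 (RtoC (- Euler_Mascheroni)).
Proof.
intros HN; destruct N as [|M]; [lia|]; clear HN.
assert (HN : 0 < Re (RtoC 0) + INR (S M)).
{ rewrite re_RtoC, S_INR; pose proof (pos_INR M); lra. }
destruct (lower_finite_part (S M) 1 0 0 1 (Rle_refl 1) HN) as [l1 H1].
destruct (upper_limit 1 0 0 1) as [l2 H2]; [simpl; lra|simpl; lra|].
set (L := (l1 + l2)%C).
assert (HL : is_gamma_fp (S M) 0 L).
{ unfold is_gamma_fp; eapply fp_ext; [| | |apply fp_halves; [|exact H1|exact H2]].
  - intros x; apply integrand_gamma.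
  - intros x; apply singular_prim_zero; lia.
  - reflexivity.
  - apply Rcont_integrand. }
enough (L = RtoC (- Euler_Mascheroni)) as <- by exact HL.
assert (HS : lim_m_infty (fun p : R => RtoC p - laplace_prim (S M) 1 0 p)%C (RtoC 0)).
{ apply lim_m_infty_ext with
    (fun p : R => (-1)%R * Csum (fun m => exp_coef (- (1)) (S m) * exp_prim (0 + INR (S m)) p) M)%C.
  - intros p; unfold laplace_prim; rewrite Csum_shift, exp_coef_0.
    replace (0 + INR 0)%C with (RtoC 0) by (simpl; ring).
    unfold exp_prim at 2; destruct (Ceq_dec (RtoC 0) (RtoC 0)) as [_|]; [ring|contradiction].
  - eapply lim_m_infty_val.
    { apply (lim_m_infty_scal (-1)%R (fun p : R =>
        Csum (fun m => exp_coef (- (1)) (S m) * exp_prim (0 + INR (S m)) p) M)%C).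
      apply (lim_m_infty_Csum (fun m (p : R) => exp_coef (- (1)) (S m) * exp_prim (0 + INR (S m)) p)%C
        (fun m => exp_coef (- (1)) (S m) * 0)%C); intros m _.
      apply (lim_m_infty_scal (exp_coef (- (1)) (S m))), exp_prim_lim.
      rewrite re_plus, !re_RtoC, S_INR; pose proof (pos_INR m); lra. }
    rewrite (Csum_ext _ (fun _ => RtoC 0)), Csum_zero by (intros; ring); ring. }
assert (HL' := fp_change _ _ (fun p => RtoC p) L _ HS HL).
replace (L + 0)%C with L in HL' by ring.
assert (Hf : forall x : R, gamma_integrand 0 x = RtoC (exp (- exp x))).
{ intros x; unfold gamma_integrand; rewrite Cexp_R.
  replace (0 * x - exp x)%C with (RtoC (- exp x)) by (rewrite RtoC_opp; ring).
  apply Cexp_R. }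
assert (HCI : forall p q, CInt (fun x : R => gamma_integrand 0 x) p q = RtoC (RInt (fun x => exp (- exp x)) p q)).
{ intros p q; rewrite <- CInt_RtoC; [now apply CInt_ext|].
  intros x; apply Rcont_ext with (fun t : R => gamma_integrand 0 t); [exact Hf|apply Rcont_gamma]. }
assert (Happ : forall eps, 0 < eps -> exists B, forall p q, p <= - B -> B <= q ->
  Rabs (RInt (fun x => exp (- exp x)) p q + p - Re L) < eps /\ Rabs (Im L) < eps).
{ intros eps He; destruct (HL' eps He) as [B HB]; exists B; intros p q Hp Hq.
  specialize (HB p q Hp Hq); rewrite HCI in HB.
  set (J := RInt _ p q) in *.
  pose proof (Rmax_Cmod (J + p - L)%C) as Hm; simpl in Hm.
  split.
  - eapply Rle_lt_trans; [|exact HB]; eapply Rle_trans; [|exact Hm].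
    eapply Rle_trans; [|apply Rmax_l]; right; unfold Re, L; simpl; f_equal; ring.
  - eapply Rle_lt_trans; [|exact HB]; eapply Rle_trans; [|exact Hm].
    eapply Rle_trans; [|apply Rmax_r]; rewrite <- Rabs_Ropp; right; unfold Im, L; simpl; f_equal; ring. }
assert (HIm : Im L = 0).
{ destruct (Req_dec (Im L) 0) as [|Hne]; [assumption|exfalso].
  assert (0 < Rabs (Im L)) by now apply Rabs_pos_lt.
  destruct (Happ _ H) as [B HB]; destruct (HB (- B) B) as [_ Hlt]; lra. }
assert (Hbound : forall n, (1 <= n)%nat -> 0 <= Re L - (ln (INR n) - harmonic n) <= 2 / INR n).
{ intros n Hn; split.
  - apply le_epsilon; intros eps He; destruct (Happ eps He) as [B HB].
    set (p := Rmin (- B) 0); set (q := Rmax B (ln (INR n))).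
    destruct (HB p q (Rmin_l _ _) (Rmax_l _ _)) as [Hlt _].
    pose proof (log_integral_bounds n p q Hn (Rmin_r _ _) (Rmax_r _ _)).
    apply Rabs_def2 in Hlt; lra.
  - apply le_epsilon; intros eps He; destruct (Happ (eps / 2)) as [B HB]; [lra|].
    destruct (exp_small 1 (eps / 2) Rlt_0_1) as [B' HB']; [lra|].
    set (p := Rmin (- Rmax B B') 0); set (q := Rmax B (ln (INR n))).
    assert (p <= - Rmax B B') by apply Rmin_l.
    pose proof (Rmax_l B B'); pose proof (Rmax_r B B').
    destruct (HB p q ltac:(lra) (Rmax_l _ _)) as [Hlt _].
    specialize (HB' p ltac:(lra)); rewrite Rmult_1_l in HB'.
    pose proof (log_integral_bounds n p q Hn (Rmin_r _ _) (Rmax_r _ _)).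
    apply Rabs_def2 in Hlt; lra. }
assert (Hlim : is_lim_seq (fun n => harmonic n - ln (INR n)) (- Re L)).
{ apply is_lim_seq_spec; intros eps; simpl.
  destruct (archimed (2 / eps)) as [Hup _].
  assert (H2e : 0 < 2 / eps) by (apply Rdiv_lt_0_compat; [lra|apply eps]).
  exists (Z.to_nat (up (2 / eps))); intros n Hn.
  apply le_INR in Hn; rewrite INR_IZR_INZ in Hn.
  rewrite Z2Nat.id in Hn by (apply le_IZR; lra).
  assert (Hn0 : 0 < INR n) by lra.
  assert (Hn1 : (1 <= n)%nat) by (apply INR_lt in Hn0 || (destruct n; [simpl in Hn0; lra|lia]); lia).
  specialize (Hbound n Hn1).
  assert (2 / INR n < eps).
  { apply Rmult_lt_reg_r with (INR n); [exact Hn0|].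
    unfold Rdiv; rewrite Rmult_assoc, Rinv_l, Rmult_1_r by lra.
    assert (H3 : 2 / eps < INR n) by lra.
    apply (Rmult_lt_compat_l eps) in H3; [|apply eps].
    replace (eps * (2 / eps)) with 2 in H3 by (field; apply Rgt_not_eq, eps); lra. }
  change (Rabs (harmonic n - ln (INR n) - - Re L) < eps); apply Rabs_def1; lra. }
unfold Euler_Mascheroni; rewrite (is_lim_seq_unique _ _ Hlim); simpl real.
rewrite Ropp_involutive; apply injective_projections; [reflexivity|exact HIm].
Qed.

Lemma gamma_residue_pole (N k : nat) :
  (k < N)%nat -> gamma_residue N (RtoC (- INR k)) = exp_coef (- (1)) k.
Proof.
intros Hk; unfold gamma_residue.
assert (Heq : forall m, (RtoC (- INR k) + INR m)%C = RtoC 0 <-> m = k).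
{ intros m; rewrite <- RtoC_plus; split.
  - intros H; apply RtoC_inj in H; apply INR_eq; lra.
  - intros ->; f_equal; ring. }
induction N as [|N IH]; [lia|]; simpl.
destruct (Nat.eq_dec k N) as [->|Hne].
- destruct (Ceq_dec _ _) as [_|Hc]; [|exfalso; now apply Hc, Heq].
  rewrite (Csum_ext _ (fun _ => RtoC 0)), Csum_zero; [ring|].
  intros m Hm; destruct (Ceq_dec _ _) as [E|_]; [apply Heq in E; lia|reflexivity].
- destruct (Ceq_dec _ _) as [E|_]; [apply Heq in E; lia|].
  rewrite IH by lia; ring.
Qed.

Lemma gamma_residue_regular (N : nat) (w : C) :
  (forall k : nat, w <> RtoC (- INR k)) -> gamma_residue N w = RtoC 0.
Proof.
intros H; unfold gamma_residue; rewrite (Csum_ext _ (fun _ => RtoC 0)), Csum_zero; [reflexivity|].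
intros m _; destruct (Ceq_dec _ _) as [E|_]; [|reflexivity].
exfalso; apply (H m); rewrite RtoC_opp.
replace w with (w + INR m - INR m)%C by ring; rewrite E; ring.
Qed.

(** The recursion of [Gamma_fp] is the functional equation with the
    residue as inhomogeneous term. *)
Lemma gamma_fp_pole (N k : nat) :
  (k < N)%nat -> is_gamma_fp N (RtoC (- INR k)) (RtoC (Gamma_fp k)).
Proof.
intros HN; induction k as [|k IH].
- simpl INR; rewrite Ropp_0.
  replace (Gamma_fp 0) with (- Euler_Mascheroni); [apply gamma_fp_zero; lia|].
  unfold Gamma_fp; rewrite harmonic_0; simpl; field.
- destruct N as [|N]; [lia|].
  assert (Hk : 0 < INR (S k)) by (apply lt_0_INR; lia).
  assert (Hk0 : RtoC (- INR (S k)) <> RtoC 0) by (intros H; apply RtoC_inj in H; lra).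
  assert (Hf : INR (fact k) <> 0) by apply INR_fact_neq_0.
  replace (RtoC (Gamma_fp (S k)))
    with ((RtoC (Gamma_fp k) - gamma_residue (S N) (RtoC (- INR (S k)))) / RtoC (- INR (S k)))%C.
  + apply gamma_fp_recursion; [exact Hk0| |].
    * rewrite re_RtoC; apply lt_INR in HN; lra.
    * replace (RtoC (- INR (S k)) + 1)%C with (RtoC (- INR k)); [apply IH; lia|].
      rewrite <- RtoC_plus; f_equal; rewrite S_INR; ring.
  + rewrite gamma_residue_pole by exact HN.
    unfold exp_coef; replace (- (1))%C with (RtoC (-1)) by (now rewrite <- RtoC_opp).
    rewrite <- RtoC_pow.
    unfold Cdiv; rewrite <- RtoC_inv, <- RtoC_mult, <- RtoC_minus, <- RtoC_inv, <- RtoC_mult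
      by (lra || apply INR_fact_neq_0).
    f_equal; unfold Gamma_fp; rewrite harmonic_S.
    replace (fact (S k)) with (S k * fact k)%nat by reflexivity; rewrite mult_INR.
    rewrite <- tech_pow_Rmult; field; split; lra.
Qed.

(** This is the formula that defines [Gamma] left of the line
    [Re w = 0]. *)
Lemma gamma_fp_descent (n K : nat) (w l : C) :
  (forall k : nat, w <> RtoC (- INR k)) -> 0 < Re w + INR (S n) ->
  is_gamma_fp (S n) (w + INR K)%C l ->
  is_gamma_fp (S n) w (l / Cprod (fun j => w + INR j) K)%C.
Proof.
intros Hw HN; revert l; induction K as [|K IH]; intros l H; simpl Cprod.
- replace (w + INR 0)%C with w in H by (simpl; ring).
  replace (l / 1)%C with l by (field; intros E; apply RtoC_inj in E; lra); exact H.
- assert (Hreg : forall k : nat, (w + INR K)%C <> RtoC (- INR k)).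
  { intros k E; apply (Hw (K + k)%nat); rewrite plus_INR, RtoC_opp, RtoC_plus.
    replace w with (w + INR K - INR K)%C by ring; rewrite E, RtoC_opp; ring. }
  assert (H0 : (w + INR K)%C <> RtoC 0).
  { intros E; apply (Hreg O); rewrite E; simpl; now rewrite Ropp_0. }
  assert (HP : Cprod (fun j => w + INR j)%C K <> RtoC 0).
  { clear - Hw; induction K as [|K IH]; simpl; [intros E; apply RtoC_inj in E; lra|].
    apply Cmult_neq_0; [exact IH|].
    intros E; apply (Hw K); rewrite RtoC_opp.
    replace w with (w + INR K - INR K)%C by ring; rewrite E; ring. }
  replace (l / (Cprod (fun j => w + INR j) K * (w + INR K)))%C
    with ((l / (w + INR K)) / Cprod (fun j => w + INR j) K)%C by (field; auto).
  apply IH.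
  replace (l / (w + INR K))%C
    with ((l - gamma_residue (S n) (w + INR K)) / (w + INR K))%C.
  + apply gamma_fp_recursion; [exact H0| |].
    * rewrite re_plus, re_RtoC; pose proof (pos_INR K); lra.
    * replace (w + INR K + 1)%C with (w + INR (S K))%C; [exact H|].
      rewrite S_INR, RtoC_plus; ring.
  + rewrite gamma_residue_regular by exact Hreg; f_equal; ring.
Qed.

Theorem gamma_star_fp (n : nat) (w : C) :
  0 < Re w + INR (S n) -> is_gamma_fp (S n) w (Gamma_star w).
Proof.
intros HN; destruct (classic (exists k : nat, w = RtoC (- INR k))) as [[k ->]|Hreg].
- rewrite Gamma_star_pole; apply gamma_fp_pole.
  rewrite re_RtoC in HN; apply INR_lt; lra.
- assert (Hw : forall k : nat, w <> RtoC (- INR k)) by (intros k E; apply Hreg; now exists k).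
  rewrite Gamma_star_regular by exact Hw; unfold Gamma.
  apply gamma_fp_descent; [exact Hw|exact HN|].
  apply gamma_fp_convergent, Gamma_shift_pos.
Qed.

(** The line for [lam = 1] is translated by the logarithm
    [rho + i psi] of [lam]; the half plane [Re lam > 0] is what keeps the upper
    end convergent on the way. *)
Lemma laplace_fp (n : nat) (alpha : R) (v : C) (rho psi : R) :
  1 <= alpha -> 0 < Re v + INR (S n) -> - (PI / 2) < psi < PI / 2 ->
  is_integrand_fp (S n) alpha v 0 (Cexp (rho + Ci * psi))
    (Cexp (- (v * (rho + Ci * psi))) *
       (Gamma_star v - (rho + Ci * psi) * gamma_residue (S n) v)).
Proof.
intros Ha HN Hpsi.
set (Lam := (rho + Ci * psi)%C).
assert (Hcos : 0 < cos psi) by (apply cos_gt_0; lra).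
assert (H := integrand_fp_shift (S n) alpha v 0 1 Lam (Gamma_star v) (exp (- Rabs rho) * cos psi) Ha HN).
replace (0 * Cexp (alpha * Lam))%C with (RtoC 0) in H by ring.
replace (1 * Cexp Lam)%C with (Cexp Lam) in H by ring.
replace (pole_sum (S n) alpha v 0 1) with (gamma_residue (S n) v) in H.
2:{ unfold pole_sum; replace (- RtoC 0)%C with (RtoC 0) by ring.
    rewrite Csum_head; [|lia|intros k Hk; rewrite exp_coef_zero by exact Hk; ring].
    rewrite exp_coef_0, Cmult_1_l; unfold gamma_residue; apply Csum_ext; intros m _.
    simpl INR; replace (v + 0 * alpha + INR m)%C with (v + INR m)%C by ring; reflexivity. }
apply H.
- apply Rmult_lt_0_compat; [apply exp_pos|exact Hcos].
- intros t Ht; split; [rewrite Cmult_0_l, re_RtoC; lra|].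
  rewrite Cmult_1_l; unfold Cexp; simpl Re.
  replace (t * (rho + (0 * psi - 1 * 0)) - 0 * (0 + (0 * 0 + 1 * psi))) with (t * rho) by ring.
  replace (t * (0 + (0 * 0 + 1 * psi)) + 0 * (rho + (0 * psi - 1 * 0))) with (t * psi) by ring.
  apply Rmult_le_compat; [left; apply exp_pos|lra| |].
  + apply exp_le. pose proof (Rle_abs (- rho)) as A; rewrite Rabs_Ropp in A.
    pose proof (Rabs_pos rho); nra.
  + destruct (Rle_lt_dec 0 psi).
    * apply cos_decr_1; nra.
    * rewrite <- (cos_neg psi), <- (cos_neg (t * psi)); apply cos_decr_1; nra.
- pose proof (gamma_star_fp n v HN) as G.
  unfold is_integrand_fp; eapply fp_ext; [| | |exact G].
  + intros x; symmetry; apply integrand_gamma.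
  + intros x; symmetry; apply singular_prim_zero; lia.
  + reflexivity.
Qed.

(** * The asymptotic expansion *)

(** Both the integral and the terms have the same counterterm, so their
    difference is an absolutely convergent integral with the factor
    [exp_rem N (- a exp (alpha x))], bounded by [|a| ^ N exp (N alpha x)] because
    [Re a >= 0].  A real translation by [rho] extracts the power of
    [exp rho]. *)
Lemma watson_remainder (N : nat) (alpha c : R) (b a : C) :
  1 <= alpha -> 0 < Re b + INR N -> 0 < c -> 0 <= Re a ->
  exists K, forall (lam l : C) (G : nat -> C) (rho : R),
    c * exp rho <= Re lam -> is_integrand_fp N alpha b a lam l ->
    (forall k, (k < N)%nat -> is_integrand_fp N alpha (b + INR k * alpha) 0 lam (G k)) ->
    Cmod (l - Csum (fun k => exp_coef (- a) k * G k) N)%C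
    <= K * exp (- (Re b + INR N * alpha) * rho).
Proof.
intros Hal Hb Hc Ha.
set (k := Re b + INR N * alpha).
assert (Hk : 0 < k) by (unfold k; pose proof (pos_INR N); nra).
destruct (linear_minus_exp k c Hc) as [K0 HK0].
set (K1 := 1 + exp K0); assert (HK1 : 0 < exp K0) by apply exp_pos.
exists (Cmod a ^ N * K1 / k + Cmod a ^ N * K1).
intros lam l G rho Hlam Hl HG.
set (r := fun x : R => (Cexp (b * x - lam * Cexp x) * exp_rem N (- a * Cexp (alpha * x)))%C).
assert (Cr : forall x, Rcont r x).
{ intros x; unfold r; apply Rcont_mult.
  - apply Rcont_ext with (fun t : R => integrand alpha b 0 lam t).
    + intros y; unfold integrand; f_equal; ring.
    + apply Rcont_integrand.
  - apply (Rcont_holo (fun L => exp_rem N (- a * Cexp (alpha * L)))%C).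
    apply (holo_comp (exp_rem N) (fun L => - a * Cexp (alpha * L))%C); [apply holo_exp_rem|holo]. }
set (D := (l - Csum (fun k => exp_coef (- a) k * G k) N)%C).
assert (HD : is_fp r (fun _ => RtoC 0) D).
{ assert (Cf : forall k x, Rcont (fun x : R => exp_coef (- a) k * integrand alpha (b + INR k * alpha) 0 lam x)%C x)
    by (intros; apply Rcont_scal, Rcont_integrand).
  eapply fp_ext; [| | |apply fp_plus; [| |exact Hl|apply (fp_scal (RtoC (-1))); [|
    apply (fp_Csum (fun k (x : R) => exp_coef (- a) k * integrand alpha (b + INR k * alpha) 0 lam x)%C
     (fun k (x : R) => exp_coef (- a) k * singular_prim N alpha (b + INR k * alpha) 0 lam x)%C
     (fun k => exp_coef (- a) k * G k)%C N Cf)]]].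
  - intros x; cbv beta.
    rewrite (Csum_ext _ (fun k => Cexp (b * x - lam * Cexp x) * exp_coef (- a * Cexp (alpha * x)) k)%C).
    + rewrite (Csum_scal (Cexp (b * x - lam * Cexp x)) (exp_coef (- a * Cexp (alpha * x)))).
      unfold r, exp_rem, exp_poly, integrand.
      replace (b * x - a * Cexp (alpha * x) - lam * Cexp x)%C
        with ((b * x - lam * Cexp x) + - a * Cexp (alpha * x))%C by ring.
      rewrite Cexp_plus; ring.
    + intros j _; rewrite exp_coef_mult_l, Cexp_pow; unfold integrand.
      replace ((b + INR j * alpha) * x - 0 * Cexp (alpha * x) - lam * Cexp x)%C
        with ((b * x - lam * Cexp x) + INR j * (alpha * x))%C by ring.
      rewrite Cexp_plus; ring.
  - intros x; cbv beta; unfold singular_prim at 1.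
    rewrite (Csum_ext (fun k => exp_coef (- a) k * singular_prim N alpha (b + INR k * alpha) 0 lam x)%C
      (fun n => exp_coef (- a) n * laplace_prim N lam (b + INR n * alpha) x)%C); [ring|].
    intros j Hj; rewrite singular_prim_zero by lia; reflexivity.
  - unfold D; ring.
  - intros; apply Rcont_integrand.
  - intros; now apply Rcont_scal, Rcont_Csum.
  - intros; now apply Rcont_Csum.
  - intros j Hj.
    apply (fp_scal (exp_coef (- a) j) (fun x : R => integrand alpha (b + INR j * alpha) 0 lam x)
      (fun x : R => singular_prim N alpha (b + INR j * alpha) 0 lam x)).
    + apply Rcont_integrand.
    + exact (HG j Hj). }
assert (HT := fp_translate r (fun _ => RtoC 0) D (- rho) Cr HD).
set (A := Cmod a ^ N * exp (- k * rho)).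
assert (HA0 : 0 <= Cmod a ^ N) by (apply pow_le, Cmod_ge_0).
assert (HA : 0 <= A) by (apply Rmult_le_pos; [exact HA0|left; apply exp_pos]).
assert (Br : forall y, Cmod (r (y + - rho)) <= A * exp (k * y - c * exp y)).
{ intros y; set (x := y + - rho); unfold r; rewrite Cmod_mult, Cmod_Cexp.
  assert (ER : Re (b * x - lam * Cexp x)%C = Re b * x - exp x * Re lam).
  { unfold Cminus; rewrite re_plus, re_opp, Cexp_R, !re_scal_r; ring. }
  rewrite ER.
  assert (Ea : Cmod (- a * Cexp (alpha * x))%C = Cmod a * exp (alpha * x)).
  { rewrite Cmod_mult, Cmod_opp, <- RtoC_mult, Cmod_Cexp, re_RtoC; reflexivity. }
  assert (B : Cmod (exp_rem N (- a * Cexp (alpha * x))%C) <= Cmod a ^ N * exp (INR N * (alpha * x))).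
  { eapply Rle_trans; [apply exp_rem_bound_neg|].
    - rewrite <- RtoC_mult, Cexp_R, re_scal_r, re_opp; pose proof (exp_pos (alpha * x)); nra.
    - rewrite Ea, pow_exp_bound by apply Cmod_ge_0; lra. }
  apply Rle_trans with (exp (Re b * x - exp x * Re lam) * (Cmod a ^ N * exp (INR N * (alpha * x)))).
  - apply Rmult_le_compat_l; [left; apply exp_pos|exact B].
  - replace (exp (Re b * x - exp x * Re lam) * (Cmod a ^ N * exp (INR N * (alpha * x))))
      with (Cmod a ^ N * (exp (Re b * x - exp x * Re lam) * exp (INR N * (alpha * x)))) by ring.
    unfold A; rewrite Rmult_assoc, <- !exp_plus.
    apply Rmult_le_compat_l; [exact HA0|]; apply exp_le.
    assert (Ey : exp y = exp rho * exp x).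
    { rewrite <- exp_plus; f_equal; unfold x; ring. }
    assert (c * exp y <= exp x * Re lam).
    { rewrite Ey; pose proof (exp_pos x); nra. }
    assert (k * x = k * y - k * rho) by (unfold x; ring).
    unfold k in *; lra. }
assert (Cr' : forall x, Rcont (fun x => r (x + - rho)) x).
{ intros x; apply Rcont_eps; intros e He.
  destruct (proj1 (Rcont_eps r (x + - rho)) (Cr _) e He) as (d & Hd & H').
  exists d; split; [exact Hd|]; intros y Hy; apply H'.
  replace (y + - rho - (x + - rho)) with (y - x) by ring; exact Hy. }
destruct (fp_dominated (fun x => r (x + - rho)) (A * K1) k Hk Cr') as (l' & Hl' & Bl).
- intros x _; eapply Rle_trans; [apply Br|]; rewrite Rmult_assoc.
  apply Rmult_le_compat_l; [exact HA|].
  apply Rle_trans with (exp (k * x)).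
  + apply exp_le; pose proof (exp_pos x); nra.
  + pose proof (exp_pos (k * x)); unfold K1; nra.
- intros x Hx; eapply Rle_trans; [apply Br|]; rewrite Rmult_assoc.
  apply Rmult_le_compat_l; [exact HA|].
  apply Rle_trans with (exp K0 * exp (- x)).
  + rewrite <- exp_plus; apply exp_le; specialize (HK0 x Hx); lra.
  + pose proof (exp_pos (- x)); unfold K1; nra.
- rewrite (fp_unique _ _ _ _ HT Hl').
  eapply Rle_trans; [exact Bl|]; right; unfold A; field; lra.
Qed.

Lemma Cexp_Ci_half_PI : Cexp (Ci * (PI / 2)%R) = Ci.
Proof.
unfold Cexp; simpl.
replace (0 * (PI / 2) - 1 * 0) with 0 by ring.
replace (0 * 0 + 1 * (PI / 2)) with (PI / 2) by ring.
rewrite exp_0, cos_PI2, sin_PI2; unfold Ci; f_equal; ring.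
Qed.

Lemma Ci_pow (n : nat) : (Ci ^ n)%C = Cexp (Ci * (INR n * (PI / 2)%R)).
Proof.
rewrite <- Cexp_Ci_half_PI at 1; rewrite Cexp_pow; f_equal; ring.
Qed.

Lemma RtoC_half_PI : RtoC (PI / 2) = (PI / 2)%C.
Proof. unfold Rdiv; rewrite RtoC_mult, RtoC_inv by lra; reflexivity. Qed.

(** A logarithm of [i z] for [z = r exp (i theta)], continuous in [theta]. *)
Definition log_iz (theta r : R) : C := (ln r + Ci * (theta + PI / 2)%R)%C.

Lemma Cexp_log_iz (theta r : R) : 0 < r ->
  Cexp (log_iz theta r) = (Ci * (r * Cexp (Ci * theta)))%C.
Proof.
intros Hr; unfold log_iz.
replace (ln r + Ci * (theta + PI / 2)%R)%C with (ln r + Ci * theta + Ci * (PI / 2)%R)%C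
  by (rewrite RtoC_plus; ring).
rewrite !Cexp_plus, Cexp_Ci_half_PI, Cexp_R, exp_ln by exact Hr; ring.
Qed.

Lemma expansion_term_eq (alpha : R) (beta : C) (theta r : R) (n : nat) :
  expansion_term alpha beta theta r n =
  (exp_coef Ci n * (Cexp (- ((beta + 1 + INR n * alpha) * log_iz theta r))
                 * Gamma_star (beta + 1 + INR n * alpha)))%C.
Proof.
unfold expansion_term, exp_coef, Rcpow.
replace (beta + INR n * alpha + 1)%C with (beta + 1 + INR n * alpha)%C by ring.
set (w := (beta + 1 + INR n * alpha)%C).
rewrite Ci_pow.
assert (E : (Cexp (Ci * (INR n * PI / 2 - (theta + PI / 2) * w)) / Cexp (w * ln r))%C
  = (Cexp (Ci * (INR n * (PI / 2)%R)) * Cexp (- (w * log_iz theta r)))%C).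
{ rewrite <- Cexp_minus, <- Cexp_plus; f_equal; unfold log_iz.
  rewrite RtoC_plus, RtoC_half_PI; field. }
transitivity ((Cexp (Ci * (INR n * PI / 2 - (theta + PI / 2) * w)) / Cexp (w * ln r))
   * Gamma_star w / INR (fact n))%C.
- field; split; [apply Cexp_nz|apply fact_nz].
- rewrite E; field; apply fact_nz.
Qed.

(** If [b + n alpha + m = 0], then
    [(- i z) ^ m = exp (i (theta - pi / 2) m) r ^ m]. *)
Lemma log_sum_eq (N : nat) (alpha : R) (beta : C) (theta r : R) :
  1 <= alpha -> 0 < r -> (index_bound beta <= N)%nat ->
  log_sum alpha beta theta r =
  (log_iz theta r * pole_sum N alpha (beta + 1) (- Ci) (Ci * (r * Cexp (Ci * theta))))%C.
Proof.
intros Ha Hr HN; unfold log_sum; rewrite (low_sum_square _ _ _ N) by assumption.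
rewrite pole_sum_square, <- square_sum_scal; apply square_sum_ext; intros m n _ _.
rewrite F_exponent_eq.
destruct (Ceq_dec _ _) as [E|_].
2:{ destruct (Rle_dec _ _); ring. }
destruct (Rle_dec _ _) as [_|Hgt].
- unfold exp_coef; replace (- - Ci)%C with Ci by ring.
  assert (Em : ((- (Ci * (r * Cexp (Ci * theta)))) ^ m)%C
     = (Cexp (Ci * (theta - PI / 2) * INR m) * RtoC (r ^ m))%C).
  { replace (- (Ci * (r * Cexp (Ci * theta))))%C
      with (Cexp (Ci * (theta - PI / 2)) * r)%C.
    - rewrite Cpow_mult_l, Cexp_pow, RtoC_pow; f_equal; f_equal; ring.
    - replace (Ci * (theta - PI / 2))%C with (Ci * theta - Ci * (PI / 2)%R)%C
        by (rewrite RtoC_half_PI; ring).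
      rewrite Cexp_minus, Cexp_Ci_half_PI.
      unfold Cdiv; rewrite Ci_inv; ring. }
  rewrite Em; unfold log_iz; rewrite RtoC_plus, RtoC_half_PI.
  field; split; apply fact_nz.
- exfalso; apply Hgt.
  assert (E' : Re (beta + 1 + INR n * alpha + INR m)%C = 0) by now rewrite E, re_RtoC.
  rewrite !re_plus, re_scal_l, !re_RtoC in E'; lra.
Qed.

(** The parameter [a = - i] after rotation of the ray by [phi]. *)
Definition rotated (alpha phi : R) : C := (- Ci * Cexp (alpha * (Ci * phi)))%C.

Lemma Re_rotated (alpha phi : R) : Re (rotated alpha phi) = sin (alpha * phi).
Proof.
unfold rotated, Cexp; simpl.
replace (alpha * (0 * phi - 1 * 0) - 0 * (0 * 0 + 1 * phi)) with 0 by ring.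
replace (alpha * (0 * 0 + 1 * phi) + 0 * (0 * phi - 1 * 0)) with (alpha * phi) by ring.
rewrite exp_0; ring.
Qed.

Lemma Re_Ci_polar (theta r : R) : Re (Ci * (r * Cexp (Ci * theta)))%C = - (r * sin theta).
Proof.
rewrite Cmult_comm, re_mult_Ci, im_scal_l; unfold Cexp; simpl.
replace (0 * theta - 1 * 0) with 0 by ring; replace (0 * 0 + 1 * theta) with theta by ring.
rewrite exp_0; ring.
Qed.

(** The value which [integrand_fp_shift] gives for the rotated ray if
    [F z] is the value for the original one. *)
Definition ray_value (N : nat) (alpha : R) (beta : C) (F : C -> C) (phi : R) (z : C) : C :=
  (Cexp (- ((beta + 1) * (Ci * phi)))
   * (F z - Ci * phi * pole_sum N alpha (beta + 1) (- Ci) (Ci * z)))%C.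

(** With [Lam = log_iz + i phi] the logarithm of [lam] on the rotated
    ray, the angle [phi] cancels in every power.  In the logarithmic terms,
    [- Lam] from [laplace_fp] and [i phi] from [ray_value] combine to
    [- log_iz], which is the contribution of [log_sum]. *)
Lemma ray_expansion (n : nat) (alpha : R) (beta : C) (F : C -> C) (phi delta : R) :
  let N := S n in
  1 < alpha -> (index_bound beta <= N)%nat -> 0 <= sin (alpha * phi) ->
  0 < delta <= PI / 2 ->
  exists K, forall theta r : R, 1 <= r ->
    - PI + delta <= theta + phi <= - delta ->
    is_integrand_fp N alpha (beta + 1) (rotated alpha phi)
      (Ci * (r * Cexp (Ci * theta)) * Cexp (Ci * phi))
      (ray_value N alpha beta F phi (r * Cexp (Ci * theta))) ->
    Cmod (F (RtoC r * Cexp (Ci * theta)) + log_sum alpha beta theta r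
          - Csum (expansion_term alpha beta theta r) N)%C
    <= K * Rpower r (- Re beta - INR N * alpha - 1).
Proof.
intros N Ha HN Hsin Hdelta.
set (b := (beta + 1)%C).
assert (Hb : 0 < Re b + INR N) by now apply index_bound_large.
assert (Hc : 0 < sin delta) by (apply sin_gt_0; pose proof PI_RGT_0; lra).
destruct (watson_remainder N alpha (sin delta) b (rotated alpha phi)) as [K HK].
{ lra. } { exact Hb. } { exact Hc. } { rewrite Re_rotated; exact Hsin. }
exists (Cmod (Cexp (b * (Ci * phi))) * K); intros theta r Hr Hth HFP.
set (z := (r * Cexp (Ci * theta))%C) in *.
set (L0 := log_iz theta r); set (Lam := (L0 + Ci * phi)%C).
assert (Hz : (Ci * z)%C = Cexp L0) by (unfold L0, z; rewrite Cexp_log_iz by lra; reflexivity).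
assert (Hlam : (Ci * z * Cexp (Ci * phi))%C = Cexp Lam).
{ unfold Lam; rewrite Cexp_plus, <- Hz; reflexivity. }
rewrite Hlam in HFP.
set (psi := theta + phi + PI / 2).
assert (HLam : Lam = (ln r + Ci * psi)%C).
{ unfold Lam, L0, log_iz, psi; rewrite !RtoC_plus; ring. }
set (G := fun k : nat => (Cexp (- ((b + INR k * alpha) * Lam)) *
  (Gamma_star (b + INR k * alpha) - Lam * gamma_residue N (b + INR k * alpha)))%C).
assert (HG : forall k, (k < N)%nat -> is_integrand_fp N alpha (b + INR k * alpha) 0 (Cexp Lam) (G k)).
{ intros k _; unfold G; rewrite HLam; apply laplace_fp; [lra| |unfold psi; lra].
  rewrite re_plus, re_scal_l, re_RtoC; pose proof (pos_INR k); fold N; nra. }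
assert (HRe : sin delta * exp (ln r) <= Re (Cexp Lam)).
{ rewrite HLam; unfold Cexp; simpl.
  replace (ln r + (0 * psi - 1 * 0)) with (ln r) by ring.
  replace (0 + (0 * 0 + 1 * psi)) with psi by ring.
  rewrite Rmult_comm; apply Rmult_le_compat_l; [left; apply exp_pos|].
  rewrite <- cos_shift.
  destruct (Rle_lt_dec 0 psi).
  - apply cos_decr_1; unfold psi in *; lra.
  - rewrite <- (cos_neg psi); apply cos_decr_1; unfold psi in *; lra. }
specialize (HK (Cexp Lam) _ G (ln r) HRe HFP HG).
set (P := pole_sum N alpha b (- Ci) (Ci * z)).
assert (Elog : log_sum alpha beta theta r = (L0 * P)%C) by (apply log_sum_eq; [lra|lra|exact HN]).
assert (Ephi : forall x, (Cexp (b * (Ci * phi)) * (Cexp (- (b * (Ci * phi))) * x))%C = x).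
{ intros x; rewrite Cmult_assoc, <- Cexp_plus.
  replace (b * (Ci * phi) + - (b * (Ci * phi)))%C with (RtoC 0) by ring.
  rewrite Cexp_0; ring. }
assert (EG : (Cexp (b * (Ci * phi)) * Csum (fun k => exp_coef (- rotated alpha phi) k * G k) N)%C
   = (Csum (expansion_term alpha beta theta r) N - Lam * P)%C).
{ rewrite <- Csum_scal.
  transitivity (Csum (expansion_term alpha beta theta r) N + - Lam * P)%C; [|ring].
  unfold P, pole_sum; rewrite <- Csum_scal, <- Csum_plus; apply Csum_ext; intros k Hk.
  rewrite expansion_term_eq; fold b L0.
  set (w := (b + INR k * alpha)%C).
  replace (- rotated alpha phi)%C with (Ci * Cexp (alpha * (Ci * phi)))%C
    by (unfold rotated; ring).
  replace (- - Ci)%C with Ci by ring.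
  rewrite exp_coef_mult_l, Cexp_pow; unfold G; fold w.
  assert (Ew : (Cexp (b * (Ci * phi)) * (Cexp (INR k * (alpha * (Ci * phi)))
     * Cexp (- (w * Lam))))%C = Cexp (- (w * L0))).
  { rewrite <- !Cexp_plus; f_equal; unfold w, Lam; ring. }
  transitivity (exp_coef Ci k * ((Cexp (b * (Ci * phi)) * (Cexp (INR k * (alpha * (Ci * phi)))
     * Cexp (- (w * Lam)))) * (Gamma_star w - Lam * gamma_residue N w)))%C; [ring|].
  rewrite Ew.
  match goal with |- _ = (_ + _ * (_ * ?D))%C =>
    assert (ED : (Cexp (- (w * L0)) * gamma_residue N w)%C = D) end.
  { unfold gamma_residue; rewrite <- Csum_scal; apply Csum_ext; intros m _.
    destruct (Ceq_dec _ _) as [E0|_]; [|ring].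
    replace (- (Ci * z))%C with (- (1) * Cexp L0)%C by (rewrite Hz; ring).
    rewrite exp_coef_mult_l, Cexp_pow, Cmult_comm; do 2 f_equal.
    replace (- (w * L0))%C with (INR m * L0 - (w + INR m) * L0)%C by ring.
    rewrite E0; ring. }
  rewrite <- ED; ring. }
assert (Key : (F z + log_sum alpha beta theta r - Csum (expansion_term alpha beta theta r) N)%C
  = (Cexp (b * (Ci * phi)) * (ray_value N alpha beta F phi z
      - Csum (fun k => exp_coef (- rotated alpha phi) k * G k) N))%C).
{ transitivity (Cexp (b * (Ci * phi)) * ray_value N alpha beta F phi z
    - Cexp (b * (Ci * phi)) * Csum (fun k => exp_coef (- rotated alpha phi) k * G k) N)%C; [|ring].
  rewrite EG; unfold ray_value; fold b P; rewrite Ephi, Elog; unfold Lam; ring. }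
rewrite Key, Cmod_mult, Rmult_assoc.
apply Rmult_le_compat_l; [apply Cmod_ge_0|].
eapply Rle_trans; [exact HK|]; right; f_equal; unfold Rpower; f_equal.
unfold b; rewrite re_plus, re_RtoC; ring.
Qed.

(** On a small disc in the lower half plane all rays between the two decay,
    so that the rotation is allowed; the identity theorem does the rest. *)
Lemma rotation_continues (K : nat) (alpha : R) (beta : C) (F : C -> C) (phi : R) :
  let N := S (S K) in
  1 < alpha -> is_F alpha beta F -> (index_bound beta <= N)%nat ->
  0 < phi < PI / alpha ->
  forall z, is_integrand_fp N alpha (beta + 1) (rotated alpha phi) (Ci * z * Cexp (Ci * phi))
    (ray_value N alpha beta F phi z).
Proof.
intros N Ha [HF HFP] HN Hphi.
set (b := (beta + 1)%C).
assert (Hb : 0 < Re b + INR N) by now apply index_bound_large.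
pose proof PI_RGT_0 as HPI.
assert (Hap : 0 < alpha * phi < PI).
{ split; [nra|].
  replace PI with (alpha * (PI / alpha)) by (field; lra).
  apply Rmult_lt_compat_l; lra. }
assert (HpP : phi < PI) by nra.
assert (Hrot : 0 < Re (rotated alpha phi)) by (rewrite Re_rotated; apply sin_gt_0; lra).
destruct (entire_finite_part K alpha b (rotated alpha phi) Ha Hrot Hb) as (Phi & HPhi & DPhi).
set (pol := fun z : C => pole_sum N alpha b (- Ci) (Ci * z)).
set (G := fun z : C => (Cexp (b * (Ci * phi)) * Phi (Ci * z * Cexp (Ci * phi)) + Ci * phi * pol z)%C).
assert (Hpol : holo pol).
{ apply (holo_comp (pole_sum N alpha b (- Ci)) (fun z => Ci * z)%C); [|holo].
  unfold pole_sum.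
  apply (holo_Csum (fun n u => exp_coef (- - Ci) n * Csum (fun m =>
    if Ceq_dec (b + INR n * alpha + INR m)%C (RtoC 0) then exp_coef (- u) m else RtoC 0) N)%C).
  intros k; apply (holo_mult (fun _ => exp_coef (- - Ci) k)); [apply holo_const|].
  apply (holo_Csum (fun m u =>
    if Ceq_dec (b + INR k * alpha + INR m)%C (RtoC 0) then exp_coef (- u) m else RtoC 0)).
  intros m; destruct (Ceq_dec _ _); [apply holo_exp_coef_opp|apply holo_const]. }
assert (HG : holo G) by (unfold G; holo).
assert (Ephi : forall x, (Cexp (- (b * (Ci * phi))) * (Cexp (b * (Ci * phi)) * x))%C = x).
{ intros x; rewrite Cmult_assoc, <- Cexp_plus.
  replace (- (b * (Ci * phi)) + b * (Ci * phi))%C with (RtoC 0) by ring.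
  rewrite Cexp_0; ring. }
assert (Ephi' : forall x, (Cexp (b * (Ci * phi)) * (Cexp (- (b * (Ci * phi))) * x))%C = x).
{ intros x; rewrite <- (Ephi x) at 2; rewrite !Cmult_assoc; f_equal; ring. }
enough (HFG : forall z, F z = G z).
{ intros z; replace (ray_value N alpha beta F phi z) with (Phi (Ci * z * Cexp (Ci * phi)))%C;
    [apply HPhi|].
  unfold ray_value; fold b (pol z); rewrite HFG; unfold G.
  transitivity (Cexp (- (b * (Ci * phi))) *
    (Cexp (b * (Ci * phi)) * Phi (Ci * z * Cexp (Ci * phi))))%C; [now rewrite Ephi|f_equal; ring]. }
set (c := cos (phi / 2) / 2).
assert (Hcos : 0 < cos (phi / 2)) by (apply cos_gt_0; lra).
assert (Hc : 0 < c) by (unfold c; lra).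
(* For [0 <= t <= 1] the angle [theta0 + t phi] differs from [- pi / 2] by at
   most [phi / 2], so the linear factor decays on all intermediate rays. *)
set (theta0 := - (PI + phi) / 2).
apply (identity_theorem F G (Cexp (Ci * theta0)) c).
- now apply entire_holo.
- exact HG.
- exact Hc.
- intros z Hz.
  assert (Hpos : forall t, 0 <= t <= 1 -> c <= Re (Ci * z * Cexp (t * (Ci * phi)))%C).
  { intros t Ht.
    replace (Ci * z * Cexp (t * (Ci * phi)))%C
      with (Ci * (1%R * Cexp (Ci * (theta0 + t * phi)%R))
            + Ci * (z - Cexp (Ci * theta0)) * Cexp (t * (Ci * phi)))%C.
    2:{ replace (Ci * (theta0 + t * phi)%R)%C with (Ci * theta0 + t * (Ci * phi))%C
          by (rewrite RtoC_plus, RtoC_mult; ring).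
        rewrite Cexp_plus; ring. }
    rewrite re_plus, Re_Ci_polar.
    assert (B : - c <= Re (Ci * (z - Cexp (Ci * theta0)) * Cexp (t * (Ci * phi)))%C).
    { assert (Em : Cmod (Ci * (z - Cexp (Ci * theta0)) * Cexp (t * (Ci * phi)))%C
          = Cmod (z - Cexp (Ci * theta0))%C).
      { rewrite !Cmod_mult, Cmod_Ci, Cmod_Cexp.
        replace (Re (t * (Ci * phi))%C) with 0 by (unfold Re; simpl; ring).
        rewrite exp_0; ring. }
      pose proof (re_le_Cmod (Ci * (z - Cexp (Ci * theta0)) * Cexp (t * (Ci * phi)))%C) as Hr.
      rewrite Em in Hr.
      pose proof (Rle_abs (- Re (Ci * (z - Cexp (Ci * theta0)) * Cexp (t * (Ci * phi)))%C)) as Hr'.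
      rewrite Rabs_Ropp in Hr'; lra. }
    assert (S0 : cos (phi / 2) <= - (1 * sin (theta0 + t * phi))).
    { replace (theta0 + t * phi) with (- (PI / 2 + (phi / 2 - t * phi))) by (unfold theta0; field).
      rewrite sin_neg, <- cos_sin.
      assert (0 <= t * phi <= phi) by nra.
      replace (- (1 * - cos (phi / 2 - t * phi))) with (cos (phi / 2 - t * phi)) by ring.
      destruct (Rle_lt_dec 0 (phi / 2 - t * phi)).
      - apply cos_decr_1; lra.
      - rewrite <- (cos_neg (phi / 2 - t * phi)); apply cos_decr_1; lra. }
    unfold c in *; lra. }
  assert (Him : Im z < 0).
  { specialize (Hpos 0 ltac:(lra)).
    replace (Ci * z * Cexp (0 * (Ci * phi)))%C with (z * Ci)%C in Hpos.
    - rewrite re_mult_Ci in Hpos; lra.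
    - replace (0 * (Ci * phi))%C with (RtoC 0) by ring; rewrite Cexp_0; ring. }
  pose proof (F_integrand_fp N alpha beta z Ha Him HN) as H; fold b in H.
  rewrite <- (HFP z Him) in H.
  assert (Sh := integrand_fp_shift N alpha b (- Ci) (Ci * z) (Ci * phi) (F z) c ltac:(lra) Hb Hc).
  fold (rotated alpha phi) (pol z) in Sh.
  specialize (fun Hp => Sh Hp H).
  match type of Sh with ?A -> _ => assert (HA : A) end.
  { intros t Ht; split; [|now apply Hpos].
    replace (- Ci * Cexp (alpha * (t * (Ci * phi))))%C with (rotated alpha (t * phi)).
    - rewrite Re_rotated; apply sin_ge_0; nra.
    - unfold rotated; f_equal; f_equal; rewrite RtoC_mult; ring. }
  specialize (Sh HA).
  assert (E := fp_unique _ _ _ _ Sh (HPhi _)).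
  unfold G; rewrite <- E.
  rewrite Ephi'; ring.
Qed.

Lemma Cmod_term (alpha : R) (beta : C) (n : nat) (B : R) :
  exists K, 0 <= K /\ forall theta r : R, 1 <= r -> Rabs (theta + PI / 2) <= B ->
    Cmod (expansion_term alpha beta theta r n)
    <= K * Rpower r (- Re beta - INR n * alpha - 1).
Proof.
set (w := (beta + 1 + INR n * alpha)%C).
exists (Cmod (exp_coef Ci n) * (exp (Rabs (Im w) * B) * Cmod (Gamma_star w))); split.
{ repeat apply Rmult_le_pos; try apply Cmod_ge_0; left; apply exp_pos. }
intros theta r Hr HB; rewrite expansion_term_eq; fold w.
rewrite !Cmod_mult, Cmod_Cexp, Rmult_assoc.
apply Rmult_le_compat_l; [apply Cmod_ge_0|].
replace (exp (Rabs (Im w) * B) * Cmod (Gamma_star w) * Rpower r (- Re beta - INR n * alpha - 1))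
  with (exp (Rabs (Im w) * B) * Rpower r (- Re beta - INR n * alpha - 1) * Cmod (Gamma_star w)) by ring.
apply Rmult_le_compat_r; [apply Cmod_ge_0|].
unfold Rpower; rewrite <- exp_plus; apply exp_le.
assert (E : Re (- (w * log_iz theta r))%C = - Re w * ln r + Im w * (theta + PI / 2)).
{ unfold log_iz, Re, Im; simpl; ring. }
assert (Ew : Re w = Re beta + 1 + INR n * alpha).
{ unfold w; rewrite !re_plus, re_scal_l, !re_RtoC; ring. }
rewrite E, Ew.
assert (Im w * (theta + PI / 2) <= Rabs (Im w) * B).
{ eapply Rle_trans; [apply Rle_abs|]; rewrite Rabs_mult.
  apply Rmult_le_compat_l; [apply Rabs_pos|exact HB]. }
lra.
Qed.

(** The expansion is first proved with so many terms that the counterterms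
    include all divergent exponents; the superfluous terms go into the error. *)
Lemma fewer_terms (alpha : R) (beta : C) (F : C -> C) (T : R -> Prop) (B : R) (N d : nat) :
  0 <= alpha -> (forall theta, T theta -> Rabs (theta + PI / 2) <= B) ->
  (exists K, forall theta r, T theta -> 1 <= r ->
    Cmod (F (RtoC r * Cexp (Ci * theta)) + log_sum alpha beta theta r
          - Csum (expansion_term alpha beta theta r) (N + d))%C
    <= K * Rpower r (- Re beta - INR (N + d) * alpha - 1)) ->
  exists K, forall theta r, T theta -> 1 <= r ->
    Cmod (F (RtoC r * Cexp (Ci * theta)) + log_sum alpha beta theta r
          - Csum (expansion_term alpha beta theta r) N)%C
    <= K * Rpower r (- Re beta - INR N * alpha - 1).
Proof.
intros Ha HT; induction d as [|d IH]; intros [K HK].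
- rewrite Nat.add_0_r in HK; now exists K.
- apply IH; rewrite Nat.add_succ_r in HK.
  destruct (Cmod_term alpha beta (N + d) B) as (K' & HK' & Hterm).
  exists (Rmax K 0 + K'); intros theta r Hth Hr.
  specialize (HK theta r Hth Hr); specialize (Hterm theta r Hr (HT theta Hth)).
  simpl Csum in HK.
  set (X := Csum (expansion_term alpha beta theta r) (N + d)) in *.
  set (t := expansion_term alpha beta theta r (N + d)) in *.
  match goal with |- Cmod (?Y - X)%C <= _ =>
    replace (Y - X)%C with ((Y - (X + t)) + t)%C by ring end.
  eapply Rle_trans; [apply Cmod_triangle|].
  set (p := Rpower r (- Re beta - INR (N + d) * alpha - 1)) in *.
  assert (Hp : 0 < p) by apply exp_pos.
  assert (Hle : Rpower r (- Re beta - INR (S (N + d)) * alpha - 1) <= p).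
  { unfold p, Rpower; apply exp_le; rewrite S_INR.
    assert (0 <= ln r) by (rewrite <- ln_1; apply ln_le; lra).
    apply Rmult_le_compat_r; [assumption|lra]. }
  set (p' := Rpower r (- Re beta - INR (S (N + d)) * alpha - 1)) in *.
  assert (0 < p') by apply exp_pos.
  pose proof (Rmax_l K 0); pose proof (Rmax_r K 0).
  assert (K * p' <= Rmax K 0 * p') by (apply Rmult_le_compat_r; lra).
  assert (Rmax K 0 * p' <= Rmax K 0 * p) by (apply Rmult_le_compat_l; lra).
  lra.
Qed.

Lemma sector_expansion (alpha : R) (beta : C) (F : C -> C) (eps : R) :
  1 < alpha -> is_F alpha beta F -> 0 < eps ->
  expansion_on alpha beta F
    (fun theta => - PI - PI / alpha + eps <= theta <= - eps).
Proof.
intros Ha HF He N0.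
pose proof PI_RGT_0 as HPI.
assert (HPa : 0 < PI / alpha) by (apply Rdiv_lt_0_compat; lra).
assert (HPa' : PI / alpha < PI).
{ apply Rmult_lt_reg_r with alpha; [lra|].
  unfold Rdiv; rewrite Rmult_assoc, Rinv_l by lra; nra. }
set (K := (N0 + index_bound beta)%nat).
(* Two terms more than needed are taken because [entire_finite_part]
   differentiates twice. *)
set (N := S (S K)).
assert (HN : (index_bound beta <= N)%nat) by (unfold N, K; lia).
set (e := Rmin (eps / 2) (PI / alpha / 2)).
(* The bound [(pi - pi / alpha) / 2] makes the sectors of the two rays overlap:
   an angle below [- pi + delta] is below [- delta] after adding [phi]. *)
set (delta := Rmin (eps / 2) (Rmin ((PI - PI / alpha) / 2) (PI / 2))).
set (phi := PI / alpha - e).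
assert (He1 : e <= eps / 2) by apply Rmin_l.
assert (He2 : e <= PI / alpha / 2) by apply Rmin_r.
assert (He0 : 0 < e) by (apply Rmin_pos; lra).
assert (Hd1 : delta <= eps / 2) by apply Rmin_l.
assert (Hd23 : delta <= Rmin ((PI - PI / alpha) / 2) (PI / 2)) by apply Rmin_r.
pose proof (Rmin_l ((PI - PI / alpha) / 2) (PI / 2)); pose proof (Rmin_r ((PI - PI / alpha) / 2) (PI / 2)).
assert (Hd0 : 0 < delta) by (repeat apply Rmin_pos; lra).
assert (Hphi : 0 < phi < PI / alpha) by (unfold phi; lra).
assert (Hap : 0 <= sin (alpha * phi)).
{ apply sin_ge_0; [nra|].
  replace PI with (alpha * (PI / alpha)) by (field; lra).
  apply Rmult_le_compat_l; lra. }
destruct (ray_expansion (S K) alpha beta F 0 delta Ha HN) as [K1 HK1].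
{ rewrite Rmult_0_r, sin_0; lra. } { lra. }
destruct (ray_expansion (S K) alpha beta F phi delta Ha HN Hap) as [K2 HK2].
{ lra. }
destruct (fewer_terms alpha beta F
  (fun theta => - PI - PI / alpha + eps <= theta <= - eps) (2 * PI) N0 (N - N0)) as [K0 HK0].
- lra.
- intros theta Hth; apply Rabs_le; lra.
- replace (N0 + (N - N0))%nat with N by (unfold N, K; lia).
  exists (Rmax K1 K2); intros theta r Hth Hr.
  assert (Hp : 0 < Rpower r (- Re beta - INR N * alpha - 1)) by apply exp_pos.
  pose proof (Rmax_l K1 K2); pose proof (Rmax_r K1 K2).
  destruct (Rle_lt_dec (- PI + delta) theta) as [Hcase|Hcase].
  + apply Rle_trans with (K1 * Rpower r (- Re beta - INR N * alpha - 1));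
      [|apply Rmult_le_compat_r; lra].
    apply HK1; [exact Hr|lra|].
    assert (Him : Im (r * Cexp (Ci * theta))%C < 0).
    { pose proof (Re_Ci_polar theta r) as E; rewrite Cmult_comm, re_mult_Ci in E.
      assert (0 < sin (- theta)) by (apply sin_gt_0; lra).
      rewrite sin_neg in *; nra. }
    pose proof (F_integrand_fp N alpha beta _ Ha Him HN) as HFP.
    rewrite <- (proj2 HF _ Him) in HFP.
    replace (rotated alpha 0) with (- Ci)%C.
    2:{ unfold rotated; replace (alpha * (Ci * 0))%C with (RtoC 0) by ring; rewrite Cexp_0; ring. }
    replace (Cexp (Ci * 0)) with (RtoC 1)
      by (replace (Ci * 0)%C with (RtoC 0) by ring; now rewrite Cexp_0).
    rewrite Cmult_1_r.
    replace (ray_value _ _ _ _ _ _) with (F (r * Cexp (Ci * theta))%C); [exact HFP|].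
    unfold ray_value; replace (- ((beta + 1) * (Ci * 0)))%C with (RtoC 0) by ring.
    rewrite Cexp_0; ring.
  + apply Rle_trans with (K2 * Rpower r (- Re beta - INR N * alpha - 1));
      [|apply Rmult_le_compat_r; lra].
    apply HK2; [exact Hr|unfold phi; lra|].
    now apply rotation_continues.
- exists K0, 1; split; [lra|]; intros theta r Hth Hr; now apply HK0.
Qed.

Theorem mainTheorem2 :
  forall (alpha : R) (beta : C) (F : C -> C),
    1 < alpha ->
    is_F alpha beta F ->
    (forall theta : R, - PI - PI / alpha < theta < 0 ->
       expansion_on alpha beta F (fun theta' => theta' = theta)) /\
    (forall eps : R, 0 < eps ->
       expansion_on alpha beta F
         (fun theta => - PI - PI / alpha + eps <= theta <= - eps)).
Proof.
intros alpha beta F Ha HF; split.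
- intros theta Hth N.
  set (eps := Rmin (- theta) (theta + PI + PI / alpha)).
  assert (He : 0 < eps) by (apply Rmin_pos; lra).
  assert (eps <= - theta) by apply Rmin_l.
  assert (eps <= theta + PI + PI / alpha) by apply Rmin_r.
  destruct (sector_expansion alpha beta F eps Ha HF He N) as (K & r0 & Hr0 & HK).
  exists K, r0; split; [exact Hr0|]; intros theta' r -> Hr; apply HK; [lra|exact Hr].
- intros eps He; now apply sector_expansion.
Qed.
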